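(* Let $\beta>0$, let $q$ be an integer with $\beta\sin^2(\frac{\pi}{q})<1$, and let $T_f\in(0,\infty)$. Let $\nu'_0\in\mathcal P(\{1,\dots,q\})$ and let $\nu'_{0,N}\in E_N$ be deterministic with $\nu'_{0,N}\to\nu'_0$. Let $(X^N_t)_{t\ge0}$ be the Markov jump process on $E_N$ with generator $Q_N^{emp}$ and $X^N_0=\nu'_{0,N}$. Then the ODE $\frac{d}{dt}\phi(t,\nu'_0)=F(\phi(t,\nu'_0))$, $\phi(0,\nu'_0)=\nu'_0$, has a unique solution on $[0,T_f]$ in $\mathcal P(\{1,\dots,q\})$, and for every $\varepsilon>0$ $$\lim_{N\to\infty}\mathbb P\Big(\sup_{0\le t\le T_f}\|X^N_t-\phi(t,\nu'_0)\|>\varepsilon\Big)=0.$$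
   Context: $S^1\cong[0,2\pi)$, $\alpha$ Lebesgue measure on $S^1$, $e_s=(\cos s,\sin s)$. Scalar-product potential $\Phi(\nu)=-\frac\beta2\|\int e_s\nu(ds)\|^2$. $S_k=[\tfrac{2\pi}{q}(k-1),\tfrac{2\pi}{q}k)$, $T(s)=k$ iff $s\in S_k$ (sitewise on configurations, by image on measures, $T(\nu)(k)=\nu(S_k)$); indices $k$ modulo $q$ in $\{1,\dots,q\}$. $S(\nu|\alpha)$ is relative entropy. $E_N$ = probability vectors $\nu'$ on $\{1,\dots,q\}$ with $N\nu'(l)\in\mathbb Z$. Finite-$N$ rates: for $\sigma'\in\{1,\dots,q\}^N$ with $\sigma'_i=k$, $L_N(\sigma')=\nu'$, set $c_N^{emp}(k,\nu')=\dfrac{\int_{T^{-1}(\sigma'_{V_N\setminus i})}\exp(-N\Phi(\frac1N\delta_{\frac{2\pi}{q}k}+\frac1N\sum_{j\ne i}\delta_{\sigma_j}))\alpha^{\otimes(N-1)}(d\sigma_{V_N\setminus i})}{\int_{T^{-1}(\sigma')}\exp(-N\Phi(\frac1N\sum_j\delta_{\sigma_j}))\alpha^{\otimes N}(d\sigma)}$ (independent of the choice of $\sigma',i$). Generator: $Q_N^{emp}f(\nu')=N\sum_{k=1}^q\nu'(k)c_N^{emp}(k,\nu')\big(f(\nu'+\frac1N(\delta_{k+1}-\delta_k))-f(\nu')\big)$. Limiting objects: for $\nu'\in\mathcal P(\{1,\dots,q\})$, $\nu^{\nu'}$ is the unique minimizer of $\Phi(\nu)+S(\nu|\alpha)$ over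 $\{\nu\in\mathcal P(S^1):T(\nu)=\nu'\}$ (unique under $\beta\sin^2(\pi/q)<1$), $M_\beta(\nu')=\int e_\omega\nu^{\nu'}(d\omega)$, $c(k,\nu')=e^{\beta\langle e_{2\pi k/q},M_\beta(\nu')\rangle}/\int_{S_k}e^{\beta\langle e_\omega,M_\beta(\nu')\rangle}\alpha(d\omega)$, and $F(\nu')(k)=c(k-1,\nu')\nu'(k-1)-c(k,\nu')\nu'(k)$, $k=1,\dots,q$. $\|\cdot\|$ is any norm on $\mathbb R^q$. *)

(* Defs.v *)
From mathcomp Require Import all_boot all_order all_algebra.
From mathcomp Require Import all_classical all_reals all_analysis.
Set Implicit Arguments. Unset Strict Implicit. Unset Printing Implicit Defensive.
Import Order.TTheory GRing.Theory Num.Theory numFieldNormedType.Exports.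
Local Open Scope ring_scope.
Local Open Scope classical_set_scope.

(* Conventions.
   - The circle S^1 is identified with [0, 2 pi) (a subset of R); alpha is
     the Lebesgue measure restricted to [0, 2 pi).
   - The spin values {1,...,q} are encoded by 'I_q, the paper's label k
     corresponding to the ordinal k-1.  Hence the paper's
     S_k = [2pi(k-1)/q, 2pi k/q) is [cell q j] = [2pi j/q, 2pi(j+1)/q) for
     j = k-1, the paper's point 2pi k/q is [cell_pt q j] = 2pi(j+1)/q,
     and "k+1 modulo q" / "k-1 modulo q" are [ordS] / [ord_pred].
   - Probability vectors on {1..q} are row vectors 'rV[R]_q. *)

Section Defs.
Variable R : realType.

Definition circle : set R := `[0, 2 * pi[.

Definition cell (q : nat) (j : 'I_q) : set R :=
  `[2 * pi * j%:R / q%:R, 2 * pi * j.+1%:R / q%:R[.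

Definition cell_pt (q : nat) (j : 'I_q) : R := 2 * pi * j.+1%:R / q%:R.

Definition alpha := (@lebesgue_measure R).

Definition dot_e (s : R) (M : R * R) : R := cos s * M.1 + sin s * M.2.

Definition probvec (q : nat) (v : 'rV[R]_q) : Prop :=
  (forall k, 0 <= v ord0 k) /\ \sum_k v ord0 k = 1.

(* A probability measure nu on S^1 with finite relative entropy w.r.t.
   alpha has a density f = dnu/dalpha; we represent nu by f. *)
Definition density_with_marginal (q : nat) (nu' : 'rV[R]_q) (f : R -> R) : Prop :=
  [/\ measurable_fun circle f,
      (forall s, 0 <= f s),
      ((\int[alpha]_(s in circle) (f s)%:E)%E = 1%E)
    & (forall k : 'I_q, (\int[alpha]_(s in cell k) (f s)%:E)%E = (nu' ord0 k)%:E)].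

Definition mean_e (f : R -> R) : R * R :=
  (Rintegral alpha circle (fun s => cos s * f s),
   Rintegral alpha circle (fun s => sin s * f s)).

Definition Phi_dens (beta : R) (f : R -> R) : R :=
  - (beta / 2) * ((mean_e f).1 ^+ 2 + (mean_e f).2 ^+ 2).

(* relative entropy S(nu|alpha) = int f log f dalpha (convention 0 log 0 = 0) *)
Definition rel_entropy (f : R -> R) : \bar R :=
  (\int[alpha]_(s in circle) (f s * ln (f s))%:E)%E.

Definition free_energy (beta : R) (f : R -> R) : \bar R :=
  ((Phi_dens beta f)%:E + rel_entropy f)%E.

Definition is_constrained_minimizer (beta : R) (q : nat) (nu' : 'rV[R]_q)
    (f : R -> R) : Prop :=
  density_with_marginal nu' f /\
  forall g, density_with_marginal nu' g -> (free_energy beta f <= free_energy beta g)%E.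

(* nu^{nu'} : the (a.e.-unique) minimizer *)
Definition nu_min (beta : R) (q : nat) (nu' : 'rV[R]_q) : R -> R :=
  xget (fun _ => 0) [set f | is_constrained_minimizer beta nu' f].

Definition M_beta (beta : R) (q : nat) (nu' : 'rV[R]_q) : R * R :=
  mean_e (nu_min beta nu').

Definition rate_c (beta : R) (q : nat) (k : 'I_q) (nu' : 'rV[R]_q) : R :=
  expR (beta * dot_e (cell_pt k) (M_beta beta nu')) /
  Rintegral alpha (cell k) (fun w => expR (beta * dot_e w (M_beta beta nu'))).

Definition Fvec (beta : R) (q : nat) (nu' : 'rV[R]_q) : 'rV[R]_q :=
  \row_k (rate_c beta (ord_pred k) nu' * nu' ord0 (ord_pred k)
          - rate_c beta k nu' * nu' ord0 k).

(* E_N : encoded by the occupation numbers N nu'(l) *)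
Definition EN (q N : nat) : finType :=
  {n : {ffun 'I_q -> 'I_N.+1} | \sum_k (n k : nat) == N}.

Definition emb (q N : nat) (x : EN q N) : 'rV[R]_q :=
  \row_k (((val x k : nat)%:R : R) / N%:R).

(* Phi(1/N sum_j delta_{s_j}) for a list of points *)
Definition Phi_emp (beta : R) (N : nat) (pts : seq R) : R :=
  - (beta / 2) * ((\sum_(s <- pts) cos s / N%:R) ^+ 2
                  + (\sum_(s <- pts) sin s / N%:R) ^+ 2).

Fixpoint iint (q : nat) (ls : seq 'I_q) (g : seq R -> R) : R :=
  match ls with
  | [::] => g [::]
  | l :: ls' => Rintegral alpha (cell l) (fun x => iint ls' (fun s => g (x :: s)))
  end.

(* a configuration sigma' with L_N(sigma') = nu' (sorted labels) *)
Definition config (q N : nat) (x : EN q N) : seq 'I_q :=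
  flatten [seq nseq (val x l : nat) l | l <- enum 'I_q].

(* c_N^emp(k, nu'), computed with sigma' = config x and i a site with label k
   (the value is independent of these choices) *)
Definition rate_cN (beta : R) (q N : nat) (k : 'I_q) (x : EN q N) : R :=
  iint (rem k (config x))
       (fun s => expR (- N%:R * Phi_emp beta N (cell_pt k :: s))) /
  iint (config x) (fun s => expR (- N%:R * Phi_emp beta N s)).

Definition is_move (q N : nat) (x : EN q N) (k : 'I_q) (y : EN q N) : bool :=
  [forall l, ((val y l : nat)%:Z == (val x l : nat)%:Z + (l == ordS k)%:Z - (l == k)%:Z)%R].

(* Q_N^emp as a matrix: (Q f)(x) = sum_y Q x y f y *)
Definition QN (beta : R) (q N : nat) (x y : EN q N) : R :=
  \sum_k N%:R * emb x ord0 k * rate_cN beta k x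
         * ((is_move x k y)%:R - (x == y)%:R).

Fixpoint Qpow (beta : R) (q N : nat) (n : nat) (x y : EN q N) : R :=
  match n with
  | 0 => (x == y)%:R
  | n'.+1 => \sum_z Qpow beta n' x z * QN beta z y
  end.

Definition PtN (beta : R) (q N : nat) (t : R) (x y : EN q N) : R :=
  limn (series (fun n => t ^+ n / (n`!)%:R * Qpow beta n x y)).

Fixpoint fdd_prod (beta : R) (q N : nat) (t0 : R) (x0 : EN q N)
    (s : seq (R * EN q N)) : R :=
  match s with
  | [::] => 1
  | (t, x) :: s' => PtN beta (t - t0) x0 x * fdd_prod beta t x s'
  end.

Definition is_MJP (beta : R) (q N : nat) (d : measure_display)
    (Omega : measurableType d) (P : probability Omega R)
    (X : R -> Omega -> EN q N) (x0 : EN q N) : Prop :=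
  [/\ (forall t (x : EN q N), measurable [set w | X t w = x]),
      (forall w t, 0 <= t -> exists2 delta : R, 0 < delta &
          forall s, t <= s < t + delta -> X s w = X t w),
      (forall w t, 0 < t -> exists x : EN q N, exists2 delta : R, 0 < delta &
          forall s, t - delta < s < t -> X s w = x)
    & (forall s : seq (R * EN q N),
          path (fun a b => a.1 <= b.1) (0, x0) s ->
          P [set w | all (fun p => X p.1 w == p.2) s] = (fdd_prod beta 0 x0 s)%:E)].

Definition is_ode_sol (beta : R) (q : nat) (Tf : R) (nu0 : 'rV[R]_q)
    (phi : R -> 'rV[R]_q) : Prop :=
  [/\ phi 0 = nu0,
      (forall t, 0 <= t <= Tf -> probvec (phi t)),
      {within `[0, Tf], continuous phi}
    & (forall t, 0 < t < Tf -> is_derive t (1 : R) phi (Fvec beta (phi t)))].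

Definition is_norm (q : nat) (nrm : 'rV[R]_q -> R) : Prop :=
  [/\ (forall x y, nrm (x + y) <= nrm x + nrm y),
      (forall (a : R) x, nrm (a *: x) = `|a| * nrm x)
    & (forall x, nrm x = 0 -> x = 0)].

End Defs.

(* Main.v *)
Require Import Defs.
From mathcomp Require Import all_boot all_order all_algebra.
From mathcomp Require Import all_classical all_reals all_analysis.
From mathcomp Require Import measurable_realfun ring lra.
Import Order.TTheory GRing.Theory Num.Theory numFieldNormedType.Exports.
Local Open Scope ring_scope.
Local Open Scope classical_set_scope.
Set Implicit Arguments. Unset Strict Implicit. Unset Printing Implicit Defensive.

(** The constrained minimizer is an exponential tilt of Lebesgue measure on each
    cell, with a common parameter M equal to its own mean.  Projections of a cell
    have half-width at most sin(pi/q), so by Hoeffding's lemma the variances of the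
    tilted cell measures are at most sin^2(pi/q); hence beta sin^2(pi/q) < 1 makes the
    self-consistency functional strongly convex, M is unique, and M and the limiting
    rates are Lipschitz in the macrostate.  Linearizing the quadratic interaction
    (Hubbard-Stratonovich, with a sum over a grid replacing the Gaussian integral),
    the same strong convexity shows that the finite-N mean concentrates near M
    uniformly in the macrostate, so the finite-N rates converge uniformly.

    Let phi solve the limiting equation.  For a suitable L and any delta > 0,
    exp(-L t) |X_t - phi(t)|^2 + delta (T - t) has nonpositive drift once N is large.
    Ville's maximal inequality for this nonnegative supermartingale, applied along
    finite time grids through the finite-dimensional distributions, bounds the
    probability of a deviation; right-continuity of paths makes countably many times
    suffice. *)

(** Adding a unit vector e to a spin sum p multiplies exp(beta |p|^2 / 2N) by exp(beta <e, p/N>) up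
    to a constant. Hence both integrals in a finite-N rate run over the same N - 1 spins and differ
    only in the function of p/N that is averaged, and rate convergence becomes a law of large
    numbers for p/N. That law is obtained by raising the coupling from beta to gam = 1/sin^2(pi/q):
    there Hoeffding's bound exactly balances the Gaussian cost, exponential moments grow only
    polynomially in N, and the gap gam - beta pays for exponential decay. No log-partition function
    is differentiated: Jensen from below and Hoeffding from above act as its first- and second-order
    expansions. The limiting field is controlled only on the simplex, so the Picard scheme for the
    equation must stay there. The Lyapunov function is a squared distance because a jump of size 1/N
    changes it by a first-order term plus O(1/N^2); its summand in delta pays for a drift error that
    is small but not zero. *)

Section Calculus.
Variable R : realType.
Implicit Types (f g df : R -> R) (a b t : R).

Lemma nondecreasing_of_derive f df a b : a <= b ->
  {within `[a, b], continuous f} ->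
  (forall t, a < t < b -> is_derive t 1 f (df t)) ->
  (forall t, a < t < b -> 0 <= df t) -> f a <= f b.
Proof.
move=> ab cf dff df0.
apply: (@ger0_derive1_ndecr R f a b) => // t; rewrite in_itv/= => tab.
  exact: (@ex_derive _ _ _ _ _ _ _ (dff t tab)).
by rewrite derive1E (@derive_val _ _ _ _ _ _ _ (dff t tab)) df0.
Qed.

Lemma is_derive_continuous f a t : is_derive t 1 f a -> {for t, continuous f}.
Proof. by move=> h; apply: differentiable_continuous; apply/derivable1_diffP; case: h. Qed.

Lemma nondecreasing_of_derive_all f df a b : a <= b ->
  (forall t, a <= t <= b -> is_derive t 1 f (df t)) ->
  (forall t, a <= t <= b -> 0 <= df t) -> f a <= f b.
Proof.
move=> ab dff df0; apply: (@nondecreasing_of_derive f df) => //.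
- apply: continuous_in_subspaceT => t; rewrite inE/= in_itv/= => tab.
  exact: is_derive_continuous (dff t tab).
- by move=> t /andP[/ltW at_ /ltW tb]; apply: dff; rewrite at_.
- by move=> t /andP[/ltW at_ /ltW tb]; apply: df0; rewrite at_.
Qed.

(** Hoeffding's lemma for a Bernoulli variable. The difference [u] of the logarithms vanishes at 0
    together with its derivative [u1], and [u2] is 1/4 minus the variance of the tilted Bernoulli
    law, hence nonnegative; monotonicity is applied twice. *)
Lemma bernoulli_mgf_le (p h : R) : 0 <= p <= 1 -> 0 <= h ->
  1 - p + p * expR h <= expR (p * h + h ^+ 2 / 8).
Proof.
move=> /andP[p0 p1] h0.
pose D t := 1 - p + p * expR t.
have Dgt0 t : 0 <= t -> 0 < D t.
  move=> t0; rewrite /D; have : 1 <= expR t by rewrite -(@expR0 R) ler_expR.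
  by move=> e1; have := ler_wpM2l p0 e1; lra.
have dD t : is_derive t 1 D (p * expR t).
  by rewrite /D; apply: is_derive_eq; rewrite /GRing.scale/=; ring.
pose u1 t := p + t / 4 - p * expR t / D t.
pose u t := p * t + t ^+ 2 / 8 - ln (D t).
have du t : 0 <= t -> is_derive t 1 u (u1 t).
  move=> t0; have dln : is_derive t 1 (@ln R \o D) ((D t)^-1 * (p * expR t)).
    apply: is_derive1_comp; exact: is_derive1_ln (Dgt0 _ t0).
  rewrite /u; apply: is_derive_eq; rewrite /GRing.scale/= /u1; field.
  by rewrite gt_eqF// Dgt0.
pose u2 t := 1 / 4 - (p * expR t * (1 - p)) / (D t) ^+ 2.
have du1 t : 0 <= t -> is_derive t 1 u1 (u2 t).
  move=> t0; have D0 : D t != 0 by rewrite gt_eqF// Dgt0.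
  have dV : is_derive t 1 (fun s => (D s)^-1) (- (D t) ^- 2 * (p * expR t)).
    by apply: (@is_derive_eq _ _ _ _ _ _ _ _ (is_deriveV D0 (dD t))).
  rewrite /u1; apply: is_derive_eq; rewrite /GRing.scale/= /u2 /D; field.
  by rewrite -/(D t).
have u2ge0 t : 0 <= t -> 0 <= u2 t.
  move=> t0; rewrite /u2 subr_ge0 ler_pdivrMr ?exprn_gt0 ?Dgt0//.
  have := sqr_ge0 (1 - p - p * expR t); rewrite /D; nra.
have u1ge0 t : 0 <= t -> 0 <= u1 t.
  move=> t0; have -> : 0 = u1 0.
    by rewrite /u1 /D expR0; field; rewrite subrK oner_eq0.
  apply: (@nondecreasing_of_derive_all u1 u2 _ _ t0) => s /andP[s0 _].
    exact: du1.
  exact: u2ge0.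
have uge0 : 0 <= u h.
  have -> : 0 = u 0 by rewrite /u /D expR0 mulr1 subrK ln1; ring.
  apply: (@nondecreasing_of_derive_all u u1 _ _ h0) => s /andP[s0 _].
    exact: du.
  exact: u1ge0.
rewrite -/(D h) -[X in X <= _](@lnK R); last by rewrite posrE Dgt0.
by rewrite ler_expR -subr_ge0.
Qed.

End Calculus.

(** * Tilted averages on the cells and the mean-field equation *)

Section IntervalIntegral.
Variable R : realType.
Implicit Types (f g : R -> R) (a b : R).

Definition ci a b f : R := Rintegral (@alpha R) `[a, b[ f.

Lemma ci_integrable a b f : continuous f ->
  (@alpha R).-integrable `[a, b[ (EFin \o f).
Proof.
move=> cf; have : (@alpha R).-integrable `[a, b] (EFin \o f).
  apply: continuous_compact_integrable; first exact: segment_compact.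
  exact: continuous_subspaceT.
apply: integrableS => //.
by move=> x /=; rewrite !in_itv/= => /andP[-> /ltW].
Qed.

Lemma ci_cst a b (r : R) : a <= b -> ci a b (fun=> r) = r * (b - a).
Proof.
move=> ab; rewrite /ci Rintegral_cst//; congr (_ * _).
have := @lebesgue_measure_itv R `[a, b[%R; rewrite /alpha /= => ->.
rewrite lte_fin; case: ltP => //= ba; apply/eqP; rewrite eq_sym subr_eq0; apply/eqP/le_anti.
by rewrite ab ba.
Qed.

Lemma eq_ci a b f g : (forall x, a <= x < b -> f x = g x) -> ci a b f = ci a b g.
Proof. by move=> fg; apply: eq_Rintegral => x; rewrite inE/= in_itv/=; exact: fg. Qed.

Lemma ciD a b f g : continuous f -> continuous g ->
  ci a b (fun x => f x + g x) = ci a b f + ci a b g.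
Proof. by move=> cf cg; rewrite /ci RintegralD//; exact: ci_integrable. Qed.

Lemma ciB a b f g : continuous f -> continuous g ->
  ci a b (fun x => f x - g x) = ci a b f - ci a b g.
Proof. by move=> cf cg; rewrite /ci RintegralB//; exact: ci_integrable. Qed.

Lemma ciZ a b (r : R) f : continuous f ->
  ci a b (fun x => r * f x) = r * ci a b f.
Proof. by move=> cf; rewrite /ci RintegralZl//; exact: ci_integrable. Qed.

Lemma le_ci a b f g : continuous f -> continuous g ->
  (forall x, a <= x < b -> f x <= g x) -> ci a b f <= ci a b g.
Proof.
move=> cf cg fg; apply: le_Rintegral; [by []|exact: ci_integrable|exact: ci_integrable|].
by move=> x; rewrite /= in_itv/=; exact: fg.
Qed.

Lemma ler_norm_ci a b f g : continuous f -> continuous g ->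
  (forall x, a <= x < b -> `|f x| <= g x) -> `|ci a b f| <= ci a b g.
Proof.
move=> cf cg fg; rewrite ler_norml; apply/andP; split.
  rewrite -mulN1r -ciZ//; apply: le_ci => //.
    by move=> x; apply: cvgM; [exact: cvg_cst|exact: cg].
  by move=> x xab; have := fg x xab; rewrite ler_norml mulN1r => /andP[].
by apply: le_ci => // x xab; have := fg x xab; rewrite ler_norml => /andP[].
Qed.

Lemma ci_split a b c f : a <= b -> b <= c -> continuous f ->
  ci a c f = ci a b f + ci b c f.
Proof.
move=> ab bc cf; rewrite /ci.
rewrite (@itv_bndbnd_setU _ _ _ (BLeft b)) ?bnd_simp//.
rewrite Rintegral_setU//.
- rewrite -itv_bndbnd_setU ?bnd_simp//; exact: ci_integrable.
- apply/disj_setPS => y [/=]; rewrite 2!in_itv/= => /andP[_ yx] /andP[].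
  by rewrite leNgt yx.
Qed.

End IntervalIntegral.

Section ExpTilt.
Variable R : realType.
Implicit Types (u v w : R * R) (x y a b : R).

Definition dotp u v : R := u.1 * v.1 + u.2 * v.2.
Definition sqn u : R := u.1 ^+ 2 + u.2 ^+ 2.

Lemma continuous_dot_e u : continuous (fun x => dot_e x u).
Proof.
move=> x; apply: cvgD; apply: cvgM; try exact: cvg_cst.
  exact: continuous_cos.
exact: continuous_sin.
Qed.

Lemma continuous_exp_dot_e u : continuous (fun x => expR (dot_e x u)).
Proof.
move=> x; apply: (@continuous_comp _ _ _ (fun x => dot_e x u) (@expR R)).
  exact: continuous_dot_e.
exact: continuous_expR.
Qed.

Lemma continuousM_fun (f g : R -> R) : continuous f -> continuous g ->
  continuous (fun x => f x * g x).
Proof. by move=> cf cg x; apply: cvgM; [exact: cf|exact: cg]. Qed.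

Lemma continuousD_fun (f g : R -> R) : continuous f -> continuous g ->
  continuous (fun x => f x + g x).
Proof. by move=> cf cg x; apply: cvgD; [exact: cf|exact: cg]. Qed.

Lemma continuous_cst_fun (c : R) : continuous (fun _ : R => c).
Proof. by move=> x; exact: cvg_cst. Qed.

Lemma dot_eD x u v : dot_e x (u + v) = dot_e x u + dot_e x v.
Proof. by rewrite /dot_e /=; ring. Qed.

Lemma abs_dot_e x u : `|dot_e x u| <= `|u.1| + `|u.2|.
Proof.
rewrite /dot_e (le_trans (ler_normD _ _))// !normrM lerD//.
  by rewrite ler_piMl// ler_norml cos_geN1 cos_le1.
by rewrite ler_piMl// ler_norml sin_geN1 sin_le1.
Qed.

Definition zint a b v : R := ci a b (fun x => expR (dot_e x v)).
(** Mean of e_s for the law on [a, b) with density proportional to exp<e_s, v>, i.e. the gradient of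
    [ln (zint a b v)]. [locked] keeps the quotients from unfolding. *)
Definition tmean a b v : R * R := locked
  (ci a b (fun x => cos x * expR (dot_e x v)) / zint a b v,
   ci a b (fun x => sin x * expR (dot_e x v)) / zint a b v).

Variables (a b : R).
Hypothesis ab : a < b.

Lemma zint_ge v : (b - a) * expR (- (`|v.1| + `|v.2|)) <= zint a b v.
Proof.
rewrite mulrC -ci_cst; last exact: ltW.
apply: le_ci; [exact: continuous_cst_fun|exact: continuous_exp_dot_e|].
move=> x _; rewrite ler_expR; have := abs_dot_e x v.
by rewrite ler_norml => /andP[].
Qed.

Lemma zint_gt0 v : 0 < zint a b v.
Proof.
apply: lt_le_trans (zint_ge v); rewrite mulr_gt0 ?expR_gt0//.
by rewrite subr_gt0.
Qed.

Lemma ci_dot_e u v :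
  ci a b (fun x => dot_e x u * expR (dot_e x v)) = zint a b v * dotp u (tmean a b v).
Proof.
have z0 : zint a b v != 0 by rewrite gt_eqF// zint_gt0.
transitivity (ci a b (fun x => u.1 * (cos x * expR (dot_e x v)) +
                               u.2 * (sin x * expR (dot_e x v)))).
  by apply: eq_ci => x _; rewrite /dot_e; ring.
have cc := continuousM_fun (@continuous_cos R) (@continuous_exp_dot_e v).
have cs := continuousM_fun (@continuous_sin R) (@continuous_exp_dot_e v).
rewrite ciD; try by apply: continuousM_fun => //; exact: continuous_cst_fun.
by rewrite !ciZ// /dotp /tmean -lock /=; field.
Qed.

Lemma tmean_bound v : `|(tmean a b v).1| <= 1 /\ `|(tmean a b v).2| <= 1.
Proof.
have z0 := zint_gt0 v.
suff H (f : R -> R) : continuous f -> (forall x, `|f x| <= 1) ->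
    `|ci a b (fun x => f x * expR (dot_e x v)) / zint a b v| <= 1.
  rewrite /tmean -lock; split; apply: H; [exact: continuous_cos| |exact: continuous_sin|] => x.
    by rewrite ler_norml cos_geN1 cos_le1.
  by rewrite ler_norml sin_geN1 sin_le1.
move=> cf f1; rewrite normrM normfV (gtr0_norm z0) ler_pdivrMr// mul1r.
apply: ler_norm_ci.
- exact: (continuousM_fun cf (@continuous_exp_dot_e v)).
- exact: continuous_exp_dot_e.
- by move=> x _; rewrite normrM [X in _ * X]gtr0_norm ?expR_gt0// ler_piMl// expR_ge0.
Qed.

(** The exponential lies above its tangent line at the tilted mean m of <e_x, u>, and the linear
    deviation from m averages to zero. Read on [ln zint], this is the supporting line, while the
    Hoeffding bound is the matching curvature bound. *)
Lemma zint_jensen v u :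
  zint a b v * expR (dotp u (tmean a b v)) <= zint a b (v + u).
Proof.
set m := dotp u _.
have ce := @continuous_exp_dot_e v.
have cd := continuousM_fun (@continuous_dot_e u) ce.
have -> : zint a b v * expR m =
    ci a b (fun x => expR m * ((1 - m) * expR (dot_e x v) + dot_e x u * expR (dot_e x v))).
  rewrite ciZ; last first.
    by apply: continuousD_fun => //; apply: continuousM_fun => //; exact: continuous_cst_fun.
  rewrite ciD//; last by apply: continuousM_fun => //; exact: continuous_cst_fun.
  by rewrite ciZ// ci_dot_e -/(zint a b v) -/m; ring.
apply: le_ci.
- apply: continuousM_fun; first exact: continuous_cst_fun.
  by apply: continuousD_fun => //; apply: continuousM_fun => //; exact: continuous_cst_fun.
- exact: continuous_exp_dot_e.
- move=> x _; rewrite dot_eD -mulrDl mulrA [leRHS]expRD [leRHS]mulrC.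
  rewrite ler_pM2r ?expR_gt0//.
  rewrite -[in leRHS](subrK m (dot_e x u)) [leRHS]expRD mulrC ler_pM2r ?expR_gt0//.
  by apply: le_trans (expR_ge1Dx _); lra.
Qed.

(* The exponential is bounded by its chord over the range of [dot_e ^~ u] on the
   interval, which has length at most [2 * r]. *)
Lemma zint_hoeffding v u (r : R) : 0 <= r ->
  (forall x y, a <= x < b -> a <= y < b -> dot_e x u - dot_e y u <= 2 * r) ->
  zint a b (v + u) <= zint a b v * expR (dotp u (tmean a b v) + r ^+ 2 / 2).
Proof.
move=> r0 hr.
have ce := @continuous_exp_dot_e v.
have cd := continuousM_fun (@continuous_dot_e u) ce.
pose E := [set dot_e x u | x in [set x | a <= x < b]].
have Ea : E (dot_e a u) by exists a => //=; rewrite lexx.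
have lbE y : a <= y < b -> lbound E (dot_e y u - 2 * r).
  by move=> yab _ [x xab <-]; have := hr y x yab xab; lra.
have infE : has_inf E.
  by split; [exists (dot_e a u)|exists (dot_e a u - 2 * r); apply: lbE; rewrite lexx].
pose c := inf E.
have cle x : a <= x < b -> c <= dot_e x u.
  by move=> xab; apply: ge_inf; [exact: infE.2|exists x].
have lec x : a <= x < b -> dot_e x u <= c + 2 * r.
  move=> xab; rewrite -lerBlDr; apply: lb_le_inf; first exact: infE.1.
  exact: lbE.
set m := dotp u _.
have z0 := zint_gt0 v.
have cm : c <= m.
  rewrite -(ler_pM2l z0) -ci_dot_e mulrC -ciZ//.
  apply: le_ci => //; first by apply: continuousM_fun => //; exact: continuous_cst_fun.
  by move=> x xab; rewrite ler_pM2r ?expR_gt0// cle.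
have mc : m <= c + 2 * r.
  rewrite -(ler_pM2l z0) -ci_dot_e mulrC -ciZ//.
  apply: le_ci => //; first by apply: continuousM_fun => //; exact: continuous_cst_fun.
  by move=> x xab; rewrite ler_pM2r ?expR_gt0// lec.
(* For r = 0 the chord would divide by 2 r; the projection is then constant on the interval, equal
   to c and to its mean m. *)
have [rp|r_le0] := ltP 0 r; last first.
  have -> : r = 0 by apply/le_anti; rewrite r0 r_le0.
  have mE : m = c by lra.
  rewrite expr0n/= mul0r addr0 mE mulrC -ciZ//.
  apply: le_ci; [exact: continuous_exp_dot_e| |].
    by apply: continuousM_fun => //; exact: continuous_cst_fun.
  move=> x xab; rewrite dot_eD expRD mulrC ler_pM2r ?expR_gt0// ler_expR.
  by apply: (le_trans (lec x xab)); lra.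
pose p := (m - c) / (2 * r).
have p01 : 0 <= p <= 1.
  by rewrite /p divr_ge0 ?ler_pdivrMr ?mulr_gt0 ?mulr_ge0//=; lra.
(* [A + B * y] is the chord of exp over [c, c + 2 r]; at y = c + 2 r t it equals exp(c) (1 - t + t
   exp(2 r)). Its tilted average is exp(c) times the moment generating function at 2 r of a
   Bernoulli law with parameter [p]. *)
pose A := expR c * (1 + c * (1 - expR (2 * r)) / (2 * r)).
pose B := expR c * (expR (2 * r) - 1) / (2 * r).
have -> : dotp u (tmean a b v) + r ^+ 2 / 2 = c + (p * (2 * r) + (2 * r) ^+ 2 / 8).
  by rewrite -/m /p; field; lra.
apply: (@le_trans _ _ (zint a b v * (expR c * (1 - p + p * expR (2 * r))))); last first.
  rewrite ler_pM2l// expRD ler_pM2l ?expR_gt0//.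
  by apply: bernoulli_mgf_le => //; lra.
have -> : zint a b v * (expR c * (1 - p + p * expR (2 * r))) =
    ci a b (fun x => A * expR (dot_e x v) + B * (dot_e x u * expR (dot_e x v))).
  rewrite ciD; try by apply: continuousM_fun => //; exact: continuous_cst_fun.
  by rewrite !ciZ// ci_dot_e -/m -/(zint a b v) /A /B /p; field; lra.
apply: le_ci; first exact: continuous_exp_dot_e.
  by apply: continuousD_fun; apply: continuousM_fun => //; exact: continuous_cst_fun.
move=> x xab; rewrite dot_eD expRD mulrC mulrA -mulrDl ler_pM2r ?expR_gt0//.
pose t := (dot_e x u - c) / (2 * r).
have t01 : 0 <= t <= 1.
  have := cle x xab; have := lec x xab => ? ?.
  by rewrite /t divr_ge0 ?ler_pdivrMr ?mulr_gt0 ?mulr_ge0//=; lra.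
have -> : dot_e x u = c + t * (2 * r) by rewrite /t; field; lra.
have -> : A + B * (c + t * (2 * r)) = expR c * (1 - t + t * expR (2 * r)).
  by rewrite /A /B; field; lra.
rewrite expRD ler_pM2l ?expR_gt0//.
have := @convex_expR R (Itv01 (andP t01).1 (andP t01).2) (2 * r) 0.
rewrite !convRE expR0 /= mulr0 addr0 mulr1 => h.
by apply: (le_trans h); rewrite /unstable.onem; lra.
Qed.

End ExpTilt.

(** * Cells of the circle and the self-consistency equation for the mean *)

Section Cells.
Variables (R : realType) (q : nat).
Hypothesis q_gt1 : (1 < q)%N.
Implicit Types (u v M : R * R) (l k : 'I_q) (nu : 'rV[R]_q).

Let s : R := sin (pi / q%:R).
Let q0 : 0 < q%:R :> R. Proof. by rewrite ltr0n; case: q q_gt1. Qed.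

Definition clo l : R := 2 * pi * l%:R / q%:R.
Definition chi l : R := 2 * pi * l.+1%:R / q%:R.

Lemma chiE l : chi l = clo l + 2 * pi / q%:R.
Proof. by rewrite /chi /clo -natr1; field; rewrite gt_eqF. Qed.

Lemma clo_lt_chi l : clo l < chi l.
Proof. by rewrite chiE ltrDl divr_gt0// mulr_gt0// pi_gt0. Qed.

(** Points of one cell differ in angle by at most 2 pi / q, which is at most pi since q >= 2, and
    cos decreases on [0, pi]; so the chord |e_x - e_y| is at most 2 sin(pi / q). Cauchy-Schwarz,
    through Lagrange's identity, transfers this to the projection on u. *)
Lemma cell_dot_e_range l u x y : clo l <= x < chi l -> clo l <= y < chi l ->
  dot_e x u - dot_e y u <= 2 * (s * Num.sqrt (sqn u)).
Proof.
move=> /andP[x1 x2] /andP[y1 y2].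
have sq0 : 0 <= sqn u by rewrite /sqn addr_ge0 ?sqr_ge0.
have q2 : (2 : R) <= q%:R by rewrite ler_nat.
have p0 := pi_gt0 R.
have piq : pi / q%:R <= pi / 2 :> R by rewrite ler_pM2l// lef_pV2 ?posrE.
have piq0 : 0 < pi / q%:R :> R by rewrite divr_gt0.
have s0 : 0 <= s by apply: sin_ge0_pi; apply/andP; split; lra.
have dxy : `|x - y| <= 2 * (pi / q%:R).
  by move: x2 y2; rewrite chiE => x2 y2; rewrite ler_norml; apply/andP; split; lra.
have cxy : cos (2 * (pi / q%:R)) <= cos (x - y).
  rewrite -(cos_norm (x - y)) leNgt ltr_cos ?in_itv/= ?normr_ge0 -?leNgt//=; try by lra.
set d1 := cos x - cos y; set d2 := sin x - sin y.
have dd : d1 ^+ 2 + d2 ^+ 2 <= (2 * s) ^+ 2.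
  have -> : d1 ^+ 2 + d2 ^+ 2 = 2 - 2 * cos (x - y).
    have := cos2Dsin2 x; have := cos2Dsin2 y; rewrite cosB /d1 /d2; lra.
  move: cxy; rewrite mulr_natl cos_mulr2n -mulr_natl => cxy.
  by have := cos2Dsin2 (pi / q%:R : R); rewrite -/s; lra.
have -> : dot_e x u - dot_e y u = u.1 * d1 + u.2 * d2.
  by rewrite /dot_e /d1 /d2; ring.
apply: le_trans (ler_norm _) _.
rewrite -(@ler_pXn2r _ 2)// ?nnegrE ?normr_ge0//; last first.
  by rewrite !mulr_ge0// sqrtr_ge0.
rewrite real_normK ?num_real// !exprMn sqr_sqrtr//.
apply: (@le_trans _ _ (sqn u * (d1 ^+ 2 + d2 ^+ 2))).
  rewrite /sqn -subr_ge0.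
  have -> : (u.1 ^+ 2 + u.2 ^+ 2) * (d1 ^+ 2 + d2 ^+ 2) - (u.1 * d1 + u.2 * d2) ^+ 2
    = (u.1 * d2 - u.2 * d1) ^+ 2 by ring.
  exact: sqr_ge0.
by rewrite mulrA -exprMn mulrC; apply: ler_wpM2r.
Qed.

Definition zc l v : R := zint (clo l) (chi l) v.
Definition mc l v : R * R := tmean (clo l) (chi l) v.

Lemma zc_gt0 l v : 0 < zc l v.
Proof. exact: (zint_gt0 (clo_lt_chi l)). Qed.

Lemma zc_ge l v : 2 * pi / q%:R * expR (- (`|v.1| + `|v.2|)) <= zc l v.
Proof.
have := zint_ge (clo_lt_chi l) v.
by have -> : chi l - clo l = 2 * pi / q%:R by rewrite chiE addrAC subrr add0r.
Qed.

Lemma mc_bound l v : `|(mc l v).1| <= 1 /\ `|(mc l v).2| <= 1.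
Proof. exact: (tmean_bound (clo_lt_chi l)). Qed.

Lemma zc_jensen l v u : zc l v * expR (dotp u (mc l v)) <= zc l (v + u).
Proof. exact: (zint_jensen (clo_lt_chi l)). Qed.

Lemma zc_hoeffding l v u :
  zc l (v + u) <= zc l v * expR (dotp u (mc l v) + s ^+ 2 * sqn u / 2).
Proof.
have sq0 : 0 <= sqn u by rewrite /sqn addr_ge0 ?sqr_ge0.
have q2 : (2 : R) <= q%:R by rewrite ler_nat.
have piq0 : 0 < pi / q%:R :> R by rewrite divr_gt0 ?pi_gt0.
have s0 : 0 <= s.
  apply: sin_ge0_pi; rewrite ltW//= ler_pdivrMr// ler_peMr ?pi_ge0//; lra.
have := zint_hoeffding (clo_lt_chi l) v (mulr_ge0 s0 (sqrtr_ge0 (sqn u)))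
  (@cell_dot_e_range l u).
by rewrite exprMn sqr_sqrtr.
Qed.

Lemma ln_zc_jensen l v u : ln (zc l v) + dotp u (mc l v) <= ln (zc l (v + u)).
Proof.
rewrite -[dotp u _]expRK -lnM ?posrE ?zc_gt0 ?expR_gt0//.
by rewrite ler_ln ?posrE ?mulr_gt0 ?zc_gt0 ?expR_gt0// zc_jensen.
Qed.

Lemma ln_zc_hoeffding l v u :
  ln (zc l (v + u)) <= ln (zc l v) + dotp u (mc l v) + s ^+ 2 * sqn u / 2.
Proof.
rewrite -addrA -[dotp u _ + _]expRK -lnM ?posrE ?zc_gt0 ?expR_gt0//.
by rewrite ler_ln ?posrE ?mulr_gt0 ?zc_gt0 ?expR_gt0// zc_hoeffding.
Qed.

Lemma dotp_bound u m : `|m.1| <= 1 -> `|m.2| <= 1 -> `|dotp u m| <= `|u.1| + `|u.2|.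
Proof.
move=> m1 m2; rewrite /dotp (le_trans (ler_normD _ _))// !normrM.
by rewrite lerD// ler_piMr.
Qed.

(** The supporting lines at v and at w bound the difference from both sides, and their slopes are
    tilted means, whose coordinates are at most 1 in absolute value. *)
Lemma ln_zc_lip l v w : `|ln (zc l v) - ln (zc l w)| <= `|v.1 - w.1| + `|v.2 - w.2|.
Proof.
have h1 := ln_zc_jensen l v (w - v).
have h2 := ln_zc_jensen l w (v - w).
rewrite !subrKC in h1 h2.
have h3 := dotp_bound (v - w) (mc_bound l w).1 (mc_bound l w).2.
have h4 := dotp_bound (w - v) (mc_bound l v).1 (mc_bound l v).2.
have e1 : `|(w - v).1| = `|v.1 - w.1| by rewrite distrC.
have e2 : `|(w - v).2| = `|v.2 - w.2| by rewrite distrC.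
rewrite e1 e2 -[`|(v - w).1|]/(`|v.1 - w.1|) -[`|(v - w).2|]/(`|v.2 - w.2|) in h3 h4.
move: h1 h2 h3 h4; move: (ln (zc l v)) (ln (zc l w)) (dotp (w - v) (mc l v))
  (dotp (v - w) (mc l w)) `|v.1 - w.1| `|v.2 - w.2|.
move=> a b c d x y h1 h2; rewrite !ler_norml => /andP[? ?] /andP[? ?].
by apply/andP; split; lra.
Qed.

(** Log-partition function per spin at macrostate [nu] under the linear tilt v; [Psi] is its
    gradient. *)
Definition Lc nu v : R := \sum_k nu ord0 k * ln (zc k v).
Definition Psi nu v : R * R :=
  (\sum_k nu ord0 k * (mc k v).1, \sum_k nu ord0 k * (mc k v).2).

Lemma Lc_jensen nu v u : (forall k, 0 <= nu ord0 k) ->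
  Lc nu v + dotp u (Psi nu v) <= Lc nu (v + u).
Proof.
move=> nu0; rewrite /Lc /dotp /Psi/= !mulr_sumr -!big_split/=.
apply: ler_sum => k _; have := ler_wpM2l (nu0 k) (ln_zc_jensen k v u).
rewrite /dotp; move: (ln (zc k v)) (ln (zc k (v + u))) (mc k v).1 (mc k v).2 (nu _ _).
move=> *; lra.
Qed.

Lemma Lc_hoeffding nu v u : probvec nu ->
  Lc nu (v + u) <= Lc nu v + dotp u (Psi nu v) + s ^+ 2 * sqn u / 2.
Proof.
move=> [nu0 nu1].
have -> : s ^+ 2 * sqn u / 2 = \sum_k nu ord0 k * (s ^+ 2 * sqn u / 2).
  by rewrite -mulr_suml nu1 mul1r.
rewrite /Lc /dotp /Psi/= !mulr_sumr -!big_split/=.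
apply: ler_sum => k _; have := ler_wpM2l (nu0 k) (ln_zc_hoeffding k v u).
rewrite /dotp; move: (ln (zc k v)) (ln (zc k (v + u))) (mc k v).1 (mc k v).2 (nu _ _).
move=> *; lra.
Qed.

Lemma probvec_avg_bound nu (f : 'I_q -> R) : probvec nu -> (forall k, `|f k| <= 1) ->
  `|\sum_k nu ord0 k * f k| <= 1.
Proof.
move=> [nu0 nu1] f1; rewrite (le_trans (ler_norm_sum _ _ _))// -[leRHS]nu1.
by apply: ler_sum => k _; rewrite normrM ger0_norm// ler_piMr.
Qed.

Lemma Psi_bound nu v : probvec nu -> `|(Psi nu v).1| <= 1 /\ `|(Psi nu v).2| <= 1.
Proof.
by move=> pn; split; apply: probvec_avg_bound => // k; case: (mc_bound k v).
Qed.

Lemma Lc_lip nu v w : probvec nu ->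
  `|Lc nu v - Lc nu w| <= `|v.1 - w.1| + `|v.2 - w.2|.
Proof.
move=> [nu0 nu1]; rewrite /Lc -sumrB (le_trans (ler_norm_sum _ _ _))//.
rewrite -[leRHS]mul1r -nu1 mulr_suml; apply: ler_sum => k _.
by rewrite -mulrBr normrM ger0_norm// ler_wpM2l// ln_zc_lip.
Qed.

Lemma lipschitz_continuous2 (f : R * R -> R) (K : R) :
  (forall v w, `|f v - f w| <= K * (`|v.1 - w.1| + `|v.2 - w.2|)) -> continuous f.
Proof.
move=> fK p; apply/cvgrPdist_lt => e e0.
have K1 : 0 < `|K| + 1 by rewrite ltr_wpDl.
have c1 : (@fst R R) x @[x --> p] --> p.1 by exact: cvg_fst.
have c2 : (@snd R R) x @[x --> p] --> p.2 by exact: cvg_snd.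
have d0 : 0 < e / (2 * (`|K| + 1)) by rewrite divr_gt0// mulr_gt0.
near=> w.
have h1 : `|p.1 - w.1| < e / (2 * (`|K| + 1)) by near: w; move/cvgrPdist_lt : c1; exact.
have h2 : `|p.2 - w.2| < e / (2 * (`|K| + 1)) by near: w; move/cvgrPdist_lt : c2; exact.
apply: (le_lt_trans (fK p w)).
apply: (@le_lt_trans _ _ ((`|K| + 1) * (`|p.1 - w.1| + `|p.2 - w.2|))).
  apply: ler_wpM2r; first by rewrite addr_ge0.
  by apply: (le_trans (ler_norm K)); lra.
have : `|p.1 - w.1| + `|p.2 - w.2| < e / (`|K| + 1).
  have -> : e / (`|K| + 1) = e / (2 * (`|K| + 1)) + e / (2 * (`|K| + 1)).
    by field; lra.
  exact: ltrD.
by rewrite ltr_pdivlMr// mulrC.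
Unshelve. all: by end_near.
Qed.

Variable beta : R.
Hypotheses (beta_gt0 : 0 < beta) (beta_lt : beta * s ^+ 2 < 1).

Definition sc M : R * R := (beta * M.1, beta * M.2).
(** Dual form of the mean-field free energy, up to the entropy of [nu]: its gradient is beta (M -
    Psi nu (beta M)), so its critical points are the solutions of [is_fix]. *)
Definition Gf nu M : R := beta / 2 * sqn M - Lc nu (sc M).
Definition is_fix nu M := Psi nu (sc M) = M.

Lemma scD M N : sc (M + N) = sc M + sc N.
Proof. by rewrite /sc /= !mulrDr. Qed.

(** Let M minimize [Gf] on the square [-1, 1]^2 and let N = [Psi nu (sc M)], which lies in the
    square again. The Jensen bound gives Gf N <= Gf M - (beta / 2) |N - M|^2, so minimality forces N
    = M, even if M sits on the boundary. *)
Lemma is_fix_exists nu : probvec nu -> exists M, is_fix nu M.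
Proof.
move=> pn.
have cL : continuous (fun M => Lc nu (sc M)).
  apply: (@lipschitz_continuous2 _ beta) => v w.
  apply: (le_trans (Lc_lip _ _ pn)); rewrite /sc/= -!mulrBr !normrM.
  by rewrite (gtr0_norm beta_gt0) mulrDr.
have c1 : continuous (@fst R R) by move=> x; exact: cvg_fst.
have c2 : continuous (@snd R R) by move=> x; exact: cvg_snd.
have cG : continuous (Gf nu).
  move=> x; apply: cvgB; last exact: cL.
  apply: cvgM; first exact: cvg_cst.
  apply: cvgD; rewrite expr2.
    by apply: (@cvgM _ _ _ _ (fun y : R * R => y.1) (fun y : R * R => y.1)); exact: c1.
  by apply: (@cvgM _ _ _ _ (fun y : R * R => y.2) (fun y : R * R => y.2)); exact: c2.
pose A : set (R * R) := `[-1, 1] `*` `[-1, 1].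
have cA : compact A by apply: compact_setX; exact: segment_compact.
have A0 : A !=set0 by exists (0, 0); split; rewrite /= in_itv/=; apply/andP; split; lra.
have [M MA Mmin] := compact_EVT_min A0 cA (continuous_subspaceT cG).
exists M; have [N eN] : exists N, N = Psi nu (sc M) by exists (Psi nu (sc M)).
have NA : N \in A.
  have [h1 h2] := Psi_bound (sc M) pn; rewrite -eN in h1 h2.
  by rewrite inE; split; rewrite /= in_itv/= -ler_norml.
have := Mmin N NA.
have := Lc_jensen (sc M) (sc (N - M)) pn.1.
rewrite -scD subrKC -eN /Gf /dotp /sqn /sc/=.
move: (Lc _ _) (Lc _ _) => L1 L2 h1 h2.
have : (N.1 - M.1) ^+ 2 + (N.2 - M.2) ^+ 2 <= 0.
  rewrite -(@pmulr_rle0 _ (beta / 2)); last by rewrite divr_gt0.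
  by lra.
have := sqr_ge0 (N.1 - M.1); have := sqr_ge0 (N.2 - M.2) => k1 k2 k3.
have /eqP : (N.1 - M.1) ^+ 2 = 0 by lra.
have /eqP : (N.2 - M.2) ^+ 2 = 0 by lra.
rewrite !sqrf_eq0 !subr_eq0 => /eqP e2 /eqP e1.
by rewrite /is_fix -eN (surjective_pairing N) e1 e2; case: (M).
Qed.

(** As a function of M, [Lc nu (sc M)] has curvature at most beta^2 s^2 by Hoeffding, against beta
    for the quadratic term; at a fixed point the first-order terms cancel. *)
Lemma Gf_strong nu M M' : probvec nu -> is_fix nu M ->
  Gf nu M + beta / 2 * (1 - beta * s ^+ 2) * sqn (M' - M) <= Gf nu M'.
Proof.
move=> pn fM; have := Lc_hoeffding (sc M) (sc (M' - M)) pn.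
rewrite -scD subrKC fM /Gf /dotp /sqn /sc/=.
move: (Lc _ _) (Lc _ _) (s ^+ 2) => L1 L2 z; lra.
Qed.

(** Adding the two Hoeffding bounds for [nu], from M to M' and back, gives <M - P, M - M'> <= beta
    s^2 |M - M'|^2 with P = [Psi nu (sc M')]. Since M' = [Psi nu' (sc M')], each coordinate of P -
    M' is at most the l1 distance of the macrostates. The factor 2 compares the l1 and Euclidean
    norms of the plane. *)
Lemma is_fix_lip nu nu' M M' : probvec nu -> probvec nu' ->
  is_fix nu M -> is_fix nu' M' ->
  (1 - beta * s ^+ 2) * (`|M.1 - M'.1| + `|M.2 - M'.2|) <=
    2 * \sum_k `|nu ord0 k - nu' ord0 k|.
Proof.
move=> pn pn' fM fM'.
set P := Psi nu (sc M').
set dl := \sum_k _.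
have d1 : `|P.1 - M'.1| <= dl.
  rewrite -[in M'.1]fM' /P /Psi/= -sumrB (le_trans (ler_norm_sum _ _ _))//.
  apply: ler_sum => k _; rewrite -mulrBl normrM ler_piMr//.
  by case: (mc_bound k (sc M')).
have d2 : `|P.2 - M'.2| <= dl.
  rewrite -[in M'.2]fM' /P /Psi/= -sumrB (le_trans (ler_norm_sum _ _ _))//.
  apply: ler_sum => k _; rewrite -mulrBl normrM ler_piMr//.
  by case: (mc_bound k (sc M')).
have h1 := Lc_hoeffding (sc M) (sc (M' - M)) pn.
have h2 := Lc_hoeffding (sc M') (sc (M - M')) pn.
rewrite -!scD !subrKC in h1 h2.
rewrite fM -/P in h1 h2; move: d1 d2 h1 h2; clearbody P => d1 d2 h1 h2.
rewrite /dotp /sqn /sc/= in h1 h2.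
set D1 := M.1 - M'.1; set D2 := M.2 - M'.2.
have key : beta * ((1 - beta * s ^+ 2) * (D1 ^+ 2 + D2 ^+ 2)) <=
    beta * ((P.1 - M'.1) * D1 + (P.2 - M'.2) * D2).
  rewrite /D1 /D2; move: h1 h2.
  by move: (s ^+ 2) P.1 P.2 M.1 M.2 M'.1 M'.2 (Lc _ _) (Lc _ _) => *; lra.
rewrite ler_pM2l// in key; clear h1 h2; clearbody D1 D2.
set a := 1 - beta * s ^+ 2 in key *.
have a0 : 0 < a by rewrite /a subr_gt0.
set n := `|D1| + `|D2|.
have n0 : 0 <= n by rewrite addr_ge0.
have up : (P.1 - M'.1) * D1 + (P.2 - M'.2) * D2 <= dl * n.
  rewrite /n [leRHS]mulrDr lerD//.
    apply: (le_trans (ler_norm _)); rewrite normrM; apply: ler_wpM2r => //.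
  apply: (le_trans (ler_norm _)); rewrite normrM; apply: ler_wpM2r => //.
have lo : n ^+ 2 <= 2 * (D1 ^+ 2 + D2 ^+ 2).
  have e1 : D1 ^+ 2 = `|D1| ^+ 2 by rewrite real_normK ?num_real.
  have e2 : D2 ^+ 2 = `|D2| ^+ 2 by rewrite real_normK ?num_real.
  by rewrite /n e1 e2; have := sqr_ge0 (`|D1| - `|D2|); lra.
have fin : n * (a * n) <= n * (2 * dl).
  have : a * n ^+ 2 <= a * (2 * (D1 ^+ 2 + D2 ^+ 2)) by rewrite ler_pM2l.
  by rewrite expr2; lra.
have [np|nn] := ltP 0 n; first by rewrite ler_pM2l in fin.
have -> : n = 0 by apply/le_anti; rewrite n0 nn.
by rewrite mulr0 mulr_ge0// sumr_ge0.
Qed.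

End Cells.

(** A lower bound on a set of finite measure makes the negative part integrable, so failure of
    integrability comes from the positive part. This settles densities of infinite entropy. *)
Lemma integral_pinfty_of_ge d (T : measurableType d) (R : realType)
    (mu : {measure set T -> \bar R}) (D : set T) (f : T -> R) (c : R) :
  measurable D -> (mu D < +oo)%E -> measurable_fun D f -> 0 <= c ->
  (forall x, D x -> - c <= f x) -> ~ mu.-integrable D (EFin \o f) ->
  (\int[mu]_(x in D) (f x)%:E = +oo)%E.
Proof.
move=> mD muD mf c0 fc nL.
have mfE : measurable_fun D (EFin \o f) by exact/measurable_EFinP.
have neg : (\int[mu]_(x in D) ((EFin \o f)^\- x) < +oo)%E.
  apply: (@le_lt_trans _ _ (\int[mu]_(x in D) (c%:E))%E).
    apply: ge0_le_integral => //; first exact: measurable_funeneg.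
    move=> x Dx; rewrite funenegE/= -EFin_max lee_fin ge_max c0 andbT.
    by rewrite lerNl fc.
  by rewrite integral_cst// lte_mul_pinfty.
have neg0 : (0 <= \int[mu]_(x in D) ((EFin \o f)^\- x))%E by exact: integral_ge0.
rewrite integralE.
have [|] := ltP (\int[mu]_(x in D) ((EFin \o f)^\+ x))%E +oo%E; last first.
  rewrite leye_eq => /eqP ->; rewrite addye//.
  by move: neg neg0; case: (\int[_]_(x in _) _)%E.
move=> pos; case: nL; apply/integrableP; split => //.
rewrite (eq_integral (fun x => (EFin \o f)^\+ x + (EFin \o f)^\- x)%E); last first.
  by move=> x _; rewrite -/((abse \o (EFin \o f)) x) fune_abse.
rewrite ge0_integralD//; last 2 first.
- exact: measurable_funepos.
- exact: measurable_funeneg.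
by rewrite lte_add_pinfty.
Qed.

(** * The constrained minimizer *)

Section CircleIntegral.
Variable (R : realType).
Implicit Types (f g : R -> R).

Definition L1 f := (@alpha R).-integrable (@circle R) (EFin \o f).
Definition Ic f : R := Rintegral (@alpha R) (@circle R) f.

Lemma measurable_circle : measurable (@circle R). Proof. exact: measurable_itv. Qed.
Hint Resolve measurable_circle : core.

Lemma alpha_circle_lt_pinfty : ((@alpha R) (@circle R) < +oo)%E.
Proof.
have := @lebesgue_measure_itv R `[0, 2 * pi[%R; rewrite /alpha /circle /= => ->.
by case: ifP => // _; rewrite -EFinB ltry.
Qed.

Lemma L1_measurable f : L1 f -> measurable_fun (@circle R) f.
Proof. by move=> /integrableP[/measurable_EFinP]. Qed.

Lemma L1_bounded f (K : R) : measurable_fun (@circle R) f ->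
  (forall x, @circle R x -> `|f x| <= K) -> L1 f.
Proof.
move=> mf fK; apply: measurable_bounded_integrable => //.
  exact: alpha_circle_lt_pinfty.
by exists K; split; [exact: num_real|move=> M KM x cx; apply: (le_trans (fK x cx)); exact: ltW].
Qed.

Lemma L1M f g (K : R) : measurable_fun (@circle R) f ->
  (forall x, @circle R x -> `|f x| <= K) -> L1 g -> L1 (fun x => f x * g x).
Proof.
move=> mf fK Lg.
have LK : L1 (fun x => K * g x) by exact: (integrableZl _ _ Lg).
apply: le_integrable LK => //.
  by apply/measurable_EFinP; apply: measurable_funM => //; exact: L1_measurable.
move=> x cx /=; rewrite lee_fin !normrM ler_wpM2r//.
by apply: (le_trans (fK x cx)); exact: ler_norm.
Qed.

Lemma L1D f g : L1 f -> L1 g -> L1 (fun x => f x + g x).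
Proof. by move=> Lf Lg; exact: (integrableD _ Lf Lg). Qed.
Lemma L1B f g : L1 f -> L1 g -> L1 (fun x => f x - g x).
Proof. by move=> Lf Lg; exact: (integrableB _ Lf Lg). Qed.
Lemma L1Z f (r : R) : L1 f -> L1 (fun x => r * f x).
Proof. by move=> Lf; exact: (integrableZl _ _ Lf). Qed.
Lemma IcD f g : L1 f -> L1 g -> Ic (fun x => f x + g x) = Ic f + Ic g.
Proof. by move=> Lf Lg; exact: RintegralD. Qed.
Lemma IcB f g : L1 f -> L1 g -> Ic (fun x => f x - g x) = Ic f - Ic g.
Proof. by move=> Lf Lg; exact: RintegralB. Qed.
Lemma IcZ f (r : R) : L1 f -> Ic (fun x => r * f x) = r * Ic f.
Proof. by move=> Lf; exact: RintegralZl. Qed.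
Lemma le_Ic f g : L1 f -> L1 g -> (forall x, @circle R x -> f x <= g x) -> Ic f <= Ic g.
Proof. by move=> Lf Lg fg; apply: le_Rintegral. Qed.
Lemma eq_Ic f g : (forall x, @circle R x -> f x = g x) -> Ic f = Ic g.
Proof. by move=> fg; apply: eq_Rintegral => x; rewrite inE; exact: fg. Qed.
Lemma eq_L1 f g : (forall x, @circle R x -> f x = g x) -> L1 f -> L1 g.
Proof.
move=> fg Lf; apply: eq_integrable Lf => // x; rewrite inE /= => cx.
by rewrite fg.
Qed.

Lemma L1_sum (I : Type) (r : seq I) (F : I -> R -> R) :
  (forall i, L1 (F i)) -> L1 (fun x => \sum_(i <- r) F i x).
Proof.
move=> LF; elim: r => [|i r IH].
  rewrite (_ : (fun x => _) = cst 0); last by apply/funext => x; rewrite big_nil.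
  by apply: (@L1_bounded _ 0) => // x _; rewrite normr0.
by apply: eq_L1 (L1D (LF i) IH) => x _; rewrite big_cons.
Qed.

Lemma Ic_sum (I : Type) (r : seq I) (F : I -> R -> R) :
  (forall i, L1 (F i)) -> Ic (fun x => \sum_(i <- r) F i x) = \sum_(i <- r) Ic (F i).
Proof.
move=> LF; elim: r => [|i r IH].
  rewrite big_nil (@eq_Ic _ (fun=> 0)) => [|x _]; last by rewrite big_nil.
  by rewrite /Ic Rintegral_cst// mul0r.
rewrite big_cons -IH -IcD//; last exact: L1_sum.
by apply: eq_Ic => x _; rewrite big_cons.
Qed.

Lemma Ic_fin f : L1 f -> (\int[@alpha R]_(x in @circle R) (f x)%:E)%E = (Ic f)%:E.
Proof. by move=> Lf; rewrite /Ic /Rintegral fineK//; exact: integrable_fin_num. Qed.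

End CircleIntegral.

(** * Gibbs variational principle for the constrained free energy *)

Section Minimizer.
Variables (R : realType) (q : nat).
Hypothesis q_gt1 : (1 < q)%N.
Implicit Types (u v M : R * R) (l k : 'I_q) (nu : 'rV[R]_q) (w : 'I_q -> R) (f g : R -> R).
Hint Resolve measurable_circle : core.

Let q0 : 0 < q%:R :> R. Proof. by rewrite ltr0n; case: q q_gt1. Qed.

Lemma mem_cell k x : @cell R q k x <-> clo R k <= x < chi R k.
Proof. by rewrite /cell /= in_itv. Qed.

Lemma cell_sub_circle k : @cell R q k `<=` @circle R.
Proof.
move=> x /mem_cell/andP[h1 h2]; rewrite /circle/= in_itv/=; apply/andP; split.
  by apply: le_trans h1; rewrite /clo !mulr_ge0 ?invr_ge0 ?pi_ge0.
apply: (lt_le_trans h2); rewrite /chi ler_pdivrMr// ler_pM2l ?mulr_gt0 ?pi_gt0//.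
by rewrite ler_nat.
Qed.

Lemma cell_inj j k x : @cell R q j x -> @cell R q k x -> j = k.
Proof.
wlog : j k / (j <= k)%N => [H|jk].
  by have [jk|/ltnW kj] := leqP j k; [exact: H|move=> a b; rewrite (H k j)].
move=> /mem_cell/andP[_ h2] /mem_cell/andP[h3 _]; apply/val_inj/anti_leq.
rewrite jk/=; have := le_lt_trans h3 h2.
by rewrite /clo /chi ltr_pM2r ?invr_gt0// ltr_pM2l ?mulr_gt0 ?pi_gt0// ltr_nat ltnS.
Qed.

Lemma cell_cover x : @circle R x -> exists k, @cell R q k x.
Proof.
rewrite /circle/= in_itv/= => /andP[x0 x2].
have p2 : 0 < 2 * pi :> R by rewrite mulr_gt0 ?pi_gt0.
set y := x * q%:R / (2 * pi).
have y0 : 0 <= y by rewrite /y !mulr_ge0 ?invr_ge0 ?mulr_ge0 ?pi_ge0.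
have yq : y < q%:R by rewrite ltr_pdivrMr// mulrC ltr_pM2l.
have /andP[t1 t2] := truncn_itv y0.
have tq : (Num.truncn y < q)%N by rewrite -(ltr_nat R) (le_lt_trans t1).
exists (Ordinal tq); apply/mem_cell; rewrite /clo /chi/=.
have -> : x = 2 * pi * y / q%:R.
  by rewrite /y [2 * pi * _]mulrCA mulfV ?gt_eqF// mulr1 mulfK ?gt_eqF.
by rewrite ler_pM2r ?invr_gt0// ltr_pM2r ?invr_gt0// ler_pM2l// ltr_pM2l// t1 t2.
Qed.

Definition step w (x : R) : R := \sum_k w k * \1_(@cell R q k) x.

Lemma step_cell w k x : @cell R q k x -> step w x = w k.
Proof.
move=> ck; rewrite /step (bigD1 k)//= indicE mem_set//= mulr1 big1 ?addr0// => j jk.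
rewrite indicE memNset ?mulr0// => cj; move/eqP: jk; apply.
exact: cell_inj cj ck.
Qed.

Lemma measurable_step w : measurable_fun (@circle R) (step w).
Proof.
apply: measurable_sum => k; apply: measurable_funM => //.
apply: measurable_indic; exact: measurable_itv.
Qed.

Lemma step_bounded w : exists K, forall x, @circle R x -> `|step w x| <= K.
Proof.
exists (\sum_k `|w k|) => x _; rewrite /step (le_trans (ler_norm_sum _ _ _))//.
apply: ler_sum => k _; rewrite normrM ler_piMr// indicE.
by case: (_ \in _); rewrite ?normr1 ?normr0.
Qed.

Lemma L1_step w f : L1 f -> L1 (fun x => step w x * f x).
Proof.
by move=> Lf; have [K hK] := step_bounded w; apply: L1M hK Lf; exact: measurable_step.
Qed.

Lemma Ic_step w f : L1 f ->
  Ic (fun x => step w x * f x) = \sum_k w k * Rintegral (@alpha R) (@cell R q k) f.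
Proof.
move=> Lf.
have L1i k : L1 (fun x => \1_(@cell R q k) x * f x).
  apply: (@L1M _ _ _ 1) => // [|x _]; last first.
    by rewrite indicE; case: (_ \in _); rewrite ?normr1 ?normr0.
  by apply: measurable_indic; exact: measurable_itv.
rewrite (@eq_Ic _ _ (fun x => \sum_k w k * (\1_(@cell R q k) x * f x))); last first.
  by move=> x _; rewrite /step mulr_suml; apply: eq_bigr => k _; rewrite mulrA.
rewrite Ic_sum; last by move=> k; exact: L1Z.
apply: eq_bigr => k _; rewrite IcZ//; congr (_ * _).
have -> : @cell R q k = @circle R `&` @cell R q k.
  by rewrite setIC; apply/esym/setIidl; exact: cell_sub_circle.
rewrite Rintegral_mkcondr; apply: eq_Rintegral => x _.
rewrite patchE indicE; have -> : (x \in @circle R `&` @cell R q k) = (x \in @cell R q k).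
  apply/idP/idP; rewrite !inE => ck; first by case: ck.
  by split=> //; exact: cell_sub_circle ck.
by case: ifP => _; rewrite ?mul1r ?mul0r.
Qed.

Lemma measurable_dot_e v : measurable_fun (@circle R) (fun x => dot_e x v).
Proof.
apply: (measurable_funS measurableT) => //.
apply: continuous_measurable_fun; exact: continuous_dot_e.
Qed.

Lemma L1_continuous f : continuous f -> L1 f.
Proof. exact: ci_integrable. Qed.

(** Pointwise Gibbs inequality: ln x <= x - 1 at x = h / a, multiplied by a. Integrated over the
    circle, it compares the entropy of a density with a reference h. *)
Lemma entropy_gibbs (a h : R) : 0 <= a -> 0 < h -> a - h <= a * ln a - a * ln h.
Proof.
move=> a0 h0; have [->|an0] := eqVneq a 0; first by rewrite !mul0r; lra.
have ap : 0 < a by rewrite lt_neqAle eq_sym an0.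
have := @le_ln1Dx R (h / a - 1); rewrite subrKC ln_div ?posrE// => /(_ _) H.
have : ln h - ln a <= h / a - 1 by apply: H; rewrite ltrBDl subrr divr_gt0.
rewrite -(ler_pM2l ap) !mulrBr mulr1.
have -> : a * (h / a) = h by field.
by move: (a * ln h) (a * ln a) => *; lra.
Qed.

Variable beta : R.
Hypotheses (beta_gt0 : 0 < beta) (beta_lt : beta * sin (pi / q%:R) ^+ 2 < 1).

Lemma density_L1 nu f : density_with_marginal nu f -> L1 f.
Proof.
move=> [mf f0 f1 _]; apply/integrableP; split; first exact/measurable_EFinP.
under eq_integral => x _ do rewrite /= ger0_norm ?f0//.
by rewrite f1 ltry.
Qed.

Lemma measurable_entropy f : measurable_fun (@circle R) f ->
  measurable_fun (@circle R) (fun x => f x * ln (f x)).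
Proof. by move=> mf; apply: measurable_funM => //; exact: measurableT_comp. Qed.

Definition Hent nu : R := \sum_k nu ord0 k * ln (nu ord0 k).

Lemma mean_dotp f v : L1 f -> Ic (fun x => f x * dot_e x v) = dotp v (mean_e f).
Proof.
move=> Lf; have Lc : L1 (fun x => cos x * f x).
  apply: (@L1M _ _ _ 1) => // [|x _]; last by rewrite ler_norml cos_geN1 cos_le1.
  apply: (measurable_funS measurableT) => //.
  by apply: continuous_measurable_fun; exact: continuous_cos.
have Ls : L1 (fun x => sin x * f x).
  apply: (@L1M _ _ _ 1) => // [|x _]; last by rewrite ler_norml sin_geN1 sin_le1.
  apply: (measurable_funS measurableT) => //.
  by apply: continuous_measurable_fun; exact: continuous_sin.
rewrite (@eq_Ic _ _ (fun x => v.1 * (cos x * f x) + v.2 * (sin x * f x))); last first.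
  by move=> x _; rewrite /dot_e; ring.
by rewrite IcD ?IcZ//; exact: L1Z.
Qed.

(** Gibbs' inequality against the reference that is proportional to exp<e_x, v> on each cell. Its
    logarithm is a step function plus a linear functional of e_x, so only the marginal and the mean
    of f enter. *)
Lemma entropy_lower_bound nu f v : probvec nu -> density_with_marginal nu f ->
  L1 (fun x => f x * ln (f x)) ->
  Hent nu - Lc nu v + dotp v (mean_e f) <= Ic (fun x => f x * ln (f x)).
Proof.
move=> [nu0 nu1] df Lent; have Lf := density_L1 df; have [mf f0 f1 fk] := df.
(* Smearing [nu] by [e] keeps the reference density positive on empty cells. *)
apply/ler_addgt0Pr => e e0.
set d := e / q%:R; have d0 : 0 < d by rewrite divr_gt0.
pose w k := (nu ord0 k + d) / zc k v.
have w0 k : 0 < w k by rewrite divr_gt0 ?zc_gt0// ltr_wpDl.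
have Ld : L1 (fun x => f x * dot_e x v).
  have := (@L1M _ _ f (`|v.1| + `|v.2|) (measurable_dot_e v)).
  move=> /(_ (fun x _ => abs_dot_e x v) Lf); apply: eq_L1 => x _; exact: mulrC.
have Lw : L1 (fun x => step (fun k => ln (w k)) x * f x) by exact: L1_step.
have Lexp : L1 (fun x => expR (dot_e x v)).
  by apply: L1_continuous; exact: continuous_exp_dot_e.
have Lh : L1 (fun x => step w x * expR (dot_e x v)) by exact: L1_step.
have fE k : Rintegral (@alpha R) (@cell R q k) f = nu ord0 k.
  by rewrite /Rintegral fk.
have fE1 : Ic f = 1 by rewrite /Ic /Rintegral f1.
have key : Ic (fun x => (step (fun k => ln (w k)) x * f x + f x * dot_e x v) +
               (f x - step w x * expR (dot_e x v))) <= Ic (fun x => f x * ln (f x)).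
  apply: le_Ic => //; first by apply: L1D; [exact: L1D|exact: L1B].
  move=> x cx; have [k ck] := cell_cover cx; rewrite !(step_cell _ ck).
  have := @entropy_gibbs (f x) (w k * expR (dot_e x v)) (f0 x).
  rewrite mulr_gt0 ?expR_gt0// => /(_ isT).
  rewrite lnM ?posrE ?expR_gt0// expRK.
  by move: (f x) (ln (w k)) (dot_e x v) (ln (f x)) (w k * expR _) => *; lra.
have hE : Ic (fun x => step w x * expR (dot_e x v)) = 1 + e.
  rewrite Ic_step//; transitivity (\sum_k (nu ord0 k + d)).
    apply: eq_bigr => k _; rewrite /w -mulrA; have := zc_gt0 q_gt1 k v => z0.
    by rewrite -[X in _ * (_ * X)]/(zc k v) mulVf ?mulr1// gt_eqF.
  rewrite big_split/= nu1 sumr_const card_ord -mulr_natr /d; congr (_ + _).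
  by field; rewrite gt_eqF.
have := key; rewrite IcD; [|exact: L1D|exact: L1B].
rewrite (IcD Lw Ld) (IcB Lf Lh) mean_dotp// Ic_step// fE1 hE.
have : Hent nu - Lc nu v <= \sum_k ln (w k) * Rintegral (@alpha R) (@cell R q k) f.
  rewrite /Hent /Lc -sumrB; apply: ler_sum => k _.
  rewrite fE -mulrBr mulrC; have [->|nk] := eqVneq (nu ord0 k) 0; first by rewrite !(mulr0, mul0r).
  have nkp : 0 < nu ord0 k by rewrite lt_neqAle eq_sym nk nu0.
  rewrite ler_wpM2r//; rewrite ln_div ?posrE ?zc_gt0// ?ltr_wpDl// lerD2r.
  by rewrite ler_ln ?posrE// ?ltr_wpDl// lerDl ltW.
move: (Ic _) (\sum_k ln _ * _) (Hent _ - _) (dotp _ _) => *; lra.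
Qed.

(** Equality case of the bound above: the tilt by v on each cell, renormalized to mass [nu k]. At v
    = beta M with M a fixed point it turns out to be a constrained minimizer. *)
Definition fmin nu v (x : R) : R :=
  step (fun k => nu ord0 k / zc k v) x * expR (dot_e x v).

Lemma L1_fmin nu v : L1 (fmin nu v).
Proof.
by apply: L1_step; apply: L1_continuous; exact: continuous_exp_dot_e.
Qed.

Lemma fmin_cell nu v k : Rintegral (@alpha R) (@cell R q k) (fmin nu v) = nu ord0 k.
Proof.
transitivity (ci (clo R k) (chi R k) (fun x => nu ord0 k / zc k v * expR (dot_e x v))).
  by apply: eq_ci => x /mem_cell ck; rewrite /fmin (step_cell _ ck).
rewrite ciZ; last exact: continuous_exp_dot_e.
by rewrite -/(zint _ _ v) -/(zc k v) divfK// gt_eqF// zc_gt0.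
Qed.

Lemma fmin_density nu v : probvec nu -> density_with_marginal nu (fmin nu v).
Proof.
move=> [nu0 nu1]; split.
- exact: L1_measurable (L1_fmin nu v).
- move=> x; rewrite /fmin mulr_ge0 ?expR_ge0//; apply: sumr_ge0 => k _.
  apply: mulr_ge0; last by rewrite indicE ler0n.
  by apply: divr_ge0; [exact: nu0|exact/ltW/zc_gt0].
- rewrite (Ic_fin (L1_fmin nu v)); congr (_%:E).
  rewrite (Ic_step _ (f := fun x => expR (dot_e x v))); last first.
    by apply: L1_continuous; exact: continuous_exp_dot_e.
  rewrite -nu1; apply: eq_bigr => k _.
  by rewrite -[Rintegral _ _ _]/(zc k v) divfK// gt_eqF// zc_gt0.
- move=> k; rewrite -(fmin_cell nu v) /Rintegral fineK//.
  apply: integrable_fin_num; first exact: measurable_itv.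
  apply: integrableS (L1_fmin nu v) => //;
    by first [exact: measurable_itv|exact: cell_sub_circle|exact: measurable_circle].
Qed.

Lemma fmin_mean nu v : mean_e (fmin nu v) = Psi nu v.
Proof.
have ce := @continuous_exp_dot_e R v.
rewrite /mean_e /Psi; congr pair.
- have Lg : L1 (fun x => cos x * expR (dot_e x v)).
    by apply: L1_continuous; apply: continuousM_fun ce; exact: continuous_cos.
  transitivity (Ic (fun x => step (fun k => nu ord0 k / zc k v) x * (cos x * expR (dot_e x v)))).
    by apply: eq_Ic => x _; rewrite /fmin; ring.
  rewrite Ic_step//; apply: eq_bigr => k _.
  rewrite -[Rintegral _ _ _]/(ci (clo R k) (chi R k) (fun x => cos x * expR (dot_e x v))).
  by rewrite /mc /tmean -lock /= -/(zc k v) mulrA mulrAC.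
- have Lg : L1 (fun x => sin x * expR (dot_e x v)).
    by apply: L1_continuous; apply: continuousM_fun ce; exact: continuous_sin.
  transitivity (Ic (fun x => step (fun k => nu ord0 k / zc k v) x * (sin x * expR (dot_e x v)))).
    by apply: eq_Ic => x _; rewrite /fmin; ring.
  rewrite Ic_step//; apply: eq_bigr => k _.
  rewrite -[Rintegral _ _ _]/(ci (clo R k) (chi R k) (fun x => sin x * expR (dot_e x v))).
  by rewrite /mc /tmean -lock /= -/(zc k v) mulrA mulrAC.
Qed.

Lemma fmin_entropy nu v : probvec nu ->
  L1 (fun x => fmin nu v x * ln (fmin nu v x)) /\
  Ic (fun x => fmin nu v x * ln (fmin nu v x)) = Hent nu - Lc nu v + dotp v (Psi nu v).
Proof.
move=> [nu0 nu1].
pose g x := step (fun k => ln (nu ord0 k) - ln (zc k v)) x * fmin nu v x +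
            fmin nu v x * dot_e x v.
have Ld : L1 (fun x => fmin nu v x * dot_e x v).
  have := (@L1M _ _ (fmin nu v) (`|v.1| + `|v.2|) (measurable_dot_e v)).
  move=> /(_ (fun x _ => abs_dot_e x v) (L1_fmin nu v)); apply: eq_L1 => x _; exact: mulrC.
have Ls : L1 (fun x => step (fun k => ln (nu ord0 k) - ln (zc k v)) x * fmin nu v x).
  exact/L1_step/L1_fmin.
have gE x : @circle R x -> g x = fmin nu v x * ln (fmin nu v x).
  move=> cx; have [k ck] := cell_cover cx.
  rewrite /g /fmin !(step_cell _ ck).
  have [->|nk] := eqVneq (nu ord0 k) 0; first by rewrite !(mul0r, mulr0) addr0.
  have nkp : 0 < nu ord0 k by rewrite lt_neqAle eq_sym nk nu0.
  rewrite lnM ?posrE ?expR_gt0 ?divr_gt0 ?zc_gt0// expRK ln_div ?posrE ?zc_gt0//.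
  by rewrite mulrC -mulrDr.
split; first by apply: eq_L1 gE _; exact: L1D.
rewrite -(eq_Ic gE) /g IcD// mean_dotp ?fmin_mean; last exact: L1_fmin.
congr (_ + _); rewrite Ic_step; last exact: L1_fmin.
rewrite /Hent /Lc -sumrB; apply: eq_bigr => k _.
by rewrite fmin_cell mulrC mulrBr.
Qed.

Lemma free_energy_fmin nu M : probvec nu -> is_fix beta nu M ->
  free_energy beta (fmin nu (sc beta M)) = (Hent nu + Gf beta nu M)%:E.
Proof.
move=> pn fM; have [L E] := fmin_entropy (sc beta M) pn.
rewrite /free_energy /rel_entropy (Ic_fin L) E /Phi_dens fmin_mean fM -EFinD.
congr (_%:E); rewrite /Gf /sqn /dotp /sc/=.
by move: (Lc _ _) (Hent _) => *; field.
Qed.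

(** The entropy bound is used with the tilt beta m, where m is the mean of g itself: the linear term
    beta |m|^2 and the energy -(beta / 2) |m|^2 add up to the quadratic term of [Gf]. A problem over
    densities thus becomes one over the plane. If the entropy integrand is not integrable, x ln x >=
    -1 makes the entropy +oo. *)
Lemma free_energy_lower_bound nu g : probvec nu -> density_with_marginal nu g ->
  ((Hent nu + Gf beta nu (mean_e g))%:E <= free_energy beta g)%E.
Proof.
move=> pn dg; have [L|nL] := pselect (L1 (fun x => g x * ln (g x))).
  have := entropy_lower_bound (sc beta (mean_e g)) pn dg L.
  rewrite /free_energy /rel_entropy (Ic_fin L) -EFinD lee_fin /Phi_dens.
  rewrite /Gf /dotp -/(sqn (mean_e g)).
  move: (mean_e g) => m; rewrite /sqn /sc/=.
  by move: (Ic _) (Hent _) (Lc _ _) => *; lra.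
have [mg g0 _ _] := dg.
rewrite /free_energy /rel_entropy.
have -> : (\int[@alpha R]_(x in @circle R) (g x * ln (g x))%:E = +oo)%E.
  apply: (@integral_pinfty_of_ge _ _ _ (@lebesgue_measure R) (@circle R)
    (fun x => g x * ln (g x)) 1 (@measurable_circle R)
    (@alpha_circle_lt_pinfty R) (measurable_entropy mg) ler01 _ nL).
  move=> x _; have := @entropy_gibbs (g x) 1 (g0 x) ltr01; rewrite ln1 mulr0 subr0.
  by have := g0 x; lra.
by rewrite addey// leey.
Qed.

(** [fmin] attains the lower bound at the fixed point, so minimizers exist and [xget] returns one.
    Strong convexity of [Gf] then forces every minimizer to have mean M, which is all that [M_beta]
    records. *)
Theorem M_betaE nu M : probvec nu -> is_fix beta nu M -> M_beta beta nu = M.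
Proof.
move=> pn fM.
have k0 : 0 < beta / 2 * (1 - beta * sin (pi / q%:R) ^+ 2).
  by rewrite mulr_gt0 ?divr_gt0 ?subr_gt0.
have mf : is_constrained_minimizer beta nu (fmin nu (sc beta M)).
  split; first exact: fmin_density.
  move=> g dg; apply: le_trans (free_energy_lower_bound pn dg).
  rewrite (free_energy_fmin pn fM) lee_fin lerD2l.
  apply: le_trans (Gf_strong q_gt1 (mean_e g) pn fM).
  by rewrite lerDl mulr_ge0 ?(ltW k0)// addr_ge0 ?sqr_ge0.
rewrite /M_beta /nu_min.
have : is_constrained_minimizer beta nu
  (xget (fun=> 0) [set f | is_constrained_minimizer beta nu f]).
  by apply: (xgetPex (fun=> 0)); exists (fmin nu (sc beta M)).
set f := xget _ _; move=> [df minf].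
have := le_trans (free_energy_lower_bound pn df) (minf _ mf.1).
rewrite (free_energy_fmin pn fM) lee_fin lerD2l.
have := Gf_strong q_gt1 (mean_e f) pn fM.
move: (mean_e f) (Gf _ _ _) (Gf _ _ _) => m G1 G2 h1 h2.
have : beta / 2 * (1 - beta * sin (pi / q%:R) ^+ 2) * sqn (m - M) <= 0 by lra.
rewrite pmulr_rle0//.
rewrite /sqn/=; have := sqr_ge0 (m.1 - M.1); have := sqr_ge0 (m.2 - M.2) => k1 k2 k3.
have /eqP : (m.1 - M.1) ^+ 2 = 0 by lra.
have /eqP : (m.2 - M.2) ^+ 2 = 0 by lra.
rewrite !sqrf_eq0 !subr_eq0 => /eqP e2 /eqP e1.
by rewrite (surjective_pairing m) e1 e2; case: (M).
Qed.

End Minimizer.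

(** * Concentration of the finite-N mean *)

Section LocallyLipschitz.
Variable R : realType.
Implicit Types (p u v : R * R) (G H : R * R -> R) (r x y a b c d : R).

Definition dist1 p v : R := `|p.1 - v.1| + `|p.2 - v.2|.
Definition inbox r p : Prop := `|p.1| <= r /\ `|p.2| <= r.

(** Weights such as exp(beta |p|^2 / 2N) are not globally Lipschitz. This class contains them, is
    stable under sums, products, exponentials and integration over a cell, and supplies both the
    continuity and the exchange of integrals needed below. *)
Definition loclip G : Prop := forall r, exists L, 0 <= L /\
  forall p v, inbox r p -> inbox r v -> `|G p - G v| <= L * dist1 p v.

Lemma dist1_ge0 p v : 0 <= dist1 p v. Proof. by rewrite addr_ge0. Qed.

Lemma loclip_of_lip G L : 0 <= L -> (forall p v, `|G p - G v| <= L * dist1 p v) -> loclip G.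
Proof. by move=> L0 GL r; exists L. Qed.

Lemma loclip_bounded G r : loclip G -> exists B, 0 <= B /\ forall p, inbox r p -> `|G p| <= B.
Proof.
move=> /(_ r)[L [L0 GL]].
have [r0|r0] := leP 0 r; last first.
  exists 0; split=> // p [p1 _]; have := le_trans (normr_ge0 _) p1; lra.
exists (`|G (0, 0)| + L * (r + r)); split.
  by rewrite addr_ge0// mulr_ge0// addr_ge0.
move=> p [p1 p2]; rewrite -[G p](subrK (G (0, 0))) addrC.
rewrite (le_trans (ler_normD _ _))// lerD2l.
apply: (le_trans (GL p (0, 0) _ _)); [by []|by split; rewrite normr0|].
by rewrite ler_wpM2l// /dist1/= !subr0 lerD.
Qed.

Lemma loclip_cst c : loclip (fun=> c).
Proof. by apply: (@loclip_of_lip _ 0) => // p v; rewrite subrr normr0 mul0r. Qed.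

Lemma loclip_fst : loclip fst.
Proof. by apply: (@loclip_of_lip _ 1) => // p v; rewrite mul1r /dist1 lerDl. Qed.

Lemma loclip_snd : loclip snd.
Proof. by apply: (@loclip_of_lip _ 1) => // p v; rewrite mul1r /dist1 lerDr. Qed.

Lemma loclipD G H : loclip G -> loclip H -> loclip (fun p => G p + H p).
Proof.
move=> gG gH r; have [L [L0 GL]] := gG r; have [K [K0 HK]] := gH r.
exists (L + K); split=> [|p v bp bv]; first by rewrite addr_ge0.
by rewrite opprD addrACA mulrDl (le_trans (ler_normD _ _))// lerD// ?GL ?HK.
Qed.

Lemma loclipM G H : loclip G -> loclip H -> loclip (fun p => G p * H p).
Proof.
move=> gG gH r; have [L [L0 GL]] := gG r; have [K [K0 HK]] := gH r.
have [B [B0 GB]] := loclip_bounded r gG; have [C [C0 HC]] := loclip_bounded r gH.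
exists (B * K + C * L); split=> [|p v bp bv]; first by rewrite addr_ge0 ?mulr_ge0.
have -> : G p * H p - G v * H v = G p * (H p - H v) + H v * (G p - G v) by ring.
rewrite (le_trans (ler_normD _ _))// !normrM mulrDl -!mulrA lerD//.
  by apply: ler_pM => //; [exact: GB|exact: HK].
by apply: ler_pM => //; [exact: HC|exact: GL].
Qed.

Lemma expR_lip x y c : x <= c -> y <= c -> `|expR x - expR y| <= expR c * `|x - y|.
Proof.
wlog yx : x y / y <= x => [hw xc yc|xc yc].
  have [yx|/ltW xy] := leP y x; first exact: hw.
  by rewrite distrC [`|x - y|]distrC hw.
rewrite !ger0_norm ?subr_ge0 ?ler_expR//.
apply: (@le_trans _ _ (expR x * (x - y))); last first.
  by rewrite ler_wpM2r ?subr_ge0// ler_expR.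
have := expR_ge1Dx (y - x); rewrite -(ler_pM2l (expR_gt0 x)) -expRD subrKC.
by move: (expR x) (expR y) => *; lra.
Qed.

Lemma loclip_expR G : loclip G -> loclip (fun p => expR (G p)).
Proof.
move=> gG r; have [L [L0 GL]] := gG r; have [B [B0 GB]] := loclip_bounded r gG.
exists (expR B * L); split=> [|p v bp bv]; first by rewrite mulr_ge0 ?expR_ge0.
apply: (@le_trans _ _ (expR B * `|G p - G v|)).
  by apply: expR_lip; [exact: le_trans (ler_norm _) (GB _ bp)|
    exact: le_trans (ler_norm _) (GB _ bv)].
by rewrite -mulrA ler_wpM2l ?expR_ge0// GL.
Qed.

Lemma loclip_sum (I : Type) (s : seq I) (G : I -> R * R -> R) :
  (forall i, loclip (G i)) -> loclip (fun p => \sum_(i <- s) G i p).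
Proof.
move=> gG; elim: s => [|i s IH].
  rewrite (_ : (fun p => _) = (fun=> 0)); first exact: loclip_cst.
  by apply/funext => p; rewrite big_nil.
rewrite (_ : (fun p => _) = (fun p => G i p + \sum_(j <- s) G j p)).
  exact: loclipD.
by apply/funext => p; rewrite big_cons.
Qed.

Lemma loclip_continuous G (f g : R -> R) : loclip G -> continuous f -> continuous g ->
  continuous (fun x => G (f x, g x)).
Proof.
move=> gG cf cg x.
have [L [L0 GL]] := gG (`|f x| + `|g x| + 1).
apply/cvgrPdist_lt => e e0.
have d0 : 0 < e / (2 * (L + 1)) by rewrite divr_gt0// mulr_gt0// ltr_wpDl.
near=> y.
have f1 : `|f x - f y| < 1 by near: y; move/cvgrPdist_lt : (cf x); exact.
have g1 : `|g x - g y| < 1 by near: y; move/cvgrPdist_lt : (cg x); exact.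
have f2 : `|f x - f y| < e / (2 * (L + 1)).
  by near: y; move/cvgrPdist_lt : (cf x); exact.
have g2 : `|g x - g y| < e / (2 * (L + 1)).
  by near: y; move/cvgrPdist_lt : (cg x); exact.
have nb (z w : R) : `|z - w| < 1 -> `|w| <= `|z| + 1.
  move=> zw; rewrite -[w](subKr z) (le_trans (ler_normB _ _))// lerD2l.
  exact: ltW.
apply: (le_lt_trans (GL (f x, g x) (f y, g y) _ _)).
- by split; rewrite /= -addrA ?lerDl// addrCA lerDl addr_ge0.
- split; rewrite /=.
    by apply: (le_trans (nb _ _ f1)); rewrite lerD2r lerDl.
  by apply: (le_trans (nb _ _ g1)); rewrite lerD2r lerDr.
- apply: (@le_lt_trans _ _ ((L + 1) * dist1 (f x, g x) (f y, g y))).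
    by rewrite ler_wpM2r ?dist1_ge0// lerDl.
  have : dist1 (f x, g x) (f y, g y) < e / (L + 1).
    have -> : e / (L + 1) = e / (2 * (L + 1)) + e / (2 * (L + 1)) by field; lra.
    exact: ltrD.
  by rewrite ltr_pdivlMr ?ltr_wpDl// mulrC.
Unshelve. all: by end_near.
Qed.

Lemma loclip_ext G H : G =1 H -> loclip G -> loclip H.
Proof. by move=> GH; rewrite (funext GH). Qed.

Lemma lip1_of_derive (f df : R -> R) : (forall x, is_derive x 1 f (df x)) ->
  (forall x, `|df x| <= 1) -> forall x y, `|f x - f y| <= `|x - y|.
Proof.
move=> dff df1 x y.
wlog yx : x y / y <= x => [hw|].
  have [yx|/ltW xy] := leP y x; first exact: hw.
  by rewrite distrC [`|x - y|]distrC hw.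
rewrite [leRHS]ger0_norm ?subr_ge0// ler_norml; apply/andP; split.
- have : (fun t => t + f t) y <= (fun t => t + f t) x.
    apply: (@nondecreasing_of_derive_all _ _ (fun t => 1 + df t)) => // t _.
    by have := df1 t; rewrite ler_norml; lra.
  by rewrite /=; lra.
- have : (fun t => t - f t) y <= (fun t => t - f t) x.
    apply: (@nondecreasing_of_derive_all _ _ (fun t => 1 - df t)) => // t _.
    by have := df1 t; rewrite ler_norml; lra.
  by rewrite /=; lra.
Qed.

Lemma cos_lip x y : `|cos x - cos y| <= `|x - y|.
Proof.
apply: (@lip1_of_derive _ (fun x => - sin x)) => t.
by rewrite normrN ler_norml sin_geN1 sin_le1.
Qed.

Lemma sin_lip x y : `|sin x - sin y| <= `|x - y|.
Proof. by apply: (@lip1_of_derive _ cos) => t; rewrite ler_norml cos_geN1 cos_le1. Qed.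

Lemma lip_continuous (f : R -> R) L : (forall x y, `|f x - f y| <= L * `|x - y|) -> continuous f.
Proof.
move=> fL x.
have H := @loclip_continuous (fun p => f p.1) id (fun=> 0).
apply: H; [|by move=> y; exact: cvg_id|by move=> y; exact: cvg_cst].
apply: (@loclip_of_lip _ `|L|) => // p v; apply: (le_trans (fL _ _)).
apply: (@le_trans _ _ (`|L| * `|p.1 - v.1|)).
  by rewrite ler_wpM2r// ler_norm.
by rewrite ler_wpM2l// /dist1 lerDl.
Qed.

(* The two iterated integrals over a strip of width [t] differ by [O(t^2)], so
   subdividing the first interval finely makes the difference vanish. *)
Lemma ci_exchange (h : R -> R -> R) L a b c d : 0 <= L -> a <= b -> c <= d ->
  (forall x x' y, `|h x y - h x' y| <= L * `|x - x'|) ->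
  (forall x y y', `|h x y - h x y'| <= L * `|y - y'|) ->
  ci a b (fun x => ci c d (h x)) = ci c d (fun y => ci a b (h^~ y)).
Proof.
move=> L0 ab cd h1 h2.
have ch1 y : continuous (h^~ y) by apply: (@lip_continuous _ L) => x x'; exact: h1.
have ch2 x : continuous (h x) by apply: (@lip_continuous _ L) => y y'; exact: h2.
have ccst (r : R) : continuous (fun _ : R => r) by move=> x; exact: cvg_cst.
have cI1 : continuous (fun x => ci c d (h x)).
  apply: (@lip_continuous _ (L * (d - c))) => x x'; rewrite -ciB//.
  apply: (@le_trans _ _ (ci c d (fun=> L * `|x - x'|))).
    apply: ler_norm_ci => [||y _]; [|exact: ccst|exact: h1].
    by move=> y; apply: cvgB; [exact: ch2|exact: ch2].
  by rewrite ci_cst// mulrAC.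
have cI2 s t : s <= t -> continuous (fun y => ci s t (h^~ y)).
  move=> st; apply: (@lip_continuous _ (L * (t - s))) => y y'; rewrite -ciB//.
  apply: (@le_trans _ _ (ci s t (fun=> L * `|y - y'|))).
    apply: ler_norm_ci => [||x _]; [|exact: ccst|exact: h2].
    by move=> x; apply: cvgB; [exact: ch1|exact: ch1].
  by rewrite ci_cst// mulrAC.
pose D s t := ci s t (fun x => ci c d (h x)) - ci c d (fun y => ci s t (h^~ y)).
have Dstrip s t : s <= t -> `|D s t| <= 2 * L * (d - c) * (t - s) ^+ 2.
  move=> st; set m := ci c d (h s) * (t - s).
  have e1 : `|ci s t (fun x => ci c d (h x)) - m| <= L * (d - c) * (t - s) ^+ 2.
    rewrite /m -ci_cst// -ciB//.
    apply: (@le_trans _ _ (ci s t (fun=> L * (t - s) * (d - c)))); last first.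
      by rewrite ci_cst// expr2 !mulrA; lra.
    apply: ler_norm_ci => [||x /andP[sx xt]]; [|exact: ccst|].
      by move=> x; apply: cvgB; [exact: cI1|exact: cvg_cst].
    rewrite -ciB// -ci_cst//; apply: ler_norm_ci => [||y _]; [|exact: ccst|].
      by move=> y; apply: cvgB; [exact: ch2|exact: ch2].
    apply: (le_trans (h1 _ _ _)); rewrite ler_wpM2l// ger0_norm ?subr_ge0//.
    by rewrite lerD2r ltW.
  have e2 : `|ci c d (fun y => ci s t (h^~ y)) - m| <= L * (d - c) * (t - s) ^+ 2.
    have -> : m = ci c d (fun y => (t - s) * h s y) by rewrite ciZ// mulrC.
    have chs : continuous (fun y => (t - s) * h s y).
      by move=> y; apply: cvgM; [exact: cvg_cst|exact: ch2].
    rewrite -ciB//; last exact: cI2.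
    apply: (@le_trans _ _ (ci c d (fun=> L * (t - s) * (t - s)))); last first.
      by rewrite ci_cst// expr2 !mulrA; lra.
    apply: ler_norm_ci => [||y _]; [|exact: ccst|].
      by move=> y; apply: cvgB; [exact: cI2|exact: chs].
    rewrite mulrC -ci_cst// -ciB// -ci_cst//.
    apply: ler_norm_ci => [||x /andP[sx xt]]; [|exact: ccst|].
      by move=> x; apply: cvgB; [exact: ch1|exact: cvg_cst].
    apply: (le_trans (h1 _ _ _)); rewrite ler_wpM2l// ger0_norm ?subr_ge0//.
    by rewrite lerD2r ltW.
  have -> : D s t = (ci s t (fun x => ci c d (h x)) - m) - (ci c d (fun y => ci s t (h^~ y)) - m).
    by rewrite opprB addrA subrK.
  have -> : 2 * L * (d - c) * (t - s) ^+ 2 =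
      L * (d - c) * (t - s) ^+ 2 + L * (d - c) * (t - s) ^+ 2 by ring.
  by apply: (le_trans (ler_normB _ _)); apply: lerD; [exact: e1|exact: e2].
have Dadd (s t u : R) : s <= t -> t <= u -> D s u = D s t + D t u.
  move=> st tu; rewrite /D (ci_split st tu cI1).
  rewrite (@eq_ci _ c d (fun y => ci s u (h^~ y)) (fun y => ci s t (h^~ y) + ci t u (h^~ y))).
    rewrite ciD; [|exact: cI2|exact: cI2].
    by rewrite opprD addrACA.
  by move=> y _; rewrite (ci_split st tu).
pose C := 2 * L * (d - c).
have C0 : 0 <= C by rewrite !mulr_ge0// subr_ge0.
have Dn n e : 0 <= e -> `|D a (a + n%:R * e)| <= n%:R * (C * e ^+ 2).
  move=> e0; elim: n => [|n IH].
    rewrite !mul0r addr0; apply: (le_trans (Dstrip _ _ (lexx _))).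
    by rewrite subrr expr0n/= mulr0.
  rewrite (@Dadd _ (a + n%:R * e)); last 2 first.
  - by rewrite lerDl mulr_ge0.
  - by rewrite lerD2l ler_wpM2r// ler_nat.
  rewrite (le_trans (ler_normD _ _))// -natr1 [leRHS]mulrDl mul1r lerD//.
  apply: (le_trans (Dstrip _ _ _)); first by rewrite lerD2l ler_wpM2r// lerDl.
  have -> : a + (n%:R + 1) * e - (a + n%:R * e) = e by ring.
  by [].
suff : D a b = 0 by move/eqP; rewrite subr_eq0 => /eqP.
apply/eqP; rewrite -normr_eq0 eq_le normr_ge0 andbT.
apply/ler_addgt0Pr => e e0; rewrite add0r.
set K := C * (b - a) ^+ 2.
have K0 : 0 <= K by rewrite mulr_ge0// sqr_ge0.
pose n := (Num.truncn (K / e)).+1.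
have n0 : 0 < n%:R :> R by rewrite ltr0n.
have Kn : K / e < n%:R.
  by have /andP[] := truncn_itv (divr_ge0 K0 (ltW e0)).
have := Dn n ((b - a) / n%:R) (divr_ge0 _ (ltW n0)).
rewrite subr_ge0 => /(_ ab).
have -> : a + n%:R * ((b - a) / n%:R) = b by field; rewrite gt_eqF.
move=> hn; apply: (le_trans hn).
have -> : n%:R * (C * ((b - a) / n%:R) ^+ 2) = K / n%:R by rewrite /K; field; rewrite gt_eqF.
by rewrite ler_pdivrMr// mulrC -ler_pdivrMr// ltW.
Qed.

End LocallyLipschitz.

(** * Iterated cell integrals of functions of the spin sum *)

Section CellSums.
Variables (R : realType) (q : nat).
Hypothesis q_gt1 : (1 < q)%N.
Implicit Types (u v p : R * R) (l k : 'I_q) (ls : seq 'I_q) (G H : R * R -> R).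

(** Integrates one spin of label k out of a function of the spin sum. The Gibbs weight depends on a
    configuration only through this sum, so iterating [Kc] covers all integrals in the rates. *)
Definition Kc k G p : R := ci (clo R k) (chi R k) (fun x => G (p.1 + cos x, p.2 + sin x)).

(* Integral of [G (p + \sum_j e_{s_j})] over the product of the cells in [ls]. *)
Fixpoint Ji ls G p : R := if ls is l :: ls' then Kc l (Ji ls' G) p else G p.

Let lohi l := clo_lt_chi R q_gt1 l.

Lemma continuous_shift G p : loclip G -> continuous (fun x => G (p.1 + cos x, p.2 + sin x)).
Proof.
move=> gG; apply: (@loclip_continuous _ G (fun x => p.1 + cos x) (fun x => p.2 + sin x)) => // x.
  by apply: cvgD; [exact: cvg_cst|exact: continuous_cos].
by apply: cvgD; [exact: cvg_cst|exact: continuous_sin].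
Qed.

Lemma inbox_shift r p x : inbox r p -> inbox (r + 1) (p.1 + cos x, p.2 + sin x).
Proof.
move=> [p1 p2]; split; rewrite /= (le_trans (ler_normD _ _))// lerD// ler_norml.
  by rewrite cos_geN1 cos_le1.
by rewrite sin_geN1 sin_le1.
Qed.

Lemma loclip_Kc k G : loclip G -> loclip (Kc k G).
Proof.
move=> gG r; have [L [L0 GL]] := gG (r + 1).
have w0 : 0 <= chi R k - clo R k by rewrite subr_ge0 ltW.
exists (L * (chi R k - clo R k)); split; first by rewrite mulr_ge0.
move=> p v bp bv; rewrite /Kc -ciB; [|exact: continuous_shift|exact: continuous_shift].
rewrite mulrAC -ci_cst; last exact/ltW/lohi.
apply: ler_norm_ci => [x||x _].
- by apply: cvgB; exact: continuous_shift.
- exact: continuous_cst_fun.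
- apply: (le_trans (GL _ _ (inbox_shift x bp) (inbox_shift x bv))).
  rewrite ler_wpM2l// /dist1/=.
  have -> : p.1 + cos x - (v.1 + cos x) = p.1 - v.1 by ring.
  by have -> : p.2 + sin x - (v.2 + sin x) = p.2 - v.2 by ring.
Qed.

Lemma loclip_Ji ls G : loclip G -> loclip (Ji ls G).
Proof. by elim: ls => //= l ls IH gG; apply: loclip_Kc; exact: IH. Qed.

Lemma Kc_exchange k l G p : loclip G -> Kc k (Kc l G) p = Kc l (Kc k G) p.
Proof.
move=> gG; have [L [L0 GL]] := gG (`|p.1| + `|p.2| + 1 + 1).
have bp : inbox (`|p.1| + `|p.2|) p by split; rewrite ?lerDl ?lerDr.
pose h x y := G (p.1 + cos x + cos y, p.2 + sin x + sin y).
rewrite /Kc /=.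
transitivity (ci (clo R l) (chi R l) (fun y => ci (clo R k) (chi R k) (h^~ y))).
  apply: (@ci_exchange _ h (L * 2)) => [|||x x' y|x y y'].
  - by rewrite mulr_ge0.
  - exact/ltW/lohi.
  - exact/ltW/lohi.
  - apply: (le_trans (GL _ _ (inbox_shift y (inbox_shift x bp))
      (inbox_shift y (inbox_shift x' bp)))).
    rewrite -mulrA ler_wpM2l// /dist1/= mulr_natl mulr2n.
    apply: lerD.
      apply: le_trans (cos_lip x x'); rewrite le_eqVlt; apply/orP; left; apply/eqP.
      by congr (`|_|); ring.
    apply: le_trans (sin_lip x x'); rewrite le_eqVlt; apply/orP; left; apply/eqP.
    by congr (`|_|); ring.
  - apply: (le_trans (GL _ _ (inbox_shift y (inbox_shift x bp))
      (inbox_shift y' (inbox_shift x bp)))).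
    rewrite -mulrA ler_wpM2l// /dist1/= mulr_natl mulr2n.
    apply: lerD.
      apply: le_trans (cos_lip y y'); rewrite le_eqVlt; apply/orP; left; apply/eqP.
      by congr (`|_|); ring.
    apply: le_trans (sin_lip y y'); rewrite le_eqVlt; apply/orP; left; apply/eqP.
    by congr (`|_|); ring.
apply: eq_ci => y _; apply: eq_ci => x _; rewrite /h.
by congr G; congr pair; rewrite addrAC.
Qed.

Lemma Ji_rot l ls G : loclip G -> Ji (l :: ls) G = Ji ls (Kc l G).
Proof.
move=> gG; elim: ls => [//|a ls IH]; apply/funext => p /=.
rewrite -[Ji ls (Kc l G)]IH; apply: Kc_exchange; exact: loclip_Ji.
Qed.

(** The cell integrations commute, so one spin of label k can be moved innermost. The denominator of
    a rate thereby becomes an integral over the same N - 1 spins as the numerator. *)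
Lemma Ji_rem k ls G : loclip G -> k \in ls -> Ji ls G = Ji (rem k ls) (Kc k G).
Proof.
move=> gG; elim: ls => [//|l ls IH]; rewrite in_cons.
have [<- _|kl /= kls] := eqVneq k l; first by rewrite /= eqxx -Ji_rot.
by rewrite [l == k]eq_sym (negbTE kl)/=; apply/funext => p; rewrite IH.
Qed.

(** Each spin moves either coordinate of the sum by at most 1, so the comparison is only needed on
    the box reachable from p. *)
Lemma Ji_le ls G H p : loclip G -> loclip H ->
  (forall v, `|v.1 - p.1| <= (size ls)%:R -> `|v.2 - p.2| <= (size ls)%:R -> G v <= H v) ->
  Ji ls G p <= Ji ls H p.
Proof.
move=> gG gH; elim: ls p => [|l ls IH] p GH /=.
  by apply: GH; rewrite subrr normr0.
apply: le_ci => [||x _].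
- by apply: continuous_shift; exact: loclip_Ji.
- by apply: continuous_shift; exact: loclip_Ji.
- apply: IH => v v1 v2; apply: GH; rewrite /= -natr1.
    have -> : v.1 - p.1 = (v.1 - (p.1 + cos x)) + cos x by ring.
    by rewrite (le_trans (ler_normD _ _))// lerD// ler_norml cos_geN1 cos_le1.
  have -> : v.2 - p.2 = (v.2 - (p.2 + sin x)) + sin x by ring.
  by rewrite (le_trans (ler_normD _ _))// lerD// ler_norml sin_geN1 sin_le1.
Qed.

Lemma JiD ls G H : loclip G -> loclip H ->
  Ji ls (fun p => G p + H p) = (fun p => Ji ls G p + Ji ls H p).
Proof.
move=> gG gH; elim: ls => [//|l ls IH]; apply/funext => p /=; rewrite IH /Kc.
by rewrite ciD//; apply: continuous_shift; exact: loclip_Ji.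
Qed.

Lemma JiZ ls c G : loclip G -> Ji ls (fun p => c * G p) = (fun p => c * Ji ls G p).
Proof.
move=> gG; elim: ls => [//|l ls IH]; apply/funext => p /=; rewrite IH /Kc.
by rewrite ciZ//; apply: continuous_shift; exact: loclip_Ji.
Qed.

Lemma loclipZ c G : loclip G -> loclip (fun p => c * G p).
Proof. by move=> gG; apply: loclipM => //; exact: loclip_cst. Qed.

Lemma Ji_sum ls (I : Type) (s : seq I) (G : I -> R * R -> R) p : (forall i, loclip (G i)) ->
  Ji ls (fun p => \sum_(i <- s) G i p) p = \sum_(i <- s) Ji ls (G i) p.
Proof.
move=> gG; elim: s => [|i s IH].
  rewrite big_nil (_ : (fun p => _) = (fun p => 0 * 0)); last first.
    by apply/funext => v; rewrite big_nil mul0r.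
  by rewrite (JiZ _ 0 (loclip_cst 0)) mul0r.
rewrite big_cons -IH (_ : (fun p => _) = (fun p => G i p + \sum_(j <- s) G j p)); last first.
  by apply/funext => v; rewrite big_cons.
by rewrite JiD//; exact: loclip_sum.
Qed.

Lemma loclip_dotp u : loclip (dotp u).
Proof.
by apply: loclipD; apply: loclipM; try exact: loclip_cst; [exact: loclip_fst|exact: loclip_snd].
Qed.

Lemma Ji_exp ls u p : Ji ls (fun v => expR (dotp u v)) p =
  expR (dotp u p) * \prod_(l <- ls) zc l u.
Proof.
elim: ls p => [|l ls IH] p /=; first by rewrite big_nil mulr1.
rewrite big_cons /Kc.
rewrite (@eq_ci _ _ _ _ (fun x => (expR (dotp u p) * \prod_(j <- ls) zc j u) * expR (dot_e x u))).
  by rewrite ciZ; [rewrite /zc /zint; ring|exact: continuous_exp_dot_e].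
move=> x _; rewrite IH mulrAC -expRD; congr (expR _ * _).
by rewrite /dotp /dot_e/=; ring.
Qed.

Lemma iint_Ji ls G p :
  iint ls (fun s => G (p.1 + \sum_(t <- s) cos t, p.2 + \sum_(t <- s) sin t)) = Ji ls G p.
Proof.
elim: ls p => [|l ls IH] p /=; first by rewrite !big_nil !addr0; case: p.
apply: eq_Rintegral => x _; rewrite -IH; congr (iint ls _); apply/funext => s.
by rewrite !big_cons !addrA.
Qed.

Lemma loclip_zc k : loclip (zc (R := R) k).
Proof.
have H : loclip (fun v : R * R => ln (zc k v)).
  by apply: (@loclip_of_lip _ _ 1) => // v w; rewrite mul1r; exact: ln_zc_lip.
by apply: loclip_ext (loclip_expR H) => v; rewrite lnK// posrE zc_gt0.
Qed.

Lemma loclip_sqn : loclip (@sqn R).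
Proof.
apply: loclipD.
  apply: loclip_ext (loclipM (@loclip_fst R) (@loclip_fst R)) => v; by rewrite expr2.
apply: loclip_ext (loclipM (@loclip_snd R) (@loclip_snd R)) => v; by rewrite expr2.
Qed.

Lemma loclip_comp_affine G (a : R) m : loclip G ->
  loclip (fun p => G (a * p.1 + m.1, a * p.2 + m.2)).
Proof.
move=> gG r; have [L [L0 GL]] := gG (`|a| * r + (`|m.1| + `|m.2|)).
exists (L * `|a|); split; first by rewrite mulr_ge0.
have inb p : inbox r p -> inbox (`|a| * r + (`|m.1| + `|m.2|)) (a * p.1 + m.1, a * p.2 + m.2).
  move=> [p1 p2]; split; rewrite /= (le_trans (ler_normD _ _))// normrM.
    by apply: lerD; [exact: ler_wpM2l|rewrite lerDl].
  by apply: lerD; [exact: ler_wpM2l|rewrite lerDr].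
move=> p v bp bv; apply: (le_trans (GL _ _ (inb _ bp) (inb _ bv))).
rewrite -mulrA ler_wpM2l// /dist1/=.
have -> : a * p.1 + m.1 - (a * v.1 + m.1) = a * (p.1 - v.1) by ring.
have -> : a * p.2 + m.2 - (a * v.2 + m.2) = a * (p.2 - v.2) by ring.
by rewrite !normrM mulrDr.
Qed.

End CellSums.

(** * Exponential concentration of the spin average under the Gibbs weight *)

Section Concentration.
Variables (R : realType) (q : nat).
Hypothesis q_gt1 : (1 < q)%N.
Variable beta : R.
Let s : R := sin (pi / q%:R).
Hypotheses (beta_gt0 : 0 < beta) (beta_lt : beta * s ^+ 2 < 1).
Implicit Types (u v p z : R * R) (l k : 'I_q) (ls : seq 'I_q) (G H : R * R -> R).

(** Borderline inverse temperature of the convexity condition: [beta_lt] says beta < gam. [eta] is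
    the reserve from which the exponential decay in N is drawn. *)
Let gam : R := (s ^+ 2)^-1.
Let eta : R := gam - beta.

Lemma sin_piq_gt0 : 0 < sin (pi / q%:R) :> R.
Proof.
have q2 : (2 : R) <= q%:R by rewrite ler_nat.
apply: sin_gt0_pi; apply/andP; split.
  by rewrite divr_gt0 ?pi_gt0//; lra.
by rewrite ltr_pdivrMr ?ltr_pMr ?pi_gt0//; lra.
Qed.

Let s2 : 0 < s ^+ 2. Proof. by rewrite exprn_gt0// sin_piq_gt0. Qed.
Let gam0 : 0 < gam. Proof. by rewrite /gam invr_gt0. Qed.
Let eta0 : 0 < eta. Proof. by rewrite /eta /gam subr_gt0 -div1r ltr_pdivlMr. Qed.
Let gams : gam * s ^+ 2 = 1. Proof. by rewrite /gam mulVf// gt_eqF. Qed.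

Variables (ls : seq 'I_q) (k : 'I_q) (M : R * R).
Let N : R := (size ls).+1%:R.
Let N0 : 0 < N. Proof. by rewrite ltr0n. Qed.
Hypotheses (M1 : `|M.1| <= 1) (M2 : `|M.2| <= 1).
(** [mean1] and [mean2] are the fixed-point equation at the macrostate of [k :: ls]. The spin k is
    not integrated here although N counts it, which leaves bounded corrections below. *)
Hypothesis mean1 : \sum_(l <- ls) (mc l (sc beta M)).1 + (mc k (sc beta M)).1 = N * M.1.
Hypothesis mean2 : \sum_(l <- ls) (mc l (sc beta M)).2 + (mc k (sc beta M)).2 = N * M.2.

(** The Gibbs factor exp(-n Phi) as a function of the sum p of n unit vectors. *)
Definition wgt (n : R) p : R := expR (beta / (2 * n) * sqn p).
Definition devn (n : R) p : R := sqn (n^-1 * p.1 - M.1, n^-1 * p.2 - M.2).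
Let w := wgt N.
Let D := devn N.
Let A0 : R := expR (- (N * beta / 2 * sqn M)).
Let P0 : R := \prod_(l <- ls) zc l (sc beta M).

(** Completing the square at M splits the interaction into a product tilt, under which the spins are
    independent, and a factor that only sees the deviation from M. *)
Lemma wgtE p : w p = A0 * (expR (dotp (sc beta M) p) * expR (N * beta / 2 * D p)).
Proof.
rewrite /w /wgt /A0 -!expRD; congr expR; rewrite /D /devn /sqn /dotp /sc/=.
by field; rewrite gt_eqF.
Qed.

Lemma sqn_ge0 v : 0 <= sqn v. Proof. by rewrite addr_ge0 ?sqr_ge0. Qed.

Lemma loclip_devn n : loclip (devn n).
Proof. exact: (@loclip_comp_affine _ _ n^-1 (- M.1, - M.2) (@loclip_sqn R)). Qed.

Lemma loclip_wgt n : loclip (wgt n).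
Proof. by apply: loclip_expR; apply: loclipZ; exact: loclip_sqn. Qed.

Lemma loclip_expdot u : loclip (fun p => expR (dotp u p)).
Proof. by apply: loclip_expR; exact: loclip_dotp. Qed.

Lemma P0_gt0 : 0 < P0.
Proof.
rewrite /P0; elim: ls => [|l t IH]; first by rewrite big_nil.
by rewrite big_cons mulr_gt0// zc_gt0.
Qed.

Lemma Ji_expdot u : Ji ls (fun p => expR (dotp u p)) (0, 0) = \prod_(l <- ls) zc l u.
Proof. by rewrite Ji_exp// /dotp/= !mulr0 addr0 expR0 mul1r. Qed.

Lemma Ji_wgt_ge : A0 * P0 <= Ji ls w (0, 0).
Proof.
rewrite /P0 -Ji_expdot.
rewrite -[A0 * _]/((fun p => A0 * Ji ls (fun p => expR (dotp (sc beta M) p)) p) (0, 0)).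
rewrite -JiZ//; last exact: loclip_expdot.
apply: Ji_le => // [||v _ _].
- exact/loclipZ/loclip_expdot.
- exact: loclip_wgt.
- rewrite wgtE ler_pM2l ?expR_gt0// ler_pMr ?expR_gt0//.
  rewrite -(@expR0 R) ler_expR mulr_ge0 ?sqn_ge0//.
  by rewrite divr_ge0// mulr_ge0// ltW.
Qed.

(** The coordinates of p / N - M lie in [-2, 2]; a grid of mesh 1 / N on this interval has 4 N + 1
    points. *)
Let gridn : nat := (4 * (size ls).+1).+1.
Definition gridpt (n : R) (ij : 'I_gridn * 'I_gridn) : R * R :=
  (n^-1 * ij.1%:R - 2, n^-1 * ij.2%:R - 2).

Lemma grid_coord (x : R) : `|x| <= 2 -> exists i : 'I_gridn, `|x - (N^-1 * i%:R - 2)| <= N^-1.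
Proof.
rewrite ler_norml => /andP[x1 x2].
have y0 : 0 <= N * (x + 2) by apply: mulr_ge0; [exact: ltW|lra].
have /andP[t1 t2] := truncn_itv y0.
have tl : (Num.truncn (N * (x + 2)) < gridn)%N.
  rewrite /gridn ltnS -(ler_nat R) (le_trans t1)// natrM mulrC.
  by rewrite ler_pM2r//; lra.
rewrite -(natr1 (Num.truncn _)) in t2; exists (Ordinal tl); rewrite /=; move: t1 t2 => /=.
move: ((Num.truncn (N * (x + 2)))%:R : R) => t t1 t2.
have -> : x - (N^-1 * t - 2) = N^-1 * (N * (x + 2) - t) by field; rewrite gt_eqF.
have iN0 : 0 <= N^-1 by rewrite invr_ge0 ltW.
rewrite ger0_norm; last by apply: mulr_ge0 => //; rewrite subr_ge0.
by rewrite ler_piMr// lerBlDl ltW.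
Qed.

(* Completing the square: [|z|^2 / 2 - <v, z> + |v|^2 / 2 = |z - v|^2 / 2], which is
   at most [1 / N^2] for the nearest grid point [v]. *)
Lemma grid_bound z : `|z.1| <= 2 -> `|z.2| <= 2 ->
  expR (N * gam / 2 * sqn z) <=
  \sum_ij expR (N * gam * dotp (gridpt N ij) z - N * gam / 2 * sqn (gridpt N ij) + gam).
Proof.
move=> /grid_coord[i hi] /grid_coord[j hj].
rewrite (bigD1 (i, j))//=; apply: (@le_trans _ _ (expR (N * gam * dotp (gridpt N (i, j)) z -
    N * gam / 2 * sqn (gridpt N (i, j)) + gam))); last first.
  by rewrite lerDl; apply: sumr_ge0 => ? _; exact: expR_ge0.
rewrite ler_expR /gridpt /dotp /sqn/=.
set a := N^-1 * i%:R - 2 in hi *; set b := N^-1 * j%:R - 2 in hj *.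
have h1 : (z.1 - a) ^+ 2 <= (N^-1) ^+ 2.
  by rewrite -(real_normK (num_real (z.1 - a))) lerXn2r// nnegrE invr_ge0 ltW.
have h2 : (z.2 - b) ^+ 2 <= (N^-1) ^+ 2.
  by rewrite -(real_normK (num_real (z.2 - b))) lerXn2r// nnegrE invr_ge0 ltW.
have h3 : N * gam / 2 * ((z.1 - a) ^+ 2 + (z.2 - b) ^+ 2) <= gam.
  apply: (@le_trans _ _ (N * gam / 2 * ((N^-1) ^+ 2 + (N^-1) ^+ 2))).
    rewrite ler_pM2l; first exact: lerD.
    by rewrite divr_gt0// mulr_gt0.
  have -> : N * gam / 2 * ((N^-1) ^+ 2 + (N^-1) ^+ 2) = gam * N^-1.
    by field; rewrite gt_eqF.
  rewrite ler_piMr ?(ltW gam0)// invf_le1//.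
  by rewrite /N ler1n.
clear h1 h2 hi hj; clearbody a b; move: h3; move: (z.1) (z.2) => x y h3.
have -> : N * gam / 2 * (x ^+ 2 + y ^+ 2) = N * gam * (a * x + b * y) -
    N * gam / 2 * (a ^+ 2 + b ^+ 2) + N * gam / 2 * ((x - a) ^+ 2 + (y - b) ^+ 2) by field.
by rewrite lerD2l.
Qed.

Lemma prod_zc_hoeffding u (t : seq 'I_q) : \prod_(l <- t) zc l (sc beta M + u) <=
  \prod_(l <- t) zc l (sc beta M) * expR (dotp u (\sum_(l <- t) (mc l (sc beta M)).1,
     \sum_(l <- t) (mc l (sc beta M)).2) + (size t)%:R * (s ^+ 2 * sqn u / 2)).
Proof.
elim: t => [|l t IH]; first by rewrite !big_nil /dotp/= !mulr0 mul0r !addr0 expR0 mulr1.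
rewrite !big_cons/=.
apply: le_trans (ler_pM _ _ (zc_hoeffding q_gt1 l (sc beta M) u) IH) _.
- exact/ltW/zc_gt0.
- by elim: t {IH} => [|a t IH]; rewrite ?big_nil// big_cons mulr_ge0// ltW// zc_gt0.
rewrite mulrACA -expRD le_eqVlt; apply/orP; left; apply/eqP; congr (_ * expR _).
rewrite -(natr1 (size t)) /dotp/= -/s.
move: (\sum_(_ <- _) _) (\sum_(_ <- _) _) ((size t)%:R : R) (sqn u) => *.
by ring.
Qed.

(** For a grid point v the Hoeffding term (N - 1) s^2 gam^2 |v|^2 / 2 is absorbed by the Gaussian
    cost N gam |v|^2 / 2 because gam s^2 = 1, and the linear terms cancel by the fixed-point
    equation up to the missing spin k. There remain gam from the mesh and at most 4 gam from the
    spin k, hence exp(5 gam) per grid point. *)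
Lemma Ji_grid : Ji ls (fun p => expR (dotp (sc beta M) p) * expR (N * gam / 2 * D p)) (0, 0) <=
  gridn%:R ^+ 2 * expR (5 * gam) * P0.
Proof.
pose C (ij : 'I_gridn * 'I_gridn) : R :=
  expR (- (N * gam * dotp (gridpt N ij) M) - N * gam / 2 * sqn (gridpt N ij) + gam).
pose U (ij : 'I_gridn * 'I_gridn) : R * R :=
  (gam * (gridpt N ij).1, gam * (gridpt N ij).2).
pose F ij p := C ij * expR (dotp (sc beta M + U ij) p).
have gF ij : loclip (F ij) by exact/loclipZ/loclip_expdot.
apply: (@le_trans _ _ (Ji ls (fun p => \sum_ij F ij p) (0, 0))).
  apply: Ji_le => // [||v v1 v2].
  - apply: loclipM; first exact: loclip_expdot.
    by apply: loclip_expR; apply: loclipZ; exact: loclip_devn.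
  - exact: loclip_sum.
  - have bz (x m : R) : `|x - 0| <= (size ls)%:R -> `|m| <= 1 -> `|N^-1 * x - m| <= 2.
      rewrite subr0 => hx hm; rewrite (le_trans (ler_normB _ _))//.
      rewrite -[2]/(1 + 1); apply: lerD => //.
      rewrite normrM gtr0_norm ?invr_gt0// mulrC ler_pdivrMr// mul1r.
      by apply: (le_trans hx); rewrite /N ler_nat.
    have := @grid_bound (N^-1 * v.1 - M.1, N^-1 * v.2 - M.2) (bz _ _ v1 M1) (bz _ _ v2 M2).
    rewrite -/(D v) => h.
    apply: (le_trans (ler_wpM2l (expR_ge0 _) h)).
    rewrite mulr_sumr; apply: ler_sum => ij _.
    rewrite /F /C -!expRD ler_expR /U /dotp/= le_eqVlt; apply/orP; left; apply/eqP.
    move: (gridpt N ij).1 (gridpt N ij).2 (sqn (gridpt N ij)) => a b c.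
    by field; rewrite gt_eqF.
rewrite Ji_sum//.
apply: (@le_trans _ _ (\sum_(ij : 'I_gridn * 'I_gridn) expR (5 * gam) * P0)); last first.
  by rewrite sumr_const card_prod card_ord -[_ *+ (_ * _)]mulr_natl natrM -expr2 mulrA.
apply: ler_sum => ij _.
rewrite /F (JiZ _ _ _ (loclip_expdot _)) ?Ji_expdot//.
apply: le_trans (ler_wpM2l (expR_ge0 _) (prod_zc_hoeffding _ _)) _.
rewrite -/P0 mulrCA mulrC ler_pM2r ?P0_gt0// -expRD ler_expR.
have -> : \sum_(l <- ls) (mc l (sc beta M)).1 = N * M.1 - (mc k (sc beta M)).1.
  by rewrite -mean1 addrK.
have -> : \sum_(l <- ls) (mc l (sc beta M)).2 = N * M.2 - (mc k (sc beta M)).2.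
  by rewrite -mean2 addrK.
have [m1 m2] := mc_bound q_gt1 k (sc beta M).
have sN : (size ls)%:R = N - 1 by rewrite /N -(natr1 (size ls)) addrK.
rewrite sN /U /dotp /sqn/=.
have g1 (i : 'I_gridn) : `|N^-1 * i%:R - 2| <= 2.
  have i0 : (0 : R) <= N^-1 * i%:R by rewrite mulr_ge0 ?invr_ge0// ltW.
  have i4 : N^-1 * i%:R <= 4.
    rewrite mulrC ler_pdivrMr// /N -natrM ler_nat.
    by have := ltn_ord i; rewrite {2}/gridn ltnS.
  by move: (N^-1 * i%:R) i0 i4 => y ? ?; rewrite ler_norml; apply/andP; split; lra.
have := g1 ij.1; have := g1 ij.2; rewrite /gridpt/=.
set a := N^-1 * ij.1%:R - 2; set b := N^-1 * ij.2%:R - 2 => b2 a2.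
move: (mc k (sc beta M)).1 (mc k (sc beta M)).2 m1 m2 => x y x1 y1.
have -> : - (N * gam * (a * M.1 + b * M.2)) - N * gam / 2 * (a ^+ 2 + b ^+ 2) + gam +
  (gam * a * (N * M.1 - x) + gam * b * (N * M.2 - y) +
   (N - 1) * (s ^+ 2 * ((gam * a) ^+ 2 + (gam * b) ^+ 2) / 2)) =
  gam * (1 - (a * x + b * y) - (a ^+ 2 + b ^+ 2) / 2) +
  (N - 1) * gam * (gam * s ^+ 2 - 1) * (a ^+ 2 + b ^+ 2) / 2 by field.
rewrite gams subrr mulr0 mul0r mul0r addr0 [leRHS]mulrC ler_pM2l//.
have ax : `|a * x| <= 2.
  by rewrite normrM -[leRHS]mulr1; apply: ler_pM.
have bY : `|b * y| <= 2.
  by rewrite normrM -[leRHS]mulr1; apply: ler_pM.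
have := sqr_ge0 a; have := sqr_ge0 b.
move: ax bY; move: (a * x) (b * y) (a ^+ 2) (b ^+ 2) => c d e f.
by rewrite !ler_norml => /andP[? ?] /andP[? ?] *; lra.
Qed.

(** Where D <= d the integrand is at most d w. Elsewhere D <= 8, and passing from beta to gam in the
    exponent gains exp(N eta D / 2) >= exp(N eta d / 2), so the integrand is dominated by that of
    [Ji_grid] times the small factor [e]. *)
Lemma concentration (d : R) : 0 < d ->
  Ji ls (fun p => w p * D p) (0, 0) <=
  (d + 8 * expR (- (N * eta / 2 * d)) * (gridn%:R ^+ 2 * expR (5 * gam))) * Ji ls w (0, 0).
Proof.
move=> d0; set e := expR (- (N * eta / 2 * d)).
pose T p := expR (dotp (sc beta M) p) * expR (N * gam / 2 * D p).
have gT : loclip T.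
  apply: loclipM; first exact: loclip_expdot.
  by apply: loclip_expR; apply: loclipZ; exact: loclip_devn.
have gw : loclip w by exact: loclip_wgt.
have gD : loclip D by exact: loclip_devn.
apply: (@le_trans _ _ (Ji ls (fun p => d * w p + (8 * e * A0) * T p) (0, 0))).
  apply: Ji_le => // [||v v1 v2].
  - exact: loclipM.
  - by apply: loclipD; exact: loclipZ.
  - have w0 : 0 < w v by rewrite /w /wgt expR_gt0.
    have T0 : 0 <= 8 * e * A0 * T v.
      by rewrite !mulr_ge0 ?expR_ge0.
    have [Dd|dD] := leP (D v) d.
      apply: (@le_trans _ _ (d * w v)); first by rewrite mulrC ler_pM2r.
      by rewrite lerDl.
    apply: (@le_trans _ _ (8 * e * A0 * T v)); last by rewrite lerDr mulr_ge0// ltW.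
    have D8 : D v <= 8.
      have bz (x m : R) : `|x - 0| <= (size ls)%:R -> `|m| <= 1 -> (N^-1 * x - m) ^+ 2 <= 4.
        rewrite subr0 => hx hm.
        have : `|N^-1 * x - m| <= 2.
          rewrite (le_trans (ler_normB _ _))//.
          rewrite -[2]/(1 + 1); apply: lerD => //.
          rewrite normrM gtr0_norm ?invr_gt0// mulrC ler_pdivrMr// mul1r.
          by apply: (le_trans hx); rewrite /N ler_nat.
        move=> h; rewrite -(real_normK (num_real (N^-1 * x - m))).
        have := normr_ge0 (N^-1 * x - m); move: (`|_|) h => y *; nra.
      have := bz _ _ v1 M1; have := bz _ _ v2 M2; rewrite /D /devn /sqn/=.
      by move: (_ ^+ 2) (_ ^+ 2) => *; lra.
    have -> : 8 * e * A0 * T v = 8 * (w v * (e * expR (N * eta / 2 * D v))).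
      have -> : T v = expR (dotp (sc beta M) v) *
          (expR (N * beta / 2 * D v) * expR (N * eta / 2 * D v)).
        rewrite /T -[in RHS]expRD; by congr (_ * expR _); rewrite /eta; ring.
      by rewrite wgtE; ring.
    rewrite mulrC; apply: ler_pM => //; first by rewrite /D /devn sqn_ge0.
      exact: ltW.
    rewrite ler_pMr// /e -expRD -(@expR0 R) ler_expR addrC -mulrBr.
    rewrite mulr_ge0 ?subr_ge0 ?ltW//.
    by rewrite divr_gt0// mulr_gt0.
rewrite JiD//; try exact: loclipZ.
rewrite (JiZ q_gt1 _ d gw) (JiZ q_gt1 _ (8 * e * A0) gT) [leRHS]mulrDl lerD2l.
apply: (@le_trans _ _ (8 * e * A0 * (gridn%:R ^+ 2 * expR (5 * gam) * P0))).
  by rewrite ler_wpM2l ?Ji_grid// !mulr_ge0 ?expR_ge0.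
have -> : 8 * e * A0 * (gridn%:R ^+ 2 * expR (5 * gam) * P0) =
   8 * e * (gridn%:R ^+ 2 * expR (5 * gam)) * (A0 * P0) by ring.
by rewrite ler_wpM2l ?Ji_wgt_ge// !mulr_ge0 ?expR_ge0 ?exprn_ge0.
Qed.

End Concentration.

(** * Convergence of the jump rates *)

Section Rates.
Variables (R : realType) (q : nat).
Hypothesis q_gt1 : (1 < q)%N.
Variable beta : R.
Hypotheses (beta_gt0 : 0 < beta) (beta_lt : beta * sin (pi / q%:R) ^+ 2 < 1).
Implicit Types (u v p M : R * R) (k l : 'I_q) (nu : 'rV[R]_q) (n : nat).

Let q0 : 0 < q%:R :> R. Proof. by rewrite ltr0n; case: q q_gt1. Qed.

(** Limiting rate as a function of the mean alone. The finite-N rate is a weighted average of its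
    values at p / N. *)
Definition rk k u : R := expR (dot_e (cell_pt R k) (sc beta u)) / zc k (sc beta u).

Lemma rate_cE k nu : rate_c beta k nu = rk k (M_beta beta nu).
Proof.
have scE s M : beta * dot_e s M = dot_e s (sc beta M) by rewrite /dot_e /sc/=; ring.
rewrite /rate_c /rk scE; congr (_ / _).
by apply: eq_ci => x _; rewrite scE.
Qed.

Lemma rk_gt0 k u : 0 < rk k u.
Proof. by rewrite divr_gt0 ?expR_gt0 ?zc_gt0. Qed.

(** For a mean in [-1, 1]^2 the exponents are at most 2 beta in absolute value, which costs exp(2
    beta) in the numerator and again in the denominator; a cell has length 2 pi / q. *)
Definition rbound : R := expR (4 * beta) / (2 * pi / q%:R).

Lemma rbound_gt0 : 0 < rbound.
Proof. by rewrite !divr_gt0 ?expR_gt0 ?mulr_gt0 ?pi_gt0. Qed.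

Let rb2 : 0 <= rbound * (2 * beta).
Proof. exact: mulr_ge0 (ltW rbound_gt0) (mulr_ge0 (ler0n _ _) (ltW beta_gt0)). Qed.

Let sc_bound u : inbox 1 u -> `|(sc beta u).1| + `|(sc beta u).2| <= 2 * beta.
Proof.
move=> [u1 u2]; rewrite /sc/= !normrM (gtr0_norm beta_gt0) -mulrDr mulrC.
by rewrite ler_pM2r//; lra.
Qed.

Lemma rk_le k u : inbox 1 u -> rk k u <= rbound.
Proof.
move=> bu; rewrite /rk ler_pdivrMr ?zc_gt0//.
have sb := sc_bound bu.
have h1 : dot_e (cell_pt R k) (sc beta u) <= 2 * beta.
  by apply: le_trans sb; apply: le_trans (abs_dot_e _ _); exact: ler_norm.
have h2 : 2 * pi / q%:R * expR (- (2 * beta)) <= zc k (sc beta u).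
  apply: le_trans (zc_ge q_gt1 k (sc beta u)).
  by rewrite ler_pM2l ?divr_gt0 ?mulr_gt0 ?pi_gt0// ler_expR lerN2.
apply: (@le_trans _ _ (rbound * (2 * pi / q%:R * expR (- (2 * beta))))); last first.
  by rewrite ler_pM2l ?rbound_gt0.
rewrite /rbound mulrA divfK ?gt_eqF ?divr_gt0 ?mulr_gt0 ?pi_gt0//.
rewrite -expRD ler_expR; lra.
Qed.

Lemma rkE k u : rk k u = expR (dot_e (cell_pt R k) (sc beta u) - ln (zc k (sc beta u))).
Proof. by rewrite expRB lnK// posrE zc_gt0. Qed.

Lemma dist1_sc u v : `|(sc beta u).1 - (sc beta v).1| + `|(sc beta u).2 - (sc beta v).2| =
  beta * dist1 u v.
Proof. by rewrite /sc/= -!mulrBr !normrM (gtr0_norm beta_gt0) -mulrDr. Qed.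

Lemma rk_lip k u v : inbox 1 u -> inbox 1 v ->
  `|rk k u - rk k v| <= rbound * (2 * beta) * dist1 u v.
Proof.
move=> bu bv.
set a := dot_e (cell_pt R k) (sc beta u) - ln (zc k (sc beta u)).
set b := dot_e (cell_pt R k) (sc beta v) - ln (zc k (sc beta v)).
have ra : rk k u = expR a by exact: rkE.
have rb : rk k v = expR b by exact: rkE.
have la : a <= ln rbound.
  by rewrite -ler_expR -ra lnK ?posrE ?rbound_gt0// rk_le.
have lb : b <= ln rbound.
  by rewrite -ler_expR -rb lnK ?posrE ?rbound_gt0// rk_le.
rewrite ra rb; apply: (le_trans (expR_lip la lb)).
rewrite lnK ?posrE ?rbound_gt0// -mulrA ler_pM2l ?rbound_gt0//.
have -> : a - b = dot_e (cell_pt R k) (sc beta u - sc beta v) -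
    (ln (zc k (sc beta u)) - ln (zc k (sc beta v))).
  rewrite /a /b /dot_e/=; move: (ln (zc k (sc beta u))) (ln (zc k (sc beta v))) => *.
  by ring.
rewrite (le_trans (ler_normB _ _))// mulr_natl mulr2n mulrDl; apply: lerD.
  by apply: (le_trans (abs_dot_e _ _)); rewrite -dist1_sc.
by rewrite -dist1_sc; exact: ln_zc_lip.
Qed.

Lemma fix_inbox nu M : probvec nu -> is_fix beta nu M -> inbox 1 M.
Proof. by move=> pn fM; have := Psi_bound q_gt1 (sc beta M) pn; rewrite fM. Qed.

Lemma rate_c_ge0 k nu : 0 <= rate_c beta k nu.
Proof. by rewrite rate_cE ltW// rk_gt0. Qed.

Lemma rate_c_le k nu : probvec nu -> rate_c beta k nu <= rbound.
Proof.
move=> pn; have [M fM] := is_fix_exists q_gt1 beta_gt0 pn.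
rewrite rate_cE (M_betaE q_gt1 beta_gt0 beta_lt pn fM) rk_le//.
exact: fix_inbox fM.
Qed.

(** Lipschitz constant of the rate in the mean, times that of the mean in the macrostate. *)
Definition rate_lip : R := rbound * (2 * beta) * (2 / (1 - beta * sin (pi / q%:R) ^+ 2)).

Lemma rate_lip_ge0 : 0 <= rate_lip.
Proof.
apply: mulr_ge0; last by rewrite divr_ge0// subr_ge0 ltW.
exact: rb2.
Qed.

Lemma rate_c_lip k nu nu' : probvec nu -> probvec nu' ->
  `|rate_c beta k nu - rate_c beta k nu'| <=
    rate_lip * \sum_j `|nu ord0 j - nu' ord0 j|.
Proof.
move=> pn pn'; have [M fM] := is_fix_exists q_gt1 beta_gt0 pn.
have [M' fM'] := is_fix_exists q_gt1 beta_gt0 pn'.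
rewrite !rate_cE (M_betaE q_gt1 beta_gt0 beta_lt pn fM).
rewrite (M_betaE q_gt1 beta_gt0 beta_lt pn' fM').
apply: (le_trans (rk_lip k (fix_inbox pn fM) (fix_inbox pn' fM'))).
rewrite /rate_lip -[leRHS]mulrA; apply: ler_wpM2l.
  exact: rb2.
have := is_fix_lip q_gt1 beta_gt0 beta_lt pn pn' fM fM'.
rewrite -/(dist1 M M') [2 / _]mulrC -[_ * 2 * _]mulrA.
have a0 : 0 < 1 - beta * sin (pi / q%:R) ^+ 2 by rewrite subr_gt0.
by rewrite -ler_pdivlMl.
Qed.

Lemma count_config n (x : EN q n) l : count_mem l (config x) = val x l.
Proof.
rewrite /config count_flatten -map_comp.
rewrite (eq_map (g := fun j => ((val x j : nat) * (j == l))%N)); last first.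
  by move=> j /=; rewrite count_nseq mulnC.
rewrite sumnE big_map big_enum/= (bigD1 l)//= eqxx muln1 big1 ?addn0// => j jl.
by rewrite (negbTE jl) muln0.
Qed.

Lemma big_config n (x : EN q n) (f : 'I_q -> R) :
  \sum_(l <- config x) f l = \sum_l (val x l : nat)%:R * f l.
Proof.
rewrite /config big_flatten big_map big_enum/=; apply: eq_bigr => l _.
by rewrite big_nseq iter_addr_0 mulr_natl.
Qed.

Lemma size_config n (x : EN q n) : size (config x) = n.
Proof.
apply/eqP; rewrite -(eqr_nat R); apply/eqP.
have := big_config x (fun=> 1); rewrite big_const_seq count_predT iter_addr_0 => ->.
transitivity ((\sum_l (val x l : nat))%:R : R); last by rewrite (eqP (valP x)).
by rewrite natr_sum; apply: eq_bigr => l _; rewrite mulr1.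
Qed.

Lemma probvec_emb n (x : EN q n.+1) : probvec (emb R x).
Proof.
split=> [k|]; first by rewrite mxE divr_ge0.
under eq_bigr do rewrite mxE.
by rewrite -mulr_suml -natr_sum (eqP (valP x)) divff.
Qed.

Lemma Ji_abs ls (G H : R * R -> R) p : loclip G -> loclip H ->
  (forall v, `|v.1 - p.1| <= (size ls)%:R -> `|v.2 - p.2| <= (size ls)%:R -> `|G v| <= H v) ->
  `|Ji ls G p| <= Ji (q := q) ls H p.
Proof.
move=> gG gH GH; rewrite ler_norml; apply/andP; split.
  rewrite -mulN1r -[_ * _]/((fun p => -1 * Ji ls H p) p) -JiZ//.
  apply: Ji_le => //; first exact: loclipZ.
  by move=> v v1 v2; have := GH v v1 v2; rewrite ler_norml mulN1r => /andP[].
apply: Ji_le => // v v1 v2; have := GH v v1 v2; by rewrite ler_norml => /andP[].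
Qed.

Section FixedN.
Variables (n : nat) (x : EN q n.+1) (k : 'I_q).
Hypothesis xk : (0 < val x k)%N.
Let N : R := n.+1%:R.
Let N0 : 0 < N. Proof. by rewrite ltr0n. Qed.
Let ls := rem k (config x).

Lemma mem_config : k \in config x.
Proof. by rewrite -has_pred1 has_count count_config. Qed.

Lemma size_rem_config : (size ls).+1 = n.+1.
Proof. by rewrite /ls size_rem ?mem_config// size_config. Qed.

Lemma big_rem_config (f : 'I_q -> R) :
  \sum_(l <- ls) f l + f k = N * \sum_l emb R x ord0 l * f l.
Proof.
have -> : \sum_(l <- ls) f l + f k = \sum_(l <- k :: ls) f l.
  by rewrite big_cons addrC.
rewrite -(perm_big _ (perm_to_rem mem_config)) big_config mulr_sumr.
by apply: eq_bigr => l _; rewrite mxE mulrA [N * _]mulrC divfK.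
Qed.

Let avg p : R * R := (N^-1 * p.1, N^-1 * p.2).
Let w := wgt beta N.

(** Since |e_t| = 1, |p + e_t|^2 = |p|^2 + 2 <p, e_t> + 1: one further spin acts as a tilt with
    mean-field parameter p / N, up to a constant that cancels in the rate. *)
Lemma wgt_shift p t : w (p.1 + cos t, p.2 + sin t) =
  expR (beta / (2 * N)) * (w p * expR (dot_e t (sc beta (avg p)))).
Proof.
rewrite /w /wgt -!expRD; congr expR; rewrite /sqn /dot_e /sc/=.
have e1 : sin t ^+ 2 = 1 - cos t ^+ 2 by exact: sin2cos2.
have -> : (p.1 + cos t) ^+ 2 + (p.2 + sin t) ^+ 2 =
  (p.1 ^+ 2 + p.2 ^+ 2) + 2 * (p.1 * cos t + p.2 * sin t) + 1.
  by rewrite !sqrrD e1; ring.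
by field; rewrite gt_eqF.
Qed.

Lemma loclip_avg (G : R * R -> R) : loclip G -> loclip (fun p => G (sc beta (avg p))).
Proof.
move=> gG; have H := @loclip_comp_affine _ G (beta / N) (0, 0) gG.
by apply: loclip_ext H => p; rewrite /sc /avg/= !addr0 !mulrA.
Qed.

Let hN p : R := expR (dot_e (cell_pt R k) (sc beta (avg p))).
Let zN p : R := zc k (sc beta (avg p)).

Lemma loclip_hN : loclip hN.
Proof.
apply: loclip_expR; apply: (@loclip_avg (fun u => dot_e (cell_pt R k) u)).
by apply: loclipD; apply: loclipZ; [exact: loclip_fst|exact: loclip_snd].
Qed.

Lemma loclip_zN : loclip zN. Proof. exact: (loclip_avg (loclip_zc q_gt1 k)). Qed.

Lemma rate_cN_num :
  iint ls (fun s => expR (- N * Phi_emp beta n.+1 (cell_pt R k :: s))) =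
  expR (beta / (2 * N)) * Ji ls (fun p => w p * hN p) (0, 0).
Proof.
have gw : loclip w by exact: loclip_wgt.
have gh := loclip_hN.
rewrite -[_ * _]/((fun p => expR (beta / (2 * N)) * Ji ls (fun p => w p * hN p) p) (0, 0)).
rewrite -JiZ//; last exact: loclipM.
rewrite -(iint_Ji _ _ (0, 0)); congr (iint ls _); apply/funext => s.
have := wgt_shift (0 + \sum_(t <- s) cos t, 0 + \sum_(t <- s) sin t) (cell_pt R k).
rewrite /hN => <-; rewrite /w /wgt; congr expR.
rewrite /Phi_emp !big_cons /sqn/= -!mulr_suml !add0r.
move: (\sum_(_ <- _) _) (\sum_(_ <- _) _) (cos _) (sin _) => a b c d.
by rewrite -/N; field; rewrite gt_eqF.
Qed.

Lemma rate_cN_den :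
  iint (config x) (fun s => expR (- N * Phi_emp beta n.+1 s)) =
  expR (beta / (2 * N)) * Ji ls (fun p => w p * zN p) (0, 0).
Proof.
have gw : loclip w by exact: loclip_wgt.
have gz := loclip_zN.
rewrite -[_ * Ji _ _ _]/((fun p => expR (beta / (2 * N)) * Ji ls (fun p => w p * zN p) p) (0, 0)).
rewrite -JiZ//; last exact: loclipM.
transitivity (Ji (config x) w (0, 0)).
  rewrite -(iint_Ji _ _ (0, 0)); congr (iint _ _); apply/funext => s.
  rewrite /w /wgt; congr expR.
  rewrite /Phi_emp /sqn/= -!mulr_suml !add0r.
  move: (\sum_(_ <- _) _) (\sum_(_ <- _) _) => a b.
  by rewrite -/N; field; rewrite gt_eqF.
rewrite (Ji_rem q_gt1 gw mem_config) -/ls; congr (Ji ls _ _); apply/funext => p.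
rewrite /Kc /zN /zc /zint.
rewrite (@eq_ci _ _ _ _ (fun t => expR (beta / (2 * N)) * w p * expR (dot_e t (sc beta (avg p))))).
  by rewrite ciZ ?mulrA//; exact: continuous_exp_dot_e.
by move=> t _; rewrite wgt_shift mulrA.
Qed.

(** Error term of [concentration] for N = m + 1. *)
Definition conc_error (m : nat) (d : R) : R :=
  8 * expR (- (m.+1%:R * ((sin (pi / q%:R) ^+ 2)^-1 - beta) / 2 * d)) *
    ((4 * m.+1).+1%:R ^+ 2 * expR (5 * (sin (pi / q%:R) ^+ 2)^-1)).

Definition rate_const : R := expR (8 * beta) * (rbound * (2 * beta)).

(** The numerator minus c times the denominator is the weighted integral of zN (rk(p / N) - c), and
    [rk] is Lipschitz, so the distance of p / N to M has to be averaged. In [rate_const] one factor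
    exp(4 beta) bounds zN from above by z, the other bounds the denominator from below. *)
Lemma rate_cN_error (d : R) : 0 < d ->
  `|rate_cN beta k x - rate_c beta k (emb R x)| <=
  rate_const * (d + (d ^+ 2 + conc_error n (d ^+ 2)) / (2 * d)).
Proof.
move=> d0.
have pe := probvec_emb x.
have [M fM] := is_fix_exists q_gt1 beta_gt0 pe.
have [M1 M2] := fix_inbox pe fM.
rewrite rate_cE (M_betaE q_gt1 beta_gt0 beta_lt pe fM) /rate_cN rate_cN_num rate_cN_den.
set E := expR (beta / (2 * N)); have E0 : 0 < E by exact: expR_gt0.
set c := rk k M; set z := zc k (sc beta M).
have z0 : 0 < z by exact: zc_gt0.
have gw : loclip w by exact: loclip_wgt.
have gh := loclip_hN; have gz := loclip_zN.
pose D p := devn M N p.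
have gD : loclip D by exact: loclip_devn.
have szN : (size ls).+1%:R = N by rewrite size_rem_config.
(* The threshold is d^2 because D is a squared distance. *)
have conc : Ji ls (fun p => w p * D p) (0, 0) <=
    (d ^+ 2 + conc_error n (d ^+ 2)) * Ji ls w (0, 0).
  have m1 : \sum_(l <- ls) (mc l (sc beta M)).1 + (mc k (sc beta M)).1 = (size ls).+1%:R * M.1.
    by rewrite szN -[in RHS]fM; exact: (big_rem_config (fun l => (mc l (sc beta M)).1)).
  have m2 : \sum_(l <- ls) (mc l (sc beta M)).2 + (mc k (sc beta M)).2 = (size ls).+1%:R * M.2.
    by rewrite szN -[in RHS]fM; exact: (big_rem_config (fun l => (mc l (sc beta M)).2)).
  have := concentration q_gt1 beta_gt0 beta_lt M1 M2 m1 m2 (exprn_gt0 2 d0).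
  by rewrite szN size_rem_config.
have box p : `|p.1 - (0 : R)| <= (size ls)%:R -> `|p.2 - (0 : R)| <= (size ls)%:R ->
    inbox 1 (avg p).
  have H (y : R) : `|y - 0| <= (size ls)%:R -> `|N^-1 * y| <= 1.
    rewrite subr0 => hy; rewrite normrM gtr0_norm ?invr_gt0// mulrC ler_pdivrMr// mul1r.
    by apply: (le_trans hy); rewrite -szN ler_nat.
  by move=> p1 p2; split; rewrite /=; exact: H.
have dist4 u : inbox 1 u -> dist1 u M <= 4.
  move=> [u1 u2]; rewrite /dist1.
  have := ler_normB u.1 M.1; have := ler_normB u.2 M.2; lra.
have zup p : inbox 1 (avg p) -> zN p <= z * expR (4 * beta).
  move=> bp; rewrite /zN -[zc k _](lnK (zc_gt0 q_gt1 k _ : _ \is Num.pos)).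
  rewrite -[z](lnK (z0 : _ \is Num.pos)) -expRD ler_expR -lerBlDl.
  apply: (le_trans (ler_norm _)); apply: (le_trans (ln_zc_lip q_gt1 _ _ _)).
  by rewrite dist1_sc mulrC ler_pM2r// dist4.
have zlo p : inbox 1 (avg p) -> z * expR (- (4 * beta)) <= zN p.
  move=> bp; rewrite /zN -[zc k (sc beta (avg p))](lnK (zc_gt0 q_gt1 k _ : _ \is Num.pos)).
  rewrite -[z](lnK (z0 : _ \is Num.pos)) -expRD ler_expR lerBlDr -lerBlDl.
  apply: (le_trans (ler_norm _)); apply: (le_trans (ln_zc_lip q_gt1 _ _ _)).
  by rewrite dist1_sc mulrC ler_pM2r// /dist1 distrC [`|M.2 - _|]distrC dist4.
have Jw0 : 0 < Ji ls w (0, 0).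
  apply: (@lt_le_trans _ _ (Ji ls (fun p => expR (dotp (0, 0) p)) (0, 0))).
    rewrite Ji_exp mulr_gt0 ?expR_gt0//.
    by elim: ls => [|l t IH]; rewrite ?big_nil// big_cons mulr_gt0// zc_gt0.
  apply: Ji_le => // [|p _ _]; first exact: loclip_expdot.
  rewrite ler_expR /dotp/= !mul0r addr0 mulr_ge0 ?sqn_ge0//.
  by rewrite divr_ge0// ?mulr_ge0// ltW.
set Num := Ji ls (fun p => w p * hN p) (0, 0).
set Den := Ji ls (fun p => w p * zN p) (0, 0).
have DenL : z * expR (- (4 * beta)) * Ji ls w (0, 0) <= Den.
  rewrite -[X in X <= _]/((fun p => z * expR (- (4 * beta)) * Ji ls w p) (0, 0)) -JiZ//.
  apply: Ji_le => // [||p p1 p2]; [exact: loclipZ|exact: loclipM|].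
  by rewrite [leLHS]mulrC; apply: ler_wpM2l; [exact: expR_ge0|exact: (zlo _ (box p p1 p2))].
have Den0 : 0 < Den by apply: lt_le_trans DenL; rewrite !mulr_gt0 ?expR_gt0.
have -> : E * Num / (E * Den) = Num / Den.
  by rewrite -mulf_div divff ?gt_eqF// mul1r.
have -> : Num / Den - c = (Num - c * Den) / Den by rewrite mulrBl mulfK// gt_eqF.
rewrite normrM normfV (gtr0_norm Den0) ler_pdivrMr//.
set K := z * expR (4 * beta) * (rbound * (2 * beta)).
have K0 : 0 <= K by apply: mulr_ge0 rb2; rewrite mulr_ge0 ?expR_ge0// ltW.
have NumE : Num - c * Den = Ji ls (fun p => w p * (hN p - c * zN p)) (0, 0).
  rewrite (_ : (fun p => _ * (_ - _)) = (fun p => w p * hN p + (- c) * (w p * zN p))); last first.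
    by apply/funext => p; ring.
  by rewrite JiD ?JiZ ?mulNr//; try apply: loclipZ; exact: loclipM.
have up : `|Num - c * Den| <= K * (d + (d ^+ 2 + conc_error n (d ^+ 2)) / (2 * d)) * Ji ls w (0, 0).
  rewrite NumE.
  apply: (@le_trans _ _ (Ji ls (fun p => K * d * w p + K / (2 * d) * (w p * D p)) (0, 0))).
    apply: Ji_abs => [||p p1 p2].
    - apply: loclipM => //; apply: loclipD => //.
      by apply: loclip_ext (loclipZ (- c) gz) => p; rewrite mulNr.
    - by apply: loclipD; apply: loclipZ => //; exact: loclipM.
    - have bp := box p p1 p2.
      have w0 : 0 < w p by exact: expR_gt0.
      rewrite normrM (gtr0_norm w0).
      have -> : K * d * w p + K / (2 * d) * (w p * D p) = w p * (K * (d + D p / (2 * d))).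
        by field; rewrite gt_eqF.
      rewrite ler_pM2l//.
      have -> : hN p - c * zN p = zN p * (rk k (avg p) - c).
        by rewrite mulrBr /rk mulrCA divff ?mulr1 ?gt_eqF ?zc_gt0// [zN p * c]mulrC.
      have zp : 0 < zN p by exact: zc_gt0.
      rewrite normrM (gtr0_norm zp) /K -mulrA.
      apply: ler_pM; [exact: ltW|exact: normr_ge0|exact: zup|].
      apply: (le_trans (rk_lip k bp (conj M1 M2))).
      apply: ler_wpM2l; first exact: rb2.
      (* Arithmetic-geometric mean: it trades the distance for its square, the quantity that
         concentration controls. *)
      have H (y : R) : `|y| <= d / 2 + y ^+ 2 / (2 * d).
        have -> : d / 2 + y ^+ 2 / (2 * d) = (d ^+ 2 + y ^+ 2) / (2 * d).
          by field; rewrite gt_eqF.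
        rewrite ler_pdivlMr ?mulr_gt0// -(real_normK (num_real y)).
        by have := sqr_ge0 (d - `|y|); lra.
      rewrite /dist1 /D /devn /sqn/=.
      move: (N^-1 * p.1 - M.1) (N^-1 * p.2 - M.2) => a b.
      apply: (le_trans (lerD (H _) (H _))).
      by rewrite le_eqVlt; apply/orP; left; apply/eqP; field; rewrite gt_eqF.
  rewrite JiD ?JiZ//; try apply: loclipZ => //; try exact: loclipM.
  apply: (@le_trans _ _ (K * d * Ji ls w (0, 0) +
     K / (2 * d) * ((d ^+ 2 + conc_error n (d ^+ 2)) * Ji ls w (0, 0)))).
    rewrite lerD2l; apply: ler_wpM2l => //.
    by rewrite divr_ge0// mulr_ge0// ltW.
  by rewrite le_eqVlt; apply/orP; left; apply/eqP; field; rewrite gt_eqF.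
apply: (le_trans up).
set X := d + _.
have X0 : 0 <= X.
  by rewrite addr_ge0 ?(ltW d0)// divr_ge0 ?mulr_ge0 ?(ltW d0)// addr_ge0 ?sqr_ge0//
    !mulr_ge0 ?expR_ge0 ?sqr_ge0.
have -> : K * X * Ji ls w (0, 0) = rate_const * X * (z * expR (- (4 * beta)) * Ji ls w (0, 0)).
  have -> : rate_const = expR (4 * beta) * expR (4 * beta) * (rbound * (2 * beta)).
    by rewrite /rate_const -expRD; congr (expR _ * _); ring.
  rewrite /K expRN; field; by rewrite gt_eqF// expR_gt0.
apply: ler_wpM2l => //; apply: mulr_ge0 => //.
by apply: mulr_ge0 rb2; exact: expR_ge0.
Qed.

End FixedN.

Lemma conc_error_cvg (d e : R) : 0 < d -> 0 < e ->
  exists n0, forall n, (n0 <= n)%N -> conc_error n d <= e.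
Proof.
move=> d0 e0.
have s0 := sin_piq_gt0 R q_gt1.
pose a : R := ((sin (pi / q%:R) ^+ 2)^-1 - beta) / 2 * d.
have a0 : 0 < a.
  by rewrite mulr_gt0// divr_gt0// subr_gt0 -div1r ltr_pdivlMr// exprn_gt0.
pose B : R := expR (5 * (sin (pi / q%:R) ^+ 2)^-1).
have B0 : 0 < B by exact: expR_gt0.
(* 6 = 3! comes from exp(x) >= x^3 / 3!, and 25 from 4 N + 1 <= 5 N; cubic decay against N^2 grid
   points leaves C / N. *)
pose C : R := 8 * 25 * B * 6 / a ^+ 3.
have C0 : 0 < C by rewrite divr_gt0 ?exprn_gt0// !mulr_gt0.
exists (Num.truncn (C / e)) => n hn.
set N : R := n.+1%:R.
have N1 : 1 <= N by rewrite ler1n.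
have N0 : 0 < N by rewrite ltr0n.
have CN : C / e <= N.
  have /andP[_ /ltW h] := truncn_itv (divr_ge0 (ltW C0) (ltW e0)).
  by apply: (le_trans h); rewrite ler_nat ltnS.
rewrite /conc_error -/B -/N.
have -> : N * ((sin (pi / q%:R) ^+ 2)^-1 - beta) / 2 * d = N * a by rewrite /a; ring.
have ex : expR (- (N * a)) <= 6 / (N * a) ^+ 3.
  have Na : 0 < N * a by rewrite mulr_gt0.
  rewrite expRN -[X in _ <= X]invrK lef_pV2 ?posrE ?expR_gt0 ?invr_gt0 ?divr_gt0 ?exprn_gt0//.
  have := @expR_ge1Dxn R (N * a) 2 (mulr_ge0 (ltW N0) (ltW a0)).
  rewrite invf_div => h; apply: le_trans h.
  by rewrite (_ : 3`! = 6)// lerDr.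
have g5 : (4 * n.+1).+1%:R <= 5 * N.
  by rewrite -natr1 natrM -/N; lra.
apply: (@le_trans _ _ (8 * (6 / (N * a) ^+ 3) * ((5 * N) ^+ 2 * B))).
  apply: ler_pM.
  - by rewrite mulr_ge0 ?expR_ge0.
  - by rewrite mulr_ge0 ?sqr_ge0// ltW.
  - by rewrite ler_pM2l.
  - by rewrite ler_pM2r// lerXn2r// ?nnegrE ?mulr_ge0 ?(ltW N0).
have -> : 8 * (6 / (N * a) ^+ 3) * ((5 * N) ^+ 2 * B) = C / N.
  by rewrite /C; field; rewrite !gt_eqF.
by rewrite ler_pdivrMr// mulrC -ler_pdivrMr.
Qed.

(** Uniform over all macrostates, as the drift estimate demands. For an unoccupied k no site carries
    the label, and the generator multiplies the rate by 0. *)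
Theorem rate_cN_cvg (e : R) : 0 < e -> exists n0, forall n, (n0 <= n)%N ->
  forall (x : EN q n.+1) k, (0 < val x k)%N ->
  `|rate_cN beta k x - rate_c beta k (emb R x)| <= e.
Proof.
move=> e0.
have C0 : 0 < rate_const.
  apply: mulr_gt0; [exact: expR_gt0|apply: mulr_gt0; first exact: rbound_gt0].
  exact: mulr_gt0.
(* Once the concentration error is below d^2, the bound becomes 2 d times [rate_const]. *)
pose d := e / (2 * rate_const).
have d0 : 0 < d by apply: divr_gt0 => //; exact: mulr_gt0.
have [n0 hn0] := conc_error_cvg (exprn_gt0 2 d0) (exprn_gt0 2 d0).
exists n0 => n nn x k xk; apply: (le_trans (rate_cN_error xk d0)).
have -> : e = rate_const * (d + (d ^+ 2 + d ^+ 2) / (2 * d)).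
  have -> : d + (d ^+ 2 + d ^+ 2) / (2 * d) = 2 * d by field; rewrite gt_eqF.
  by rewrite /d; field; rewrite gt_eqF.
have d2 : 0 < 2 * d by exact: mulr_gt0.
by rewrite ler_pM2l// lerD2l ler_pM2r ?invr_gt0// lerD2l hn0.
Qed.

End Rates.

(** * The empirical ordinary differential equation *)

Section VectorFunctions.
Variables (R : realType) (q : nat).
Implicit Types (f : R -> 'rV[R]_q) (d : 'rV[R]_q).

Lemma is_derive_rV f t d :
  is_derive t (1 : R) f d <-> forall k, is_derive t (1 : R) (fun s => f s ord0 k) (d ord0 k).
Proof.
split=> [[df fd] k|H].
  have dk : derivable (fun s => f s ord0 k) t 1 by exact: (derivable_mxP _ _ _).1.
  by split=> //; rewrite -fd derive_mx// mxE.
have df : derivable f t 1.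
  by apply/derivable_mxP => i j; rewrite (ord1 i); case: (H j).
split=> //; rewrite derive_mx//; apply/rowP => k; rewrite mxE; by case: (H k).
Qed.

Lemma continuous_rV f : (forall k, continuous (fun t => f t ord0 k)) -> continuous f.
Proof.
move=> cf t; apply/cvgrPdist_le => /= e e0; near=> s.
rewrite [leLHS]/Num.Def.normr/= mx_normrE (bigmax_le _ (ltW e0))//= => -[i k] _.
rewrite !mxE (ord1 i)/=; move: k {i}; near: s; apply: filter_forall => /= k.
exact: ((cvgrPdist_le _ _).1 (cf k t)).
Unshelve. all: by end_near. Qed.

Lemma continuous_of_bound (h : R -> R) (B : R -> R -> R) :
  (forall t s, `|h t - h s| <= B t s) -> (forall t, B t s @[s --> t] --> 0) -> continuous h.
Proof.
move=> hB B0 t; apply/cvgrPdist_lt => e e0; near=> s.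
apply: (le_lt_trans (hB t s)); apply: (le_lt_trans (ler_norm _)).
near: s; move/cvgrPdist_lt : (B0 t) => /(_ e e0); apply: filterS => s /=.
by rewrite sub0r normrN.
Unshelve. all: by end_near. Qed.

Lemma dist_cvg0 f (L : R) t : (forall k, continuous (fun t => f t ord0 k)) ->
  L * (\sum_j `|f t ord0 j - f s ord0 j|) @[s --> t] --> (0 : R).
Proof.
move=> cf; rewrite -[X in _ --> X](mulr0 L); apply: cvgM; first exact: cvg_cst.
elim: (index_enum _) => [|j r IH].
  by under eq_cvg do rewrite big_nil; exact: cvg_cst.
have hj : `|f t ord0 j - f s ord0 j| @[s --> t] --> (0 : R).
  rewrite -[X in _ --> X](@normr0 _ R); apply: cvg_norm.
  rewrite -[X in _ --> X](subrr (f t ord0 j)); apply: cvgB; first exact: cvg_cst.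
  exact: cf.
rewrite (_ : (fun s => _) = (fun s => `|f t ord0 j - f s ord0 j| +
    \sum_(i <- r) `|f t ord0 i - f s ord0 i|)).
  have h := cvgD hj IH; rewrite addr0 in h; exact: h.
by apply/funext => s; rewrite big_cons.
Qed.

End VectorFunctions.

Section Primitive.
Variable R : realType.
Implicit Types (f : R -> R).

(** The integrals start at -1 so that 0 is an interior point and the derivative at 0 is
    two-sided. *)
Definition prim f (t : R) : R :=
  \int[@lebesgue_measure R]_(s in `[-1, t]) f s - \int[@lebesgue_measure R]_(s in `[-1, 0]) f s.

Lemma prim0 f : prim f 0 = 0. Proof. by rewrite /prim subrr. Qed.

Lemma is_derive_prim f (t : R) : continuous f -> 0 <= t -> is_derive t 1 (prim f) (f t).
Proof.
move=> cf t0; have t1 : t < t + 1 by rewrite ltrDl.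
have fi : (@lebesgue_measure R).-integrable `[-1, t + 1] (EFin \o f).
  apply: continuous_compact_integrable; first exact: segment_compact.
  exact: continuous_subspaceT.
have m1t : -1 < t by rewrite (lt_le_trans _ t0)// ltrN10.
have [dF Ft] := continuous_FTC1_closed t1 fi m1t (cf t).
rewrite /prim -[f t]subr0; apply: is_deriveB.
by split; [exact: dF|rewrite -derive1E; exact: Ft].
Qed.

End Primitive.

Section Sup.
Variable R : realType.

(** The limit is the supremum of the lower bounds u_n - 2 A 2^-n, each of which lies below every u_m
    + 2 A 2^-m; 2 A 2^-n is the geometric tail. *)
Lemma geometric_limit (u : nat -> R) (A : R) : 0 <= A ->
  (forall n, `|u n.+1 - u n| <= A * 2^-1 ^+ n) ->
  exists x, forall n, `|u n - x| <= 2 * A * 2^-1 ^+ n.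
Proof.
move=> A0 hu.
have nn m n : `|u (n + m)%N - u n| <= 2 * A * 2^-1 ^+ n * (1 - 2^-1 ^+ m).
  elim: m => [|m IH]; first by rewrite addn0 !subrr normr0 mulr0.
  rewrite addnS -[u _](subrK (u (n + m)%N)) -addrA (le_trans (ler_normD _ _))//.
  apply: (le_trans (lerD (hu _) IH)).
  rewrite exprD exprS le_eqVlt; apply/orP; left; apply/eqP.
  by move: (_ ^+ n) (_ ^+ m) => x y; field.
have nn2 m n : `|u (n + m)%N - u n| <= 2 * A * 2^-1 ^+ n.
  apply: (le_trans (nn m n)); rewrite ler_piMr//.
    by rewrite mulr_ge0 ?mulr_ge0// exprn_ge0// invr_ge0.
pose E := [set u n - 2 * A * 2^-1 ^+ n | n in [set: nat]].
have le_all m n : u m - 2 * A * 2^-1 ^+ m <= u n + 2 * A * 2^-1 ^+ n.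
  have h0 n' : 0 <= 2 * A * 2^-1 ^+ n' by rewrite mulr_ge0 ?mulr_ge0// exprn_ge0// invr_ge0.
  have [mn|/ltnW nm] := leqP m n.
    have := nn2 (n - m)%N m; rewrite subnKC// ler_norml => /andP[h1 h2].
    have := h0 n; move: (2 * A * _ ^+ n) (2 * A * _ ^+ m) h1 h2 => x y; lra.
  have := nn2 (m - n)%N n; rewrite subnKC// ler_norml => /andP[h1 h2].
  have := h0 m; move: (2 * A * _ ^+ m) (2 * A * _ ^+ n) h1 h2 => x y; lra.
have supE : has_sup E.
  split; first by exists (u 0%N - 2 * A * 2^-1 ^+ 0); exists 0%N.
  by exists (u 0%N + 2 * A * 2^-1 ^+ 0) => _ [m _ <-]; exact: le_all.
exists (sup E) => n.
have h1 : u n - 2 * A * 2^-1 ^+ n <= sup E.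
  by apply: ub_le_sup; [exact: supE.2|exists n].
have h2 : sup E <= u n + 2 * A * 2^-1 ^+ n.
  by apply: ge_sup; [exact: supE.1|move=> _ [m _ <-]; exact: le_all].
by rewrite ler_norml; apply/andP; split; lra.
Qed.

Lemma le0_of_geometric (x A : R) : (forall n, x <= A * 2^-1 ^+ n) -> x <= 0.
Proof.
move=> h; rewrite leNgt; apply/negP => x0.
have A0 : 0 < A by have := h 0%N; rewrite expr0 mulr1; exact: lt_le_trans.
pose n := Num.truncn (A / x).
have /andP[_ hn] := truncn_itv (divr_ge0 (ltW A0) (ltW x0)).
have n2 : n.+1%:R <= (2 : R) ^+ n.+1 by rewrite -natrX ler_nat ltnW// ltn_expl.
have := h n.+1; rewrite exprVn leNgt => /negP; apply.
rewrite ltr_pdivrMr ?exprn_gt0// mulrC -ltr_pdivrMr//.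
exact: lt_le_trans hn n2.
Qed.

End Sup.

(** * Picard iteration confined to the simplex *)

Section SimplexFlow.
Variables (R : realType) (q : nat) (F : 'rV[R]_q -> 'rV[R]_q) (L C : R).
Implicit Types (v w : 'rV[R]_q) (y : R -> 'rV[R]_q) (k j : 'I_q) (t s : R).

Definition d1 v w : R := \sum_j `|v ord0 j - w ord0 j|.

Hypotheses (L_ge0 : 0 <= L) (C_gt0 : 0 < C).
Hypothesis F_lip : forall v w k, probvec v -> probvec w ->
  `|F v ord0 k - F w ord0 k| <= L * d1 v w.
Hypothesis F_sum : forall v, probvec v -> \sum_k F v ord0 k = 0.
Hypothesis F_ge : forall v k, probvec v -> - (C * v ord0 k) <= F v ord0 k.

Lemma d1_ge0 v w : 0 <= d1 v w. Proof. exact: sumr_ge0. Qed.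

Lemma le_d1 v w k : `|v ord0 k - w ord0 k| <= d1 v w.
Proof. by rewrite /d1 (bigD1 k)//= lerDl; exact: sumr_ge0. Qed.

Lemma probvec_le1 v k : probvec v -> v ord0 k <= 1.
Proof.
by move=> [v0 v1]; rewrite -v1 (bigD1 k)//= lerDl; apply: sumr_ge0.
Qed.

Lemma d1_le2 v w : probvec v -> probvec w -> d1 v w <= 2.
Proof.
move=> [v0 v1] [w0 w1]; apply: (@le_trans _ _ (\sum_j (v ord0 j + w ord0 j))).
  apply: ler_sum => j _; rewrite (le_trans (ler_normB _ _))//.
  by rewrite !ger0_norm.
by rewrite big_split/= v1 w1.
Qed.

(** Adding C v makes the field nonnegative and of constant total C on the simplex. The equation
    becomes phi' = -C phi + Gk(phi), whose integral form preserves positivity and mass. *)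
Definition Gk k v : R := F v ord0 k + C * v ord0 k.

Lemma Gk_ge0 k v : probvec v -> 0 <= Gk k v.
Proof. by move=> pv; have := F_ge k pv; rewrite /Gk -subr_ge0 opprK. Qed.

Lemma Gk_sum v : probvec v -> \sum_k Gk k v = C.
Proof. by move=> pv; rewrite big_split/= F_sum// -mulr_sumr pv.2 mulr1 add0r. Qed.

Lemma Gk_le k v : probvec v -> Gk k v <= C.
Proof.
move=> pv; rewrite -(Gk_sum pv) (bigD1 k)//= lerDl.
by apply: sumr_ge0 => j _; exact: Gk_ge0.
Qed.

Lemma Gk_lip k v w : probvec v -> probvec w -> `|Gk k v - Gk k w| <= (L + C) * d1 v w.
Proof.
move=> pv pw.
have -> : Gk k v - Gk k w = (F v ord0 k - F w ord0 k) + C * (v ord0 k - w ord0 k).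
  by rewrite /Gk; ring.
rewrite (le_trans (ler_normD _ _))// mulrDl lerD ?F_lip//.
by rewrite normrM (gtr0_norm C_gt0) ler_pM2l// le_d1.
Qed.

Definition good_path y : Prop :=
  (forall t, probvec (y t)) /\ forall k, continuous (fun t => y t ord0 k).

Lemma continuous_Gk y k : good_path y -> continuous (fun s => expR (C * s) * Gk k (y s)).
Proof.
move=> [py cy] t; apply: cvgM.
  apply: (@continuous_comp _ _ _ (fun s => C * s) (@expR R)).
    by apply: cvgM; [exact: cvg_cst|exact: cvg_id].
  exact: continuous_expR.
apply: (@continuous_of_bound R (fun s => Gk k (y s)) (fun t s => (L + C) * d1 (y t) (y s))).
  by move=> a b; exact: Gk_lip.
by move=> a; exact: dist_cvg0.
Qed.

Variable nu0 : 'rV[R]_q.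
Hypothesis nu0_prob : probvec nu0.

(** Variation of constants with integrating factor exp(C t). The plain Picard integral could leave
    the simplex, outside which nothing is assumed about [F]; this one cannot. *)
Definition zz y k t : R :=
  expR (- (C * t)) * (nu0 ord0 k + prim (fun s => expR (C * s) * Gk k (y s)) t).
(** Negative times are frozen at 0, so that iterates are good paths on the whole line. *)
Definition picard y t : 'rV[R]_q := \row_k zz y k (Num.max 0 t).

Lemma is_derive_exp_comp (f : R -> R) (t df : R) : is_derive t 1 f df ->
  is_derive t 1 (fun s => expR (f s)) (df * expR (f t)).
Proof.
move=> d; have := @is_derive1_comp R expR f t _ _ (is_derive_expR (f t)) d.
by rewrite mulrC.
Qed.

Lemma is_derive_expM (a t : R) : is_derive t 1 (fun s => expR (a * s)) (a * expR (a * t)).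
Proof.
have d : is_derive t 1 (fun s : R => a * s) a.
  by apply: is_derive_eq; rewrite /GRing.scale/=; ring.
exact: is_derive_exp_comp d.
Qed.

Lemma is_derive_zz y k t : good_path y -> 0 <= t ->
  is_derive t 1 (zz y k) (- C * zz y k t + Gk k (y t)).
Proof.
move=> gy t0; have dp := is_derive_prim (continuous_Gk (k := k) gy) t0.
have de : is_derive t 1 (fun s => expR (- (C * s))) (- C * expR (- (C * t))).
  apply: is_derive_exp_comp; apply: is_derive_eq; rewrite /GRing.scale/=; ring.
set f := fun s => _ in dp.
have dn : is_derive t 1 (fun s => nu0 ord0 k + prim f s) (f t).
  have h := is_deriveD (is_derive_cst (nu0 ord0 k) t 1) dp.
  by apply: (is_derive_eq h); rewrite add0r.
apply: is_derive_eq (is_deriveM de dn) _.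
rewrite /zz -/f /GRing.scale/=.
have e1 : expR (- (C * t)) * f t = Gk k (y t).
  by rewrite /f mulrA -expRD addNr expR0 mul1r.
by rewrite e1; ring.
Qed.

Lemma sum_prim y t : good_path y -> 0 <= t ->
  \sum_k prim (fun s => expR (C * s) * Gk k (y s)) t = expR (C * t) - 1.
Proof.
move=> gy t0.
pose S s := \sum_k prim (fun s => expR (C * s) * Gk k (y s)) s - expR (C * s).
have dS s : 0 <= s -> is_derive s 1 S 0.
  move=> s0.
  have dsum : is_derive s 1 (\sum_k prim (fun s => expR (C * s) * Gk k (y s)))
      (\sum_k expR (C * s) * Gk k (y s)).
    by apply: is_derive_sum => k; apply: is_derive_prim => //; exact: continuous_Gk.
  have := is_deriveB dsum (is_derive_expM C s).
  rewrite -mulr_sumr Gk_sum; last exact: gy.1.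
  rewrite (_ : expR (C * s) * C - C * expR (C * s) = 0); last by ring.
  rewrite (_ : (\sum_k _ - _) = S)//.
  by apply/funext => r; rewrite /S/= fct_sumE.
have S1 : S 0 <= S t.
  by apply: (@nondecreasing_of_derive_all _ S (fun=> 0) 0 t t0) => // s /andP[s0 _]; exact: dS.
have S2 : - S 0 <= - S t.
  apply: (@nondecreasing_of_derive_all _ (fun s => - S s) (fun=> 0) 0 t t0) => // s /andP[s0 _].
  by have := is_deriveN (dS s s0); rewrite oppr0.
have St : S t = S 0 by lra.
have S0 : S 0 = - 1.
  by rewrite /S mulr0 expR0 big1 ?sub0r// => k _; rewrite prim0.
by move: St; rewrite S0 /S => /eqP; rewrite subr_eq addrC => /eqP.
Qed.

Lemma zz_ge0 y k t : good_path y -> 0 <= t -> 0 <= zz y k t.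
Proof.
move=> gy t0; rewrite /zz mulr_ge0 ?expR_ge0// addr_ge0 ?nu0_prob.1//.
rewrite -(@prim0 R (fun s => expR (C * s) * Gk k (y s))).
apply: (@nondecreasing_of_derive_all _ _
  (fun s => expR (C * s) * Gk k (y s)) 0 t t0) => s /andP[s0 _].
  by apply: is_derive_prim => //; exact: continuous_Gk.
by rewrite mulr_ge0 ?expR_ge0// Gk_ge0//; exact: gy.1.
Qed.

Lemma zz_sum y t : good_path y -> 0 <= t -> \sum_k zz y k t = 1.
Proof.
move=> gy t0; rewrite /zz -mulr_sumr big_split/= nu0_prob.2 sum_prim//.
by rewrite subrKC -expRD addNr expR0.
Qed.

Lemma zz_le1 y k t : good_path y -> 0 <= t -> zz y k t <= 1.
Proof.
move=> gy t0; rewrite -(zz_sum gy t0) (bigD1 k)//= lerDl.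
by apply: sumr_ge0 => j _; exact: zz_ge0.
Qed.

Lemma zz_lip y k s t : good_path y -> 0 <= s -> s <= t -> `|zz y k t - zz y k s| <= C * (t - s).
Proof.
move=> gy s0 st.
have bd r : s <= r <= t -> `|- C * zz y k r + Gk k (y r)| <= C.
  move=> /andP[sr _]; have r0 := le_trans s0 sr.
  have h1 := zz_ge0 k gy r0; have h2 := zz_le1 k gy r0.
  have h3 := Gk_ge0 k (gy.1 r); have h4 := Gk_le k (gy.1 r).
  have h5 : C * zz y k r <= C by rewrite ler_piMr// ltW.
  have h6 : 0 <= C * zz y k r by rewrite mulr_ge0// ltW.
  rewrite mulNr ler_norml; apply/andP; split.
    by rewrite lerNl opprD opprK; rewrite (le_trans _ h5)// gerBl.
  by rewrite (le_trans _ h4)// gerDr oppr_le0.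
rewrite ler_norml; apply/andP; split.
- have : zz y k s + C * s <= zz y k t + C * t.
    apply: (@nondecreasing_of_derive_all _ (fun r => zz y k r + C * r)
      (fun r => (- C * zz y k r + Gk k (y r)) + C) s t st) => r rr.
      have dz : is_derive r 1 (zz y k) (- C * zz y k r + Gk k (y r)).
        by apply: is_derive_zz => //; case/andP: rr => sr _; exact: le_trans sr.
      apply: is_derive_eq; rewrite /GRing.scale/=; ring.
    by have := bd r rr; rewrite ler_norml -subr_ge0 opprK addrC => /andP[].
  by lra.
- have : C * s - zz y k s <= C * t - zz y k t.
    apply: (@nondecreasing_of_derive_all _ (fun r => C * r - zz y k r)
      (fun r => C - (- C * zz y k r + Gk k (y r))) s t st) => r rr.
      have dz : is_derive r 1 (zz y k) (- C * zz y k r + Gk k (y r)).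
        by apply: is_derive_zz => //; case/andP: rr => sr _; exact: le_trans sr.
      apply: is_derive_eq; rewrite /GRing.scale/=; ring.
    by have := bd r rr; rewrite ler_norml subr_ge0 => /andP[].
  by lra.
Qed.

Lemma max0_lip s t : `|Num.max 0 s - Num.max 0 t| <= `|s - t|.
Proof.
rewrite /Num.max; case: ltP => s0; case: ltP => t0; rewrite ?subrr ?normr0//.
  by rewrite subr0 gtr0_norm// (le_trans _ (ler_norm _))//; lra.
by rewrite sub0r normrN gtr0_norm// distrC (le_trans _ (ler_norm _))//; lra.
Qed.

Lemma max0_ge0 t : 0 <= Num.max 0 t. Proof. by rewrite le_max lexx. Qed.

Lemma picard_lip y k s t : good_path y ->
  `|picard y s ord0 k - picard y t ord0 k| <= C * `|s - t|.
Proof.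
move=> gy; rewrite !mxE; apply: (@le_trans _ _ (C * `|Num.max 0 s - Num.max 0 t|)); last first.
  by rewrite ler_pM2l// max0_lip.
move: (max0_ge0 s) (max0_ge0 t); move: (Num.max 0 s) (Num.max 0 t) => a b a0 b0.
have [ab|/ltW ba] := leP a b.
  by rewrite distrC [`|a - b|]distrC [`|b - a|]ger0_norm ?subr_ge0// zz_lip.
by rewrite [`|a - b|]ger0_norm ?subr_ge0// zz_lip.
Qed.

Lemma continuous_of_lip y : (forall k s t, `|y s ord0 k - y t ord0 k| <= C * `|s - t|) ->
  forall k, continuous (fun t => y t ord0 k).
Proof.
move=> hy k; apply: (@continuous_of_bound _ _ (fun t s => C * `|t - s|)) => [t s|t].
  exact: hy.
have h : C * `|t - s| @[s --> t] --> C * `|t - t|.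
  apply: cvgM; first exact: cvg_cst.
  by apply: cvg_norm; apply: cvgB; [exact: cvg_cst|exact: cvg_id].
by move: h; rewrite subrr normr0 mulr0.
Qed.

Lemma picard_good y : good_path y -> good_path (picard y).
Proof.
move=> gy; split=> [t|].
  split=> [k|]; first by rewrite mxE zz_ge0// max0_ge0.
  by under eq_bigr do rewrite mxE; rewrite zz_sum// max0_ge0.
by apply: continuous_of_lip => k s t; exact: picard_lip.
Qed.

(** Large enough that one Picard step halves the distance weighted by exp(-Lam t), on the whole
    half-line at once, so that time need not be subdivided. *)
Definition Lam : R := 2 * (q%:R * (L + C)).

Lemma zz_contract y y' (K : R) k t : good_path y -> good_path y' -> 0 <= K ->
  (forall s, 0 <= s -> d1 (y s) (y' s) <= K * expR (Lam * s)) -> 0 <= t ->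
  `|zz y k t - zz y' k t| <= (L + C) * K / (C + Lam) * expR (Lam * t).
Proof.
move=> gy gy' K0 hd t0.
have LC : 0 <= L + C by rewrite addr_ge0// ltW.
have Lm0 : 0 <= Lam by rewrite /Lam mulr_ge0// mulr_ge0.
have CL : 0 < C + Lam by rewrite ltr_wpDr.
set f := fun s => expR (C * s) * Gk k (y s).
set g := fun s => expR (C * s) * Gk k (y' s).
pose A := (L + C) * K.
have A0 : 0 <= A by rewrite mulr_ge0.
pose h s := A / (C + Lam) * expR ((C + Lam) * s).
have dh s : is_derive s 1 h (A * expR ((C + Lam) * s)).
  have de := is_derive_expM (C + Lam) s.
  rewrite /h; apply: is_derive_eq; rewrite /GRing.scale/=.
  by field; rewrite gt_eqF.
have fg s : 0 <= s -> `|f s - g s| <= A * expR ((C + Lam) * s).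
  move=> s0; rewrite /f /g -mulrBr normrM gtr0_norm ?expR_gt0//.
  rewrite [(C + Lam) * s]mulrDl expRD mulrCA ler_pM2l ?expR_gt0//.
  apply: (le_trans (Gk_lip k (gy.1 s) (gy'.1 s))).
  by rewrite /A -mulrA ler_wpM2l// hd.
have df s : 0 <= s -> is_derive s 1 (prim f) (f s).
  by move=> s0; apply: is_derive_prim => //; exact: continuous_Gk.
have dg s : 0 <= s -> is_derive s 1 (prim g) (g s).
  by move=> s0; apply: is_derive_prim => //; exact: continuous_Gk.
have up : `|prim f t - prim g t| <= h t.
  have h0 : 0 <= h 0 by rewrite /h mulr_ge0 ?expR_ge0// divr_ge0// ltW.
  rewrite ler_norml; apply/andP; split.
  - have : h 0 + (prim f 0 - prim g 0) <= h t + (prim f t - prim g t).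
      apply: (@nondecreasing_of_derive_all _ (fun s => h s + (prim f s - prim g s))
        (fun s => A * expR ((C + Lam) * s) + (f s - g s)) 0 t t0) => s /andP[s0 _].
        exact: is_deriveD (dh s) (is_deriveB (df s s0) (dg s s0)).
      by have := fg s s0; rewrite ler_norml -subr_ge0 opprK addrC => /andP[].
    by rewrite !prim0; lra.
  - have : h 0 - (prim f 0 - prim g 0) <= h t - (prim f t - prim g t).
      apply: (@nondecreasing_of_derive_all _ (fun s => h s - (prim f s - prim g s))
        (fun s => A * expR ((C + Lam) * s) - (f s - g s)) 0 t t0) => s /andP[s0 _].
        exact: is_deriveB (dh s) (is_deriveB (df s s0) (dg s s0)).
      by have := fg s s0; rewrite ler_norml subr_ge0 => /andP[].
    by rewrite !prim0; lra.
have -> : zz y k t - zz y' k t = expR (- (C * t)) * (prim f t - prim g t).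
  by rewrite /zz -/f -/g; ring.
rewrite normrM gtr0_norm ?expR_gt0//.
apply: (le_trans (ler_wpM2l (expR_ge0 _) up)).
rewrite /h mulrCA -/A ler_wpM2l//; first by rewrite divr_ge0// ltW.
by rewrite -expRD ler_expR; lra.
Qed.

Lemma picard_contract y y' (K : R) t : good_path y -> good_path y' -> 0 <= K ->
  (forall s, 0 <= s -> d1 (y s) (y' s) <= K * expR (Lam * s)) -> 0 <= t ->
  d1 (picard y t) (picard y' t) <= K / 2 * expR (Lam * t).
Proof.
move=> gy gy' K0 hd t0.
have LC : 0 < L + C by rewrite ltr_wpDl.
have Lm0 : 0 <= Lam by rewrite /Lam mulr_ge0// mulr_ge0// ltW.
apply: (@le_trans _ _ (\sum_(j : 'I_q) (L + C) * K / (C + Lam) * expR (Lam * t))).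
  apply: ler_sum => j _; rewrite !mxE; have -> : Num.max 0 t = t by apply/max_idPr.
  exact: zz_contract.
rewrite sumr_const card_ord -[X in X <= _]mulr_natl mulrA ler_wpM2r ?expR_ge0//.
have CL : 0 < C + Lam by rewrite ltr_wpDr.
rewrite !mulrA ler_pdivrMr// [leRHS]mulrAC ler_pdivlMr//.
have -> : q%:R * (L + C) * K * 2 = Lam * K by rewrite /Lam; ring.
by rewrite mulrC ler_wpM2l// lerDr ltW.
Qed.

Fixpoint Yn n : R -> 'rV[R]_q := if n is n'.+1 then picard (Yn n') else fun=> nu0.

Lemma Yn_good n : good_path (Yn n).
Proof.
elim: n => [|n IH] /=; last exact: picard_good.
by split=> // k t; exact: cvg_cst.
Qed.

Lemma Yn_step n t : 0 <= t -> d1 (Yn n.+1 t) (Yn n t) <= 2 * 2^-1 ^+ n * expR (Lam * t).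
Proof.
have Lm0 : 0 <= Lam by rewrite /Lam mulr_ge0// mulr_ge0// addr_ge0// ltW.
elim: n t => [|n IH] t t0.
  rewrite expr0 mulr1; apply: (le_trans (d1_le2 _ _)).
  - exact: (Yn_good 1).1.
  - exact: nu0_prob.
  - by rewrite ler_peMr// -(@expR0 R) ler_expR mulr_ge0.
have h := picard_contract (Yn_good n.+1) (Yn_good n) _ IH t0.
apply: (le_trans (h _)); first by rewrite mulr_ge0// exprn_ge0// invr_ge0.
by rewrite exprS; rewrite le_eqVlt; apply/orP; left; apply/eqP; field.
Qed.

(** The premise 0 <= t stands inside the existential so that the choice principle applies to all
    pairs (t, k). *)
Lemma Yn_limit t k : exists x, 0 <= t -> forall n,
  `|Yn n t ord0 k - x| <= 2 * (2 * expR (Lam * t)) * 2^-1 ^+ n.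
Proof.
have [t0|] := leP 0 t; last by exists 0.
have [x hx] : exists x, forall n, `|Yn n t ord0 k - x| <= 2 * (2 * expR (Lam * t)) * 2^-1 ^+ n.
  apply: (@geometric_limit R (fun n => Yn n t ord0 k)) => [|n].
    by rewrite mulr_ge0 ?expR_ge0.
  apply: (le_trans (le_d1 _ _ k)); apply: (le_trans (Yn_step n t0)).
  by rewrite le_eqVlt; apply/orP; left; apply/eqP; ring.
by exists x.
Qed.

Theorem flow_exists : exists phi : R -> 'rV[R]_q,
  [/\ phi 0 = nu0, good_path phi &
    forall t, 0 < t -> is_derive t (1 : R) phi (F (phi t))].
Proof.
have [g hg] : exists g : R -> 'I_q -> R, forall t k, 0 <= t -> forall n,
    `|Yn n t ord0 k - g t k| <= 2 * (2 * expR (Lam * t)) * 2^-1 ^+ n.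
  have [g hg] := choice (fun tk : R * 'I_q => Yn_limit tk.1 tk.2).
  by exists (fun t k => g (t, k)) => t k; exact: (hg (t, k)).
pose phi t : 'rV[R]_q := \row_k g (Num.max 0 t) k.
have hphi t k n : 0 <= t -> `|Yn n t ord0 k - phi t ord0 k| <= 2 * (2 * expR (Lam * t)) * 2^-1 ^+ n.
  by move=> t0; rewrite mxE (max_idPr t0); exact: hg.
have phimax t : phi (Num.max 0 t) = phi t.
  by apply/rowP => k; rewrite !mxE (max_idPr (max0_ge0 t)).
have prob0 t : 0 <= t -> probvec (phi t).
  move=> t0; split=> [k|].
    rewrite -oppr_le0; apply: (@le0_of_geometric _ _ (2 * (2 * expR (Lam * t)))) => n.
    have := hphi t k n t0; rewrite ler_norml => /andP[_ h]; apply: le_trans h.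
    by rewrite lerDr; exact: ((Yn_good n).1 t).1.
  have d0 : `|\sum_k phi t ord0 k - 1| <= 0.
    apply: (@le0_of_geometric _ _ (q%:R * (2 * (2 * expR (Lam * t))))) => n.
    have -> : \sum_k phi t ord0 k - 1 = \sum_k (phi t ord0 k - Yn n t ord0 k).
      by rewrite sumrB ((Yn_good n).1 t).2.
    rewrite (le_trans (ler_norm_sum _ _ _))//.
    apply: (@le_trans _ _ (\sum_(j : 'I_q) 2 * (2 * expR (Lam * t)) * 2^-1 ^+ n)).
      by apply: ler_sum => j _; rewrite distrC hphi.
    rewrite sumr_const card_ord -[X in X <= _]mulr_natl.
    by rewrite le_eqVlt; apply/orP; left; apply/eqP; ring.
  by move: d0; rewrite normr_le0 subr_eq0 => /eqP.
have prob t : probvec (phi t) by rewrite -phimax; apply: prob0; exact: max0_ge0.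
have lip0 k s t : 0 <= s -> 0 <= t -> `|phi s ord0 k - phi t ord0 k| <= C * `|s - t|.
  move=> s0 t0; rewrite -subr_le0.
  apply: (@le0_of_geometric _ _ (2 * (2 * expR (Lam * s)) + 2 * (2 * expR (Lam * t)))) => n.
  have h1 := hphi s k n.+1 s0; have h2 := hphi t k n.+1 t0.
  have h3 := picard_lip k s t (Yn_good n).
  rewrite -/(Yn n.+1) in h3.
  have : `|phi s ord0 k - phi t ord0 k| <= `|Yn n.+1 s ord0 k - phi s ord0 k| +
     `|Yn n.+1 t ord0 k - phi t ord0 k| + `|Yn n.+1 s ord0 k - Yn n.+1 t ord0 k|.
    have -> : phi s ord0 k - phi t ord0 k = - (Yn n.+1 s ord0 k - phi s ord0 k) +
      (Yn n.+1 t ord0 k - phi t ord0 k) + (Yn n.+1 s ord0 k - Yn n.+1 t ord0 k) by ring.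
    rewrite (le_trans (ler_normD _ _))// lerD2r (le_trans (ler_normD _ _))//.
    by rewrite normrN.
  have hn : (2^-1 : R) ^+ n.+1 <= 2^-1 ^+ n.
    by rewrite exprS ler_piMl ?exprn_ge0 ?invr_ge0// invf_le1// ler1n.
  have e0 r : 0 <= 2 * (2 * expR (Lam * r)) by rewrite !mulr_ge0 ?expR_ge0.
  have h1' := le_trans h1 (ler_wpM2l (e0 s) hn).
  have h2' := le_trans h2 (ler_wpM2l (e0 t) hn).
  rewrite mulrDl => h4.
  move: h1' h2' h3 h4 {h1 h2}.
  move: (2 * (2 * expR (Lam * s)) * _) (2 * (2 * expR (Lam * t)) * _) => b c.
  move: (C * _) `|phi s ord0 k - _| `|Yn n.+1 s ord0 k - phi _ _ _|
    `|Yn n.+1 t ord0 k - phi _ _ _| `|Yn n.+1 s ord0 k - Yn _ _ _ _| => *; lra.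
have lip k s t : `|phi s ord0 k - phi t ord0 k| <= C * `|s - t|.
  rewrite -(phimax s) -(phimax t).
  apply: (le_trans (lip0 _ _ _ (max0_ge0 s) (max0_ge0 t))).
  by rewrite ler_pM2l// max0_lip.
have gphi : good_path phi by split=> //; exact: continuous_of_lip.
(* Both phi and [picard phi] are within a geometric error of the next iterate: phi as the limit,
   [picard phi] by contraction from the distance of phi to the current iterate. *)
have fixphi t : 0 <= t -> phi t = picard phi t.
  move=> t0; apply/rowP => k; apply/eqP; rewrite -subr_eq0 -normr_le0.
  apply: (@le0_of_geometric _ _ (2 * (2 * expR (Lam * t)) + q%:R * 4 / 2 * expR (Lam * t))) => n.
  have hd s : 0 <= s -> d1 (Yn n s) (phi s) <= q%:R * 4 * 2^-1 ^+ n * expR (Lam * s).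
    move=> s0; apply: (@le_trans _ _ (\sum_(j : 'I_q) 2 * (2 * expR (Lam * s)) * 2^-1 ^+ n)).
      by apply: ler_sum => j _; exact: hphi.
    rewrite sumr_const card_ord -[X in X <= _]mulr_natl.
    by rewrite le_eqVlt; apply/orP; left; apply/eqP; ring.
  have K0 : 0 <= q%:R * 4 * 2^-1 ^+ n :> R by rewrite !mulr_ge0// exprn_ge0// invr_ge0.
  have h1 := le_trans (le_d1 _ _ k) (picard_contract (Yn_good n) gphi K0 hd t0).
  have h2 := hphi t k n.+1 t0.
  have hn : (2^-1 : R) ^+ n.+1 <= 2^-1 ^+ n.
    by rewrite exprS ler_piMl ?exprn_ge0 ?invr_ge0// invf_le1// ler1n.
  have e0 : 0 <= 2 * (2 * expR (Lam * t)) by rewrite !mulr_ge0 ?expR_ge0.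
  have h2' := le_trans h2 (ler_wpM2l e0 hn).
  have -> : phi t ord0 k - picard phi t ord0 k = - (Yn n.+1 t ord0 k - phi t ord0 k) +
     (picard (Yn n) t ord0 k - picard phi t ord0 k) by rewrite /=; ring.
  rewrite (le_trans (ler_normD _ _))// normrN mulrDl lerD//.
  apply: (le_trans h1).
  by rewrite le_eqVlt; apply/orP; left; apply/eqP; ring.
exists phi; split=> //.
  rewrite fixphi//; apply/rowP => k; rewrite mxE (max_idPr (lexx 0)).
  by rewrite /zz mulr0 oppr0 expR0 mul1r prim0 addr0.
move=> t t0; apply/is_derive_rV => k.
have dz := is_derive_zz k gphi (ltW t0).
have zE s : 0 <= s -> phi s ord0 k = zz phi k s.
  by move=> s0; rewrite fixphi// mxE (max_idPr s0).
have e : - C * zz phi k t + Gk k (phi t) = F (phi t) ord0 k.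
  by rewrite -zE ?(ltW t0)// /Gk; ring.
rewrite e in dz.
(* phi agrees with [zz phi k] only at times s >= 0; these fill a neighbourhood of t because t >
   0. *)
apply: (near_eq_is_derive _ dz) => //.
near=> s; rewrite zE//.
by apply: ltW; near: s; exact: lt_nbhsr.
Unshelve. all: by end_near.
Qed.

End SimplexFlow.

Section WithinContinuity.
Variables (R : realType) (A : set R).

Lemma within_continuous_sum (I : Type) (r : seq I) (f : I -> R -> R) :
  (forall i, {within A, continuous (f i)}) ->
  {within A, continuous (fun t => \sum_(i <- r) f i t)}.
Proof.
move=> cf; elim: r => [|i r IH].
  rewrite (_ : (fun t => _) = (fun=> 0)); last by apply/funext => t; rewrite big_nil.
  by move=> x; exact: cvg_cst.
rewrite (_ : (fun t => _) = (fun t => f i t + \sum_(j <- r) f j t)); last first.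
  by apply/funext => t; rewrite big_cons.
by move=> x; apply: cvgD; [exact: cf|exact: IH].
Qed.

Lemma within_continuousM (f g : R -> R) : {within A, continuous f} ->
  {within A, continuous g} -> {within A, continuous (fun t => f t * g t)}.
Proof. by move=> cf cg x; apply: cvgM; [exact: cf|exact: cg]. Qed.

Lemma within_continuousB (f g : R -> R) : {within A, continuous f} ->
  {within A, continuous g} -> {within A, continuous (fun t => f t - g t)}.
Proof. by move=> cf cg x; apply: cvgB; [exact: cf|exact: cg]. Qed.

Lemma within_continuousD (f g : R -> R) : {within A, continuous f} ->
  {within A, continuous g} -> {within A, continuous (fun t => f t + g t)}.
Proof. by move=> cf cg x; apply: cvgD; [exact: cf|exact: cg]. Qed.

Lemma within_continuous_coord q (f : R -> 'rV[R]_q) k : {within A, continuous f} ->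
  {within A, continuous (fun t => f t ord0 k)}.
Proof.
move=> cf x; apply: (@continuous_comp (subspace A) _ _ f (fun M => M ord0 k)).
  exact: cf.
exact: coord_continuous.
Qed.

Lemma within_continuous_expM (a : R) : {within A, continuous (fun t => expR (a * t))}.
Proof.
apply: continuous_subspaceT => t.
exact: is_derive_continuous (is_derive_expM a t).
Qed.

End WithinContinuity.

(** * Gronwall's argument in squared distance *)

Section Uniqueness.
Variables (R : realType) (q : nat) (F : 'rV[R]_q -> 'rV[R]_q) (L : R).
Hypothesis F_lip : forall v w k, probvec v -> probvec w ->
  `|F v ord0 k - F w ord0 k| <= L * d1 v w.

Definition sqdist (v w : 'rV[R]_q) : R := \sum_k (v ord0 k - w ord0 k) ^+ 2.

Lemma sqdist_ge0 v w : 0 <= sqdist v w.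
Proof. by apply: sumr_ge0 => k _; exact: sqr_ge0. Qed.

Lemma d1_sqr_le v w : d1 v w ^+ 2 <= q%:R * sqdist v w.
Proof.
rewrite expr2 /d1 mulr_suml.
have H j k : `|v ord0 j - w ord0 j| * `|v ord0 k - w ord0 k| <=
    ((v ord0 j - w ord0 j) ^+ 2 + (v ord0 k - w ord0 k) ^+ 2) / 2.
  rewrite -(real_normK (num_real (v ord0 j - w ord0 j))).
  rewrite -(real_normK (num_real (v ord0 k - w ord0 k))).
  by have := sqr_ge0 (`|v ord0 j - w ord0 j| - `|v ord0 k - w ord0 k|); lra.
apply: (@le_trans _ _ (\sum_j \sum_k
    ((v ord0 j - w ord0 j) ^+ 2 + (v ord0 k - w ord0 k) ^+ 2) / 2)).
  by apply: ler_sum => j _; rewrite mulr_sumr; apply: ler_sum => k _; exact: H.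
have -> : \sum_j \sum_k ((v ord0 j - w ord0 j) ^+ 2 + (v ord0 k - w ord0 k) ^+ 2) / 2 =
   q%:R * sqdist v w.
  under eq_bigr => j _.
    rewrite -mulr_suml big_split/= sumr_const card_ord -/(sqdist v w).
    over.
  rewrite -mulr_suml big_split/= sumr_const card_ord !sumrMnl -/(sqdist v w).
  by rewrite -[sqdist v w *+ q]mulr_natl; field.
by [].
Qed.

Lemma is_derive_sqdist (f g : R -> 'rV[R]_q) (t : R) (df dg : 'rV[R]_q) :
  is_derive t 1 f df -> is_derive t 1 g dg ->
  is_derive t 1 (fun s => sqdist (f s) (g s))
    (\sum_k 2 * (f t ord0 k - g t ord0 k) * (df ord0 k - dg ord0 k)).
Proof.
move=> /is_derive_rV hf /is_derive_rV hg.
have H k : is_derive t (1 : R) (fun s => (f s ord0 k - g s ord0 k) ^+ 2)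
    (2 * (f t ord0 k - g t ord0 k) * (df ord0 k - dg ord0 k)).
  have db := is_deriveB (hf k) (hg k).
  have := is_deriveM db db.
  rewrite (_ : (fun s => f s ord0 k) - _ = (fun s => f s ord0 k - g s ord0 k))//.
  move=> h; rewrite (_ : (fun s => _ ^+ 2) =
    (fun s => f s ord0 k - g s ord0 k) * (fun s => f s ord0 k - g s ord0 k)).
    by apply: is_derive_eq h _; rewrite /GRing.scale/=; ring.
  by apply/funext => s; rewrite expr2.
have := is_derive_sum H.
by rewrite (_ : \sum_k _ = (fun s => sqdist (f s) (g s)))//; apply/funext => s; rewrite fct_sumE.
Qed.

(** The squared distance, unlike [d1], is differentiable. Its derivative is at most 2 L d1^2 <= 2 L
    q sqdist, so with a = 2 L q its product with exp(-a s) is nonincreasing and starts at 0; [h]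
    carries a minus sign to fit the monotonicity lemma. *)
Lemma gronwall_sqdist (T : R) (f g : R -> 'rV[R]_q) : 0 <= L ->
  (forall t, 0 <= t <= T -> probvec (f t)) -> (forall t, 0 <= t <= T -> probvec (g t)) ->
  {within `[0, T], continuous f} -> {within `[0, T], continuous g} ->
  (forall t, 0 < t < T -> is_derive t (1 : R) f (F (f t))) ->
  (forall t, 0 < t < T -> is_derive t (1 : R) g (F (g t))) ->
  f 0 = g 0 -> forall t, 0 <= t <= T -> f t = g t.
Proof.
move=> L0 pf pg cf cg df dg fg0 t tT.
have /andP[t0 tT'] := tT.
pose a : R := 2 * L * q%:R.
pose E s := sqdist (f s) (g s).
have cE : {within `[0, t], continuous E}.
  apply: (@continuous_subspaceW _ _ _ `[0, T]).
    by move=> x /=; rewrite !in_itv/= => /andP[-> xt]; exact: le_trans xt tT'.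
  apply: within_continuous_sum => k; rewrite (_ : (fun s => _) =
     (fun s => (f s ord0 k - g s ord0 k) * (f s ord0 k - g s ord0 k))); last first.
    by apply/funext => s; rewrite expr2.
  have cd : {within `[0, T], continuous (fun s => f s ord0 k - g s ord0 k)}.
    by apply: within_continuousB; exact: within_continuous_coord.
  exact: within_continuousM.
pose h s := - 1 * (expR (- a * s) * E s).
have ch : {within `[0, t], continuous h}.
  apply: within_continuousM; first by move=> x; exact: cvg_cst.
  by apply: within_continuousM => //; exact: within_continuous_expM.
pose dE s := \sum_k 2 * (f s ord0 k - g s ord0 k) * (F (f s) ord0 k - F (g s) ord0 k).
pose dh s := expR (- a * s) * (a * E s - dE s).
have h0 : h 0 <= h t.
  apply: (@nondecreasing_of_derive _ h dh _ _ t0 ch) => s /andP[s0 st].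
    have sT : 0 < s < T by rewrite s0/=; exact: lt_le_trans tT'.
    have dEs : is_derive s 1 E (dE s) := is_derive_sqdist (df s sT) (dg s sT).
    have d2 := is_deriveM (is_derive_expM (- a) s) dEs.
    have d3 := is_deriveM (is_derive_cst (-1 : R) s 1) d2.
    apply: is_derive_eq d3 _.
    by rewrite /dh /GRing.scale/=; ring.
  have sT : 0 <= s <= T by rewrite (ltW s0)/=; exact: le_trans (ltW st) tT'.
  rewrite /dh mulr_ge0 ?expR_ge0// subr_ge0.
  apply: (@le_trans _ _ (\sum_k 2 * `|f s ord0 k - g s ord0 k| * (L * d1 (f s) (g s)))).
    apply: ler_sum => k _; rewrite -!mulrA ler_pM2l//.
    apply: (le_trans (ler_norm _)); rewrite normrM ler_wpM2l//.
    by apply: F_lip; [exact: pf|exact: pg].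
  rewrite -mulr_suml -mulr_sumr -/(d1 (f s) (g s)).
  have -> : 2 * d1 (f s) (g s) * (L * d1 (f s) (g s)) = 2 * L * (d1 (f s) (g s) ^+ 2) by ring.
  rewrite /a -[leRHS]mulrA ler_wpM2l ?mulr_ge0//; exact: d1_sqr_le.
have E0 : E 0 = 0 by rewrite /E /sqdist fg0 big1// => k _; rewrite subrr expr0n.
have Et : E t <= 0.
  move: h0; rewrite /h E0 !mulr0 mulN1r oppr_ge0.
  by rewrite pmulr_rle0 ?expR_gt0.
have Et0 : E t = 0 by apply/le_anti; rewrite Et sqdist_ge0.
apply/rowP => k; apply/eqP; rewrite -subr_eq0 -sqrf_eq0.
have := psumr_eq0P (fun j _ => sqr_ge0 (f t ord0 j - g t ord0 j)) Et0.
by move=> /(_ k isT) ->.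
Qed.

End Uniqueness.

Section EmpiricalODE.
Variables (R : realType) (q : nat).
Hypothesis q_gt1 : (1 < q)%N.
Variable beta : R.
Hypotheses (beta_gt0 : 0 < beta) (beta_lt : beta * sin (pi / q%:R) ^+ 2 < 1).
Implicit Types (v w : 'rV[R]_q) (k : 'I_q).

Definition flux k v : R := rate_c beta k v * v ord0 k.
Definition flux_lip : R := rbound q beta + rate_lip q beta.

Lemma flux_lip_ge0 : 0 <= flux_lip.
Proof. by rewrite addr_ge0 ?rate_lip_ge0// ltW// rbound_gt0. Qed.

Lemma flux_lipP k v w : probvec v -> probvec w ->
  `|flux k v - flux k w| <= flux_lip * d1 v w.
Proof.
move=> pv pw.
have -> : flux k v - flux k w = rate_c beta k v * (v ord0 k - w ord0 k) +
   (rate_c beta k v - rate_c beta k w) * w ord0 k.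
  rewrite /flux; move: (rate_c beta k v) (rate_c beta k w) => c c'.
  by ring.
apply: (le_trans (ler_normD _ _)); rewrite /flux_lip [leRHS]mulrDl; apply: lerD; rewrite normrM.
  apply: ler_pM => //; last exact: le_d1.
  by rewrite ger0_norm; [exact: rate_c_le|exact: rate_c_ge0].
rewrite [`|w ord0 k|]ger0_norm ?pw.1// -[leRHS]mulr1; apply: ler_pM => //.
- exact: pw.1.
- exact: rate_c_lip.
- exact: probvec_le1.
Qed.

Lemma FvecE v k : Fvec beta v ord0 k = flux (ord_pred k) v - flux k v.
Proof. by rewrite mxE. Qed.

Lemma Fvec_lip v w k : probvec v -> probvec w ->
  `|Fvec beta v ord0 k - Fvec beta w ord0 k| <= 2 * flux_lip * d1 v w.
Proof.
move=> pv pw; rewrite !FvecE.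
have -> : flux (ord_pred k) v - flux k v - (flux (ord_pred k) w - flux k w) =
  (flux (ord_pred k) v - flux (ord_pred k) w) - (flux k v - flux k w).
  move: (flux (ord_pred k) v) (flux k v) (flux (ord_pred k) w) (flux k w) => a b c d.
  by ring.
rewrite (le_trans (ler_normB _ _))// -mulrA mulr_natl mulr2n lerD//; exact: flux_lipP.
Qed.

Lemma Fvec_sum v : \sum_k Fvec beta v ord0 k = 0.
Proof.
under eq_bigr do rewrite FvecE.
rewrite sumrB [X in _ - X](reindex_inj (can_inj (@ord_predK q)))/=.
by rewrite subrr.
Qed.

(** The inflow is nonnegative and the outflow is at most [rbound] times the mass at k. This is the
    one-sided bound that keeps the flow in the simplex. *)
Lemma Fvec_ge v k : probvec v -> - (rbound q beta * v ord0 k) <= Fvec beta v ord0 k.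
Proof.
move=> pv; rewrite FvecE.
have h1 : 0 <= flux (ord_pred k) v by rewrite mulr_ge0 ?rate_c_ge0// pv.1.
have h2 : flux k v <= rbound q beta * v ord0 k.
  by apply: ler_wpM2r; [exact: pv.1|exact: rate_c_le].
move: h1 h2; move: (flux _ _) (flux _ _) (_ * _) => *; lra.
Qed.

Lemma empirical_ode_exists (Tf : R) (nu0 : 'rV[R]_q) : probvec nu0 ->
  exists phi, is_ode_sol beta Tf nu0 phi.
Proof.
move=> p0.
have [phi [phi0 gphi dphi]] := flow_exists (mulr_ge0 (ler0n _ 2) flux_lip_ge0)
  (rbound_gt0 q_gt1 beta) Fvec_lip (fun v _ => Fvec_sum v) Fvec_ge p0.
exists phi; split=> //.
- by move=> t _; exact: gphi.1.
- by apply: continuous_subspaceT; apply: continuous_rV; exact: gphi.2.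
- by move=> t /andP[t0 _]; exact: dphi.
Qed.

Lemma empirical_ode_unique (Tf : R) (nu0 : 'rV[R]_q) (phi psi : R -> 'rV[R]_q) :
  is_ode_sol beta Tf nu0 phi -> is_ode_sol beta Tf nu0 psi ->
  forall t, 0 <= t <= Tf -> psi t = phi t.
Proof.
move=> [f0 pf cf df] [g0 pg cg dg].
apply: (gronwall_sqdist Fvec_lip (mulr_ge0 (ler0n _ 2) flux_lip_ge0)) => //.
by rewrite f0 g0.
Qed.

End EmpiricalODE.

Section OneState.
Variables (R : realType) (beta : R).

Lemma probvec1 (v w : 'rV[R]_1) : probvec v -> probvec w -> v = w.
Proof.
move=> [_ v1] [_ w1]; apply/rowP => k; rewrite (ord1 k).
by move: v1 w1; rewrite !big_ord1 => -> ->.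
Qed.

Lemma one_state_ode (Tf : R) (nu0 : 'rV[R]_1) : probvec nu0 ->
  is_ode_sol beta Tf nu0 (fun=> nu0).
Proof.
move=> p0; split=> //.
  by apply: continuous_subspaceT => x; exact: cvg_cst.
move=> t _.
have -> : Fvec beta nu0 = 0.
  apply/rowP => k; rewrite !mxE; have -> : ord_pred k = k by rewrite (ord1 k); apply/val_inj.
  by rewrite subrr.
exact: is_derive_cst.
Qed.

End OneState.

(** * A maximal inequality for the jump process *)

Section TransitionFunction.
Variables (R : realType) (q N : nat) (beta : R).
Implicit Types (x y z : EN q N) (t : R).

Lemma cvg_pseries_fact (b : nat -> R) (A K r : R) : 0 <= A -> 0 <= K ->
  (forall n, `|b n| <= A * K ^+ n) -> cvgn (pseries (fun n => b n / n`!%:R) r).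
Proof.
move=> A0 K0 hb; apply: normed_cvg.
apply: (@series_le_cvg _ _ (fun n => A * exp_coeff (K * `|r|) n)) => [n|n|n|].
- exact: normr_ge0.
- by rewrite mulr_ge0// /exp_coeff/= divr_ge0// exprn_ge0// mulr_ge0.
- rewrite /= /exp_coeff/= normrM normrX normrM normfV [`|n`!%:R|]ger0_norm//.
  rewrite exprMn [leRHS]mulrA [A * _]mulrA mulrAC.
  by rewrite ler_wpM2r ?invr_ge0// ler_wpM2r// exprn_ge0.
- exact: (@is_cvg_seriesZ _ (exp_coeff (K * `|r|)) A (is_cvg_series_exp_coeff _)).
Qed.

Definition Qbound : R := \sum_(z : EN q N) \sum_(y : EN q N) `|QN beta z y|.

Lemma Qbound_ge0 : 0 <= Qbound.
Proof. by apply: sumr_ge0 => z _; apply: sumr_ge0. Qed.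

Lemma Qpow_le n x y : `|Qpow beta n x y| <= 1 * Qbound ^+ n.
Proof.
rewrite mul1r; elim: n y => [|n IH] y /=; first by case: (x == y); rewrite ?normr1 ?normr0 expr0.
rewrite (le_trans (ler_norm_sum _ _ _))//.
apply: (@le_trans _ _ (\sum_z Qbound ^+ n * `|QN beta z y|)).
  by apply: ler_sum => z _; rewrite normrM ler_wpM2r.
rewrite -mulr_sumr exprSr ler_wpM2l ?exprn_ge0 ?Qbound_ge0//.
apply: ler_sum => z _; rewrite (bigD1 y)//= lerDl; exact: sumr_ge0.
Qed.

(** The shift m records the order of differentiation in t: differentiating the exponential series
    termwise turns [Qcoef m] into [Qcoef m.+1]. *)
Definition Qcoef m x y (n : nat) : R := Qpow beta (n + m) x y / n`!%:R.

Lemma cvg_Qcoef m x y r : cvgn (pseries (Qcoef m x y) r).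
Proof.
apply: (@cvg_pseries_fact (fun n => Qpow beta (n + m) x y) (Qbound ^+ m) Qbound).
- by rewrite exprn_ge0// Qbound_ge0.
- exact: Qbound_ge0.
- by move=> n; rewrite -exprD addnC; have := Qpow_le (m + n) x y; rewrite mul1r.
Qed.

Lemma diffs_Qcoef m x y : pseries_diffs (Qcoef m x y) = Qcoef m.+1 x y.
Proof.
apply/funext => n; rewrite /pseries_diffs /Qcoef addnS addSn factS natrM.
by rewrite invfM mulrCA [n.+1%:R * _]mulrA mulfV ?pnatr_eq0// mul1r.
Qed.

Lemma PtNE t x y : PtN beta t x y = limn (pseries (Qcoef 0 x y) t).
Proof.
rewrite /PtN; congr (limn (series _)); apply/funext => n.
by rewrite /Qcoef/= addn0; ring.
Qed.

Lemma limn_sum (I : Type) (r : seq I) (u : I -> nat -> R) :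
  (forall i, cvgn (u i)) ->
  (fun n => \sum_(i <- r) u i n) @ \oo --> \sum_(i <- r) limn (u i).
Proof.
move=> cu; elim: r => [|i r IH].
  rewrite big_nil (_ : (fun n => _) = (fun=> 0)); first exact: cvg_cst.
  by apply/funext => n; rewrite big_nil.
rewrite big_cons (_ : (fun n => _) = (fun n => u i n + \sum_(j <- r) u j n)).
  by apply: cvgD IH; exact: cu.
by apply/funext => n; rewrite big_cons.
Qed.

(** Kolmogorov's forward equation, by termwise differentiation of the exponential series. *)
Lemma PtN_derive t x y :
  is_derive t (1 : R) (fun s => PtN beta s x y) (\sum_z PtN beta t x z * QN beta z y).
Proof.
have -> : (fun s => PtN beta s x y) = (fun s => limn (pseries (Qcoef 0 x y) s)).
  by apply/funext => s; exact: PtNE.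
have h := @pseries_snd_diffs R (Qcoef 0 x y) (`|t| + 1) t (@cvg_Qcoef _ _ _ _).
rewrite !diffs_Qcoef in h.
have {}h := h (@cvg_Qcoef _ _ _ _) (@cvg_Qcoef _ _ _ _) _.
apply: is_derive_eq (h _) _; first by rewrite [ltRHS]ger0_norm ?addr_ge0// ltrDl.
pose u z n := pseries (Qcoef 0 x z) t n * QN beta z y.
have cu z : cvgn (u z).
  by apply: is_cvgM; [exact: cvg_Qcoef|exact: is_cvg_cst].
apply: cvg_lim => //.
have := @limn_sum _ (index_enum _) u cu.
rewrite (_ : \sum_(i <- _) limn (u i) = \sum_z PtN beta t x z * QN beta z y).
  rewrite (_ : (fun n => _) = pseries (Qcoef 1 x y) t)//.
  apply/funext => n; rewrite /u /pseries /series/=.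
  under eq_bigr do rewrite mulr_suml.
  rewrite exchange_big/=; apply: eq_bigr => i _.
  rewrite /Qcoef addn0 addn1/= !mulr_suml; apply: eq_bigr => z _.
  by ring.
apply: eq_bigr => z _; rewrite PtNE; apply: cvg_lim => //.
by apply: cvgM; [exact: cvg_Qcoef|exact: cvg_cst].
Qed.

Lemma PtN0 x y : PtN beta 0 x y = (x == y)%:R.
Proof.
rewrite PtNE; apply: cvg_lim => //; rewrite -cvg_shiftS.
rewrite (_ : [sequence _]_n = (fun=> (x == y)%:R)); first exact: cvg_cst.
apply/funext => n; rewrite /pseries /series/= big_nat_recl//= expr0 mulr1.
rewrite /Qcoef/= divr1 big1 ?addr0// => i _; by rewrite exprS mul0r mulr0.
Qed.

End TransitionFunction.

(** * Ville's inequality along finite time grids *)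

Section MaximalInequality.
Variables (R : realType) (q N : nat) (beta : R) (d : measure_display).
Variables (Omega : measurableType d) (P : probability Omega R).
Variables (X : R -> Omega -> EN q N) (x0 : EN q N).
Hypothesis hX : is_MJP beta P X x0.
Implicit Types (s : seq (R * EN q N)) (t : R) (y z : EN q N) (A B : set Omega).

Let mX t (x : EN q N) : measurable [set w | X t w = x]. Proof. by case: hX. Qed.

Lemma measurable_state t (b : EN q N -> bool) : measurable [set w | b (X t w)].
Proof.
have -> : [set w | b (X t w)] =
    \big[setU/set0]_(x <- seq.filter b (index_enum (EN q N))) [set w | X t w = x].
  rewrite -bigcup_seq; apply/seteqP; split=> w /=.
    by move=> bw; exists (X t w) => //=; rewrite mem_filter bw mem_index_enum.
  by move=> [x /=]; rewrite mem_filter => /andP[bx _] ->.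
by apply: bigsetU_measurable => x _; exact: mX.
Qed.

Definition pr A : R := fine (P A).

Lemma prE A : measurable A -> P A = (pr A)%:E.
Proof. by move=> mA; rewrite /pr fineK//; exact: fin_num_measure. Qed.

Lemma pr_le A B : measurable A -> measurable B -> A `<=` B -> pr A <= pr B.
Proof. by move=> mA mB AB; rewrite -lee_fin -!prE//; apply: le_measure; rewrite ?inE. Qed.

Lemma pr_ge0 A : 0 <= pr A.
Proof. by rewrite /pr fine_ge0// measure_ge0. Qed.

Lemma pr_partition A t : measurable A ->
  pr A = \sum_(y : EN q N) pr (A `&` [set w | X t w = y]).
Proof.
move=> mA; apply: EFin_inj; rewrite -prE// -sumEFin.
rewrite (eq_bigr (fun y => P (A `&` [set w | X t w = y]))); last first.
  by move=> y _; rewrite prE//; exact: measurableI.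
have H r : uniq r -> P (A `&` [set w | X t w \in r]) =
    (\sum_(y <- r) P (A `&` [set w | X t w = y]))%E.
  elim: r => [|y r IH] /=.
    rewrite big_nil (_ : _ `&` _ = set0) ?measure0//.
    by apply/seteqP; split=> // w [].
  move=> /andP[yr ur]; rewrite big_cons -IH// -measureU.
  - congr (P _); apply/seteqP; split=> w /=.
      rewrite in_cons => -[Aw /orP[/eqP e|wr]]; [by left|by right].
    by rewrite in_cons => -[[Aw ->]|[Aw ->]]; rewrite ?eqxx ?orbT.
  - exact: measurableI.
  - by apply: measurableI => //; exact: (measurable_state t (fun z => z \in r)).
  - by rewrite -subset0 => w [[_ /= e1] [_ /= e2]]; move: yr; rewrite -e1 e2.
rewrite -H ?index_enum_uniq//; congr (P _); apply/seteqP; split=> w /=; last by case.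
by move=> Aw; split=> //; rewrite mem_index_enum.
Qed.

Definition cyl s : set Omega := [set w | all (fun p => X p.1 w == p.2) s].

Lemma measurable_cyl s : measurable (cyl s).
Proof.
rewrite /cyl; elim: s => [|p s IH] /=.
  by rewrite (_ : [set _ | _] = setT)//; apply/seteqP; split.
have -> : [set w | (X p.1 w == p.2) && all (fun p => X p.1 w == p.2) s] =
    [set w | X p.1 w == p.2] `&` [set w | all (fun p => X p.1 w == p.2) s].
  by apply/seteqP; split=> w /=; [move=> /andP[]|move=> [-> ->]].
by apply: measurableI => //; exact: (measurable_state p.1 (fun y => y == p.2)).
Qed.

Let lep (a b : R * EN q N) : bool := a.1 <= b.1.
Definition pp s : R := fdd_prod beta 0 x0 s.

Lemma pr_cyl s : path lep (0, x0) s -> pr (cyl s) = pp s.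
Proof. by case: hX => _ _ _ h ps; rewrite /pr /cyl h. Qed.

Lemma pp_ge0 s : path lep (0, x0) s -> 0 <= pp s.
Proof. by move=> /pr_cyl <-; exact: pr_ge0. Qed.

Lemma pp_rcons s t y : pp (rcons s (t, y)) =
  pp s * PtN beta (t - (last (0, x0) s).1) (last (0, x0) s).2 y.
Proof.
rewrite /pp; elim: s (0 : R) x0 => [|[t' z] s IH] r x /=.
  by rewrite mul1r mulr1.
by rewrite IH mulrA.
Qed.

Lemma path_rcons_lep s t y : path lep (0, x0) s -> (last (0, x0) s).1 <= t ->
  path lep (0, x0) (rcons s (t, y)).
Proof. by move=> ps lt; rewrite rcons_path ps. Qed.

Lemma path_last_ge0 s : path lep (0, x0) s -> 0 <= (last (0, x0) s).1.
Proof.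
elim/last_ind: s => [//|s p IH]; rewrite rcons_path last_rcons => /andP[/IH h lp].
exact: le_trans h lp.
Qed.

Variables (T : R) (W dW : R -> EN q N -> R).
Hypothesis W_ge0 : forall t z, 0 <= t <= T -> 0 <= W t z.
Hypothesis W_cont : forall z, {within `[0, T], continuous (W^~ z)}.
Hypothesis W_deriv : forall t z, 0 < t < T -> is_derive t (1 : R) (W^~ z) (dW t z).
Hypothesis W_gen : forall t z, 0 < t < T -> \sum_y QN beta z y * W t y + dW t z <= 0.

(* The weights [pp (rcons s (r, z))] are path probabilities, so they are nonnegative
   and the sign of the generator inequality survives averaging. *)
Lemma supermartingale s t : path lep (0, x0) s -> (last (0, x0) s).1 <= t -> t <= T ->
  \sum_y pp (rcons s (t, y)) * W t y <= pp s * W (last (0, x0) s).1 (last (0, x0) s).2.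
Proof.
move=> ps lt tT; set tl := (last (0, x0) s).1; set xl := (last (0, x0) s).2.
have tl0 : 0 <= tl by exact: path_last_ge0.
pose Pz r z := PtN beta (r - tl) xl z.
have dP r z : is_derive r (1 : R) (fun r => Pz r z) (\sum_y Pz r y * QN beta y z).
  have ds : is_derive r (1 : R) (fun r => r - tl) 1.
    by apply: is_derive_eq; rewrite subr0.
  have := @is_derive1_comp R (fun u => PtN beta u xl z) (fun r => r - tl) r _ _
    (PtN_derive beta (r - tl) xl z) ds.
  by rewrite mulr1.
(* [g r] is the expectation of W(r, X_r) on the event that the path follows s; by the forward
   equation its derivative averages the generator applied to W plus the time derivative of W. *)
pose g r := pp s * \sum_y Pz r y * W r y.
pose dg r := pp s * \sum_y (Pz r y * dW r y + W r y * (\sum_z Pz r z * QN beta z y)).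
have cg : {within `[tl, t], continuous (fun r => - 1 * g r)}.
  apply: within_continuousM; first by move=> x; exact: cvg_cst.
  apply: within_continuousM; first by move=> x; exact: cvg_cst.
  apply: within_continuous_sum => y; apply: within_continuousM.
    apply: continuous_subspaceT => r; exact: is_derive_continuous (dP r y).
  apply: (@continuous_subspaceW _ _ _ `[0, T]); last exact: W_cont.
  move=> x /=; rewrite !in_itv/= => /andP[h1 h2].
  by rewrite (le_trans tl0 h1) (le_trans h2 tT).
have hd r : tl < r < t -> is_derive r (1 : R) (fun r => - 1 * g r) (- 1 * dg r).
  move=> /andP[h1 h2].
  have rT : 0 < r < T by rewrite (le_lt_trans tl0 h1) (lt_le_trans h2 tT).
  have dsum (l : seq (EN q N)) (c : EN q N -> R) :
      (forall z, is_derive r (1 : R) (fun r => Pz r z) (c z)) ->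
      is_derive r (1 : R) (fun r => \sum_(y <- l) Pz r y * W r y)
      (\sum_(y <- l) (Pz r y * dW r y + W r y * c y)).
    move=> dc; elim: l => [|y l IH].
      rewrite big_nil (_ : (fun r => _) = cst 0); first exact: is_derive_cst.
      by apply/funext => u; rewrite big_nil.
    rewrite big_cons (_ : (fun r => _) =
        (fun r => Pz r y * W r y) + (fun r => \sum_(j <- l) Pz r j * W r j)).
      exact: (is_deriveD (is_deriveM (dc y) (W_deriv y rT)) IH).
    by apply/funext => u; rewrite big_cons.
  have d2 := is_deriveM (is_derive_cst (pp s) r 1) (dsum (index_enum _) _ (dP r)).
  have d3 := is_deriveM (is_derive_cst (-1 : R) r 1) d2.
  apply: is_derive_eq d3 _; rewrite /GRing.scale/= /dg.
  by move: (\sum_y _) (\sum_y _) => *; ring.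
have gmono : - 1 * g tl <= - 1 * g t.
  apply: (@nondecreasing_of_derive _ _ (fun r => - 1 * dg r) _ _ lt cg hd) => r /andP[h1 h2].
  have rT : 0 < r < T by rewrite (le_lt_trans tl0 h1) (lt_le_trans h2 tT).
  rewrite mulN1r oppr_ge0 /dg.
  have -> : \sum_y (Pz r y * dW r y + W r y * (\sum_z Pz r z * QN beta z y)) =
      \sum_z Pz r z * (\sum_y QN beta z y * W r y + dW r z).
    rewrite big_split/= addrC.
    have -> : \sum_y W r y * (\sum_z Pz r z * QN beta z y) =
        \sum_z Pz r z * (\sum_y QN beta z y * W r y).
      under eq_bigr do rewrite mulr_sumr.
      rewrite exchange_big/=; apply: eq_bigr => z _; rewrite mulr_sumr.
      by apply: eq_bigr => y _; rewrite mulrCA [W r y * _]mulrC.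
    by rewrite -big_split/=; apply: eq_bigr => z _; rewrite mulrDr.
  rewrite mulr_sumr; apply: sumr_le0 => z _; rewrite mulrA.
  have pz : 0 <= pp s * Pz r z.
    by rewrite -pp_rcons; apply: pp_ge0; apply: path_rcons_lep => //; exact: ltW.
  by apply: mulr_ge0_le0 => //; exact: W_gen.
have gtl : g tl = pp s * W tl xl.
  rewrite /g; congr (_ * _); rewrite (bigD1 xl)//= /Pz subrr PtN0 eqxx mul1r big1 ?addr0//.
  by move=> y; rewrite eq_sym => /negbTE yx; rewrite PtN0 yx mul0r.
have gt_ : g t = \sum_y pp (rcons s (t, y)) * W t y.
  by rewrite /g mulr_sumr; apply: eq_bigr => y _; rewrite pp_rcons mulrA.
by move: gmono; rewrite gtl gt_ !mulN1r lerN2.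
Qed.

Variable a : R.
Hypothesis a_gt0 : 0 < a.

Definition bad (ts : seq R) : set Omega := [set w | has (fun t => a <= W t (X t w)) ts].

Lemma measurable_bad ts : measurable (bad ts).
Proof.
rewrite /bad; elim: ts => [|t ts IH] /=.
  by rewrite (_ : [set _ | _] = set0)//; apply/seteqP; split.
have -> : [set w | (a <= W t (X t w)) || has (fun t => a <= W t (X t w)) ts] =
    [set w | a <= W t (X t w)] `|` [set w | has (fun t => a <= W t (X t w)) ts].
  by apply/seteqP; split=> w /=; [move=> /orP|move=> h; apply/orP].
by apply: measurableU => //; exact: (measurable_state t (fun y => a <= W t y)).
Qed.

(** Induction on the remaining times, splitting by the state y at the next time t. If W(t, y) >= a,
    the event has at most the probability of the longer prefix, hence at most that probability times
    W(t, y) / a; otherwise the induction hypothesis applies to the longer prefix. The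
    supermartingale property sums the branches. *)
Lemma maximal_ineq_prefix ts s : path lep (0, x0) s ->
  path <=%R (last (0, x0) s).1 ts -> (last (0, x0) s).1 <= T -> all (fun t => t <= T) ts ->
  pr (cyl s `&` bad ts) <= pp s * W (last (0, x0) s).1 (last (0, x0) s).2 / a.
Proof.
elim: ts s => [|t ts IH] s ps /=.
  move=> _ lT _; rewrite (_ : _ `&` _ = set0); last by apply/seteqP; split=> // w [].
  rewrite /pr measure0/=; rewrite divr_ge0 ?mulr_ge0 ?pp_ge0 ?(ltW a_gt0)//.
  by apply: W_ge0; rewrite path_last_ge0.
move=> /andP[lt pts] lT /andP[tT aT].
have t0 : 0 <= t by apply: le_trans lt; exact: path_last_ge0.
rewrite (@pr_partition _ t); last first.
  by apply: measurableI; [exact: measurable_cyl|exact: (measurable_bad (t :: ts))].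
apply: (@le_trans _ _ (\sum_y (pp (rcons s (t, y)) * W t y) / a)); last first.
  rewrite -mulr_suml ler_pM2r ?invr_gt0//; exact: supermartingale.
apply: ler_sum => y _.
have ps' : path lep (0, x0) (rcons s (t, y)) by exact: path_rcons_lep.
have mb : measurable (cyl s `&` bad (t :: ts) `&` [set w | X t w = y]).
  apply: measurableI; last exact: mX.
  by apply: measurableI; [exact: measurable_cyl|exact: (measurable_bad (t :: ts))].
have cylE w : cyl s w -> X t w = y -> cyl (rcons s (t, y)) w.
  by rewrite /cyl/= all_rcons/= => -> ->; rewrite eqxx.
have [ay|ya] := leP a (W t y).
  apply: (@le_trans _ _ (pr (cyl (rcons s (t, y))))).
    apply: pr_le => //; first exact: measurable_cyl.
    by move=> w [[cw _] xw]; exact: cylE.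
  by rewrite pr_cyl// -mulrA ler_peMr ?pp_ge0// ler_pdivlMr// mul1r.
apply: (@le_trans _ _ (pr (cyl (rcons s (t, y)) `&` bad ts))).
  apply: pr_le => //; first by apply: measurableI; [exact: measurable_cyl|exact: measurable_bad].
  move=> w [[cw bw] xw]; split; first exact: cylE.
  by move: bw; rewrite /bad/= xw leNgt ya.
by have := IH (rcons s (t, y)) ps'; rewrite last_rcons/= => /(_ pts tT aT).
Qed.

Lemma maximal_ineq ts : 0 <= T -> sorted <=%R ts -> all (fun t => 0 <= t <= T) ts ->
  pr (bad ts) <= W 0 x0 / a.
Proof.
move=> T0 sts ats.
have := @maximal_ineq_prefix ts [::] isT; rewrite /= /pp/= mul1r.
rewrite (_ : cyl [::] `&` bad ts = bad ts); last by apply/seteqP; split=> w; [case|split].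
apply=> //.
- by case: ts sts ats => //= t ts -> /andP[/andP[-> _] _].
- by apply: sub_all ats => t /andP[].
Qed.

End MaximalInequality.

(** * The law of large numbers *)

Section Generator.
Variables (R : realType) (q : nat).
Hypothesis q_gt1 : (1 < q)%N.
Variable beta : R.
Hypotheses (beta_gt0 : 0 < beta) (beta_lt : beta * sin (pi / q%:R) ^+ 2 < 1).
Implicit Types (v w : 'rV[R]_q) (k l : 'I_q) (n : nat).

Lemma iint_ge0 (ls : seq 'I_q) (g : seq R -> R) : (forall s, 0 <= g s) -> 0 <= iint ls g.
Proof.
elim: ls g => [|l ls IH] g g0 /=; first exact: g0.
by apply: Rintegral_ge0 => x _; apply: IH => s; exact: g0.
Qed.

Lemma rate_cN_ge0 n (x : EN q n) k : 0 <= rate_cN beta k x.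
Proof. by rewrite divr_ge0// iint_ge0// => s; exact: expR_ge0. Qed.

Definition jump k l : R := (l == ordS k)%:R - (l == k)%:R.

Lemma jump_abs k l : `|jump k l| <= 1.
Proof.
rewrite /jump; case: (l == ordS k); case: (l == k);
  by rewrite ?subrr ?subr0 ?sub0r ?normrN ?normr0 ?normr1.
Qed.

Lemma is_move_emb n (x y : EN q n.+1) k l : is_move x k y ->
  emb R y ord0 l = emb R x ord0 l + jump k l / n.+1%:R.
Proof.
move=> /forallP/(_ l)/eqP h; rewrite !mxE -mulrDl; congr (_ / _).
have := congr1 (fun z : int => z%:~R : R) h.
by rewrite !rmorphB !rmorphD/= /jump addrA.
Qed.

Lemma is_move_inj n (x y y' : EN q n) k : is_move x k y -> is_move x k y' -> y = y'.
Proof.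
move=> /forallP h /forallP h'; apply/val_inj/ffunP => l; apply/val_inj.
by have := h l; rewrite -(eqP (h' l)) => /eqP[].
Qed.

Lemma is_move_exists n (x : EN q n) k : (0 < val x k)%N -> exists y, is_move x k y.
Proof.
move=> xk; have sx : \sum_l (val x l : nat) = n by exact/eqP/(valP x).
(* Since q >= 2, source and target differ, also at the wrap-around from the last label. The particle
   in k then leaves room for one more at the target within the total n. *)
have Sk : ordS k != k.
  apply/eqP => /(congr1 val)/=; have := ltn_ord k; rewrite leq_eqVlt => /predU1P[e|lt_k].
    by rewrite e modnn => k0; move: e q_gt1; rewrite -k0 => <-.
  by rewrite modn_small// => /eqP; rewrite eqn_leq ltnn.
pose f l : nat := (val x l + (l == ordS k) - (l == k))%N.
have fle l : (f l < n.+1)%N.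
  rewrite ltnS /f; have [->|lS] := eqVneq l (ordS k).
    rewrite (negbTE Sk) subn0 addn1 -[X in (_ <= X)%N]sx (bigD1 (ordS k))//= (bigD1 k)/=;
      last by rewrite eq_sym.
    by rewrite -addn1 leq_add2l (leq_trans xk)// leq_addr.
  rewrite addn0 (leq_trans (leq_subr _ _))// -[X in (_ <= X)%N]sx (bigD1 l)//=; exact: leq_addr.
have sf : \sum_l f l = n.
  have e : (\sum_l f l + 1 = \sum_l (val x l : nat) + 1)%N.
    have <- : \sum_l (l == k : nat) = 1%N.
      by rewrite (bigD1 k)//= eqxx big1 ?addn0// => j /negbTE->.
    have {2}-> : \sum_l (l == k : nat) = \sum_l (l == ordS k : nat).
      rewrite (bigD1 k)//= eqxx big1 ?addn0; last by move=> j /negbTE->.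
      by rewrite (bigD1 (ordS k))//= eqxx big1 ?addn0// => j /negbTE->.
    rewrite -!big_split/=; apply: eq_bigr => l _; rewrite /f subnK//.
    by have [->|_] := eqVneq l k; rewrite ?(leq_trans xk) ?leq_addr.
  by apply/eqP; rewrite -(eqn_add2r 1) e sx.
have hy : \sum_l ([ffun l => Ordinal (fle l)] l : nat) == n.
  by rewrite -[X in _ == X]sf; apply/eqP; apply: eq_bigr => l _; rewrite ffunE.
exists (Sub [ffun l => Ordinal (fle l)] hy : EN q n).
apply/forallP => l; rewrite SubK ffunE/= /f.
have le1 : ((l == k) <= val x l + (l == ordS k))%N.
  by have [->|_] := eqVneq l k; rewrite ?(leq_trans xk) ?leq_addr.
by rewrite -subzn// PoszD.
Qed.

(** Each label k has either an empty source, and then zero weight, or exactly one target state, so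
    increments need bounding along genuine moves only. *)
Lemma QN_le n (x : EN q n.+1) (f : EN q n.+1 -> R) (B : 'I_q -> R) :
  (forall k y, is_move x k y -> f y - f x <= B k) ->
  \sum_y QN beta x y * f y <=
  \sum_k n.+1%:R * emb R x ord0 k * rate_cN beta k x * B k.
Proof.
move=> fB.
rewrite /QN; under eq_bigr do rewrite mulr_suml.
rewrite exchange_big/=; apply: ler_sum => k _.
set r := _ * _ * rate_cN beta k x.
have r0 : 0 <= r.
  apply: mulr_ge0; last exact: rate_cN_ge0.
  by apply: mulr_ge0; [exact: ler0n|exact: (probvec_emb R x).1].
under eq_bigr do rewrite -mulrA.
rewrite -mulr_sumr.
have [xk|xk] := posnP (val x k).
  have -> : r = 0 by rewrite /r mxE xk mul0r mulr0 mul0r.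
  by rewrite !mul0r.
rewrite ler_wpM2l//.
have [y hy] := is_move_exists xk.
apply: le_trans (fB k y hy).
under eq_bigr do rewrite mulrBl.
rewrite sumrB lerB//.
  rewrite (bigD1 y)//= hy mul1r big1 ?addr0// => z zy.
  case: (boolP (is_move x k z)) => [hz|]; last by rewrite mul0r.
  by move: zy; rewrite (is_move_inj hz hy) eqxx.
by rewrite (bigD1 x)//= eqxx mul1r big1 ?addr0// => z; rewrite eq_sym => /negbTE ->; rewrite mul0r.
Qed.

Lemma sqdist_move n (x y : EN q n.+1) k v : is_move x k y ->
  sqdist (emb R y) v - sqdist (emb R x) v <=
  2 / n.+1%:R * (\sum_l (emb R x ord0 l - v ord0 l) * jump k l) + q%:R / n.+1%:R ^+ 2.
Proof.
move=> m; rewrite /sqdist -sumrB mulr_sumr.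
have -> : q%:R / n.+1%:R ^+ 2 = \sum_(l < q) (n.+1%:R ^+ 2)^-1 :> R.
  by rewrite sumr_const card_ord mulr_natl.
rewrite -big_split/=; apply: ler_sum => l _; rewrite (is_move_emb l m).
have N0 : 0 < n.+1%:R :> R by rewrite ltr0n.
have j1 : jump k l ^+ 2 <= 1.
  by rewrite -(real_normK (num_real _)) expr_le1// jump_abs.
move: (emb R x ord0 l) (v ord0 l) (jump k l) j1 => a b c c1.
have -> : (a + c / n.+1%:R - b) ^+ 2 - (a - b) ^+ 2 =
  2 / n.+1%:R * ((a - b) * c) + c ^+ 2 / n.+1%:R ^+ 2 by field; rewrite gt_eqF.
by rewrite lerD2l -[leRHS]mul1r ler_wpM2r// invr_ge0 exprn_ge0// ltW.
Qed.

(** Summation by parts on the cycle: the field is the superposition of the jump directions weighted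
    by the fluxes. This puts the drift of the limit in the form of the generator sum. *)
Lemma Fvec_jump v (g : 'I_q -> R) :
  \sum_l g l * Fvec beta v ord0 l = \sum_k flux beta k v * (\sum_l g l * jump k l).
Proof.
have e1 k : \sum_l g l * jump k l = g (ordS k) - g k.
  rewrite /jump; under eq_bigr do rewrite mulrBr.
  rewrite sumrB (bigD1 (ordS k))//= eqxx mulr1 big1 ?addr0;
    last by move=> j /negbTE->; rewrite mulr0.
  by rewrite (bigD1 k)//= eqxx mulr1 big1 ?addr0// => j /negbTE->; rewrite mulr0.
under [RHS]eq_bigr do rewrite e1 mulrBr.
under [LHS]eq_bigr do rewrite FvecE mulrBr.
rewrite !sumrB; congr (_ - _); last by apply: eq_bigr => k _; rewrite mulrC.
rewrite (reindex_inj (can_inj (@ordSK q)))/=; apply: eq_bigr => k _.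
by rewrite ordSK mulrC.
Qed.

(** Each of the q transitions contributes 2 [flux_lip] d1^2, and d1^2 <= q [sqdist]. *)
Definition lyap_rate : R := 2 * q%:R ^+ 2 * flux_lip q beta.

Lemma lyap_rate_ge0 : 0 <= lyap_rate.
Proof. by rewrite !mulr_ge0 ?flux_lip_ge0. Qed.

(* The generator applied to the squared distance to [v], minus the drift of [v]
   under the limiting flow; only the rate error [e] and the O(1/N) jump size remain. *)
Lemma generator_sqdist n (x : EN q n.+1) v (e : R) : 0 <= e -> probvec v ->
  (forall k, (0 < val x k)%N -> `|rate_cN beta k x - rate_c beta k (emb R x)| <= e) ->
  \sum_k n.+1%:R * emb R x ord0 k * rate_cN beta k x *
    (2 / n.+1%:R * (\sum_l (emb R x ord0 l - v ord0 l) * jump k l) + q%:R / n.+1%:R ^+ 2)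
  - \sum_l 2 * (emb R x ord0 l - v ord0 l) * Fvec beta v ord0 l <=
  lyap_rate * sqdist (emb R x) v + (4 * q%:R * e + q%:R * (rbound q beta + e) / n.+1%:R).
Proof.
move=> e0 pv he.
have N0 : 0 < n.+1%:R :> R by rewrite ltr0n.
have px := probvec_emb R x.
set z := emb R x; set D := d1 z v.
have D0 : 0 <= D by exact: d1_ge0.
pose S k := \sum_l (z ord0 l - v ord0 l) * jump k l.
have SD k : `|S k| <= D.
  rewrite /S (le_trans (ler_norm_sum _ _ _))//; apply: ler_sum => l _.
  by rewrite normrM ler_piMr// jump_abs.
have -> : \sum_l 2 * (z ord0 l - v ord0 l) * Fvec beta v ord0 l =
    \sum_k 2 * (flux beta k v * S k).
  rewrite -mulr_sumr -Fvec_jump mulr_sumr; apply: eq_bigr => l _.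
  by rewrite mulrA.
rewrite -sumrB.
have step k : n.+1%:R * z ord0 k * rate_cN beta k x * (2 / n.+1%:R * S k + q%:R / n.+1%:R ^+ 2)
   - 2 * (flux beta k v * S k) <=
   2 * D * (e + flux_lip q beta * D) + q%:R / n.+1%:R * ((rbound q beta + e) * z ord0 k).
  have zc : `|z ord0 k * rate_cN beta k x - flux beta k z| <= e * z ord0 k.
    have [xk|xk] := posnP (val x k).
      by rewrite /flux /z mxE xk !mul0r mulr0 subrr normr0 mulr0.
    have -> : z ord0 k * rate_cN beta k x - flux beta k z =
        (rate_cN beta k x - rate_c beta k z) * z ord0 k.
      rewrite /flux; move: (rate_cN beta k x) (rate_c beta k z) => c c'.
      by ring.
    rewrite normrM [`|z ord0 k|]ger0_norm; last exact: px.1.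
    by apply: ler_wpM2r; [exact: px.1|exact: he].
  have z1 : z ord0 k <= 1 by exact: probvec_le1.
  have z0 : 0 <= z ord0 k by exact: px.1.
  have diff : `|z ord0 k * rate_cN beta k x - flux beta k v| <= e + flux_lip q beta * D.
    have -> : z ord0 k * rate_cN beta k x - flux beta k v =
       (z ord0 k * rate_cN beta k x - flux beta k z) + (flux beta k z - flux beta k v).
      by rewrite addrA subrK.
    apply: (le_trans (ler_normD _ _)); apply: lerD; last exact: flux_lipP.
    by apply: (le_trans zc); rewrite ler_piMr.
  have up : z ord0 k * rate_cN beta k x <= (rbound q beta + e) * z ord0 k.
    have fz : flux beta k z <= rbound q beta * z ord0 k.
      by apply: ler_wpM2r => //; exact: rate_c_le.
    have := le_trans (ler_norm _) zc.
    rewrite lerBlDr => h; apply: (le_trans h); rewrite mulrDl addrC.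
    by rewrite lerD2r.
  have main : 2 * ((z ord0 k * rate_cN beta k x - flux beta k v) * S k) <=
      2 * D * (e + flux_lip q beta * D).
    rewrite -mulrA ler_pM2l//; apply: (le_trans (ler_norm _)).
    by rewrite normrM [leRHS]mulrC; apply: ler_pM.
  have qN : 0 <= q%:R / n.+1%:R :> R by rewrite divr_ge0.
  have rest := ler_wpM2l qN up.
  move: main rest.
  move: (rate_cN beta k x) (flux beta k v) (S k) (z ord0 k) => c f s a main rest.
  have -> : n.+1%:R * a * c * (2 / n.+1%:R * s + q%:R / n.+1%:R ^+ 2) - 2 * (f * s) =
    2 * ((a * c - f) * s) + q%:R / n.+1%:R * (a * c) by field; rewrite gt_eqF.
  exact: lerD.
apply: (@le_trans _ _ (\sum_(k < q) (2 * D * (e + flux_lip q beta * D) +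
    q%:R / n.+1%:R * ((rbound q beta + e) * z ord0 k)))).
  by apply: ler_sum => k _; exact: step.
rewrite big_split/= sumr_const card_ord -mulr_sumr -mulr_sumr px.2 mulr1.
rewrite addrA [q%:R * _ / _]mulrAC lerD2r -[X in X <= _]mulr_natl.
have D2 : D <= 2 by exact: d1_le2.
have DV : D ^+ 2 <= q%:R * sqdist z v by exact: d1_sqr_le.
have -> : q%:R * (2 * D * (e + flux_lip q beta * D)) =
   (2 * q%:R * flux_lip q beta) * D ^+ 2 + (2 * q%:R * e) * D by ring.
apply: lerD.
  apply: (@le_trans _ _ ((2 * q%:R * flux_lip q beta) * (q%:R * sqdist z v))).
    by apply: ler_wpM2l => //; rewrite !mulr_ge0 ?flux_lip_ge0.
  rewrite /lyap_rate le_eqVlt; apply/orP; left; apply/eqP.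
  by move: (flux_lip q beta) (sqdist z v) => *; ring.
apply: (@le_trans _ _ ((2 * q%:R * e) * 2)); first by rewrite ler_wpM2l// !mulr_ge0.
by rewrite le_eqVlt; apply/orP; left; apply/eqP; ring.
Qed.

Definition lyap (delta T : R) v (t : R) n (x : EN q n.+1) : R :=
  expR (- lyap_rate * t) * sqdist (emb R x) v + delta * (T - t).

(** Time derivative of [lyap] when v moves along the limiting flow. *)
Definition dlyap (delta : R) v (t : R) n (x : EN q n.+1) : R :=
  expR (- lyap_rate * t) * (- lyap_rate * sqdist (emb R x) v -
    \sum_l 2 * (emb R x ord0 l - v ord0 l) * Fvec beta v ord0 l) - delta.

Lemma lyap_generator_le0 (delta : R) : 0 < delta -> exists n0, forall n, (n0 <= n)%N ->
  forall (x : EN q n.+1) v (t T : R), 0 <= t -> probvec v ->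
  \sum_y QN beta x y * lyap delta T v t y + dlyap delta v t x <= 0.
Proof.
move=> de0.
have q0 : 0 < q%:R :> R by rewrite ltr0n; case: q q_gt1.
(* The rate error may use half of delta, the jump-size error the other half. The cap at 1 lets [K]
   be chosen independently of e. *)
pose e := Num.min 1 (delta / (8 * q%:R)).
have e0 : 0 < e by rewrite lt_min ltr01 divr_gt0// mulr_gt0.
have e1 : e <= 1 by rewrite ge_min lexx.
have e2 : 4 * q%:R * e <= delta / 2.
  have h : e <= delta / (8 * q%:R) by rewrite ge_min lexx orbT.
  apply: (@le_trans _ _ (4 * q%:R * (delta / (8 * q%:R)))).
    by rewrite ler_wpM2l// mulr_ge0// ltW.
  by rewrite le_eqVlt; apply/orP; left; apply/eqP; field; rewrite gt_eqF.
have [n0 hn0] := rate_cN_cvg q_gt1 beta_gt0 beta_lt e0.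
have rb0 := rbound_gt0 q_gt1 beta.
pose K := q%:R * (rbound q beta + 1).
have K0 : 0 <= K by rewrite mulr_ge0// addr_ge0// ltW.
pose n1 := Num.truncn (2 * K / delta).
exists (maxn n0 n1) => n; rewrite geq_max => /andP[nn0 nn1] x v t T t0 pv.
have N0 : 0 < n.+1%:R :> R by rewrite ltr0n.
have KN : q%:R * (rbound q beta + e) / n.+1%:R <= delta / 2.
  rewrite ler_pdivrMr//; apply: (@le_trans _ _ K).
    by rewrite ler_wpM2l// lerD2l.
  have /andP[_ /ltW h] := truncn_itv (divr_ge0 (mulr_ge0 (ler0n R 2) K0) (ltW de0)).
  have : 2 * K / delta <= n.+1%:R by apply: (le_trans h); rewrite ler_nat ltnS.
  by rewrite ler_pdivrMr//; lra.
set E := expR (- lyap_rate * t).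
have E0 : 0 < E by exact: expR_gt0.
have E1 : E <= 1.
  by rewrite -(@expR0 R) ler_expR mulNr oppr_le0 mulr_ge0// lyap_rate_ge0.
have gs := @generator_sqdist n x v e (ltW e0) pv (hn0 n nn0 x).
have fB k y : is_move x k y -> lyap delta T v t y - lyap delta T v t x <=
    E * (2 / n.+1%:R * (\sum_l (emb R x ord0 l - v ord0 l) * jump k l) + q%:R / n.+1%:R ^+ 2).
  move=> m; have h := ler_wpM2l (ltW E0) (sqdist_move v m).
  apply: le_trans h; rewrite /lyap -/E.
  by move: (sqdist _ _) (sqdist _ _) => a b; rewrite le_eqVlt; apply/orP; left; apply/eqP; ring.
have h1 : \sum_y QN beta x y * lyap delta T v t y <= E *
    \sum_k n.+1%:R * emb R x ord0 k * rate_cN beta k x *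
    (2 / n.+1%:R * (\sum_l (emb R x ord0 l - v ord0 l) * jump k l) + q%:R / n.+1%:R ^+ 2).
  rewrite mulr_sumr; apply: (le_trans (QN_le fB)).
  by apply: ler_sum => k _; rewrite mulrCA.
rewrite /dlyap -/E.
move: gs h1; set G := \sum_k _; set dr := \sum_l 2 * _ * _; set V := sqdist _ _.
move=> gs h1.
apply: (@le_trans _ _ (E * (G - dr - lyap_rate * V) - delta)).
  move: h1; move: (\sum_y _) lyap_rate => a b h1.
  have -> : E * (G - dr - b * V) - delta = E * G + (E * (- b * V - dr) - delta) by ring.
  by rewrite lerD2r.
rewrite subr_le0; apply: (@le_trans _ _ (E * delta)); last by rewrite ler_piMl// ltW.
rewrite ler_pM2l//; move: gs e2 KN.
move: (4 * q%:R * e) (_ / n.+1%:R) (lyap_rate * V) => a b c; lra.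
Qed.

End Generator.

Section Norm.
Variables (R : realType) (q : nat) (nrm : 'rV[R]_q -> R).
Hypothesis nrmP : is_norm nrm.

Lemma nrm0 : nrm 0 = 0.
Proof. by case: nrmP => _ h _; rewrite -(scale0r 0) h normr0 mul0r. Qed.

Lemma nrmN x : nrm (- x) = nrm x.
Proof. by case: nrmP => _ h _; rewrite -scaleN1r h normrN1 mul1r. Qed.

Lemma nrm_ge0 x : 0 <= nrm x.
Proof.
case: nrmP => tri _ _; have := tri x (- x); rewrite subrr nrm0 nrmN.
by move: (nrm x) => a; lra.
Qed.

(** The summand 1 keeps the constant positive, for it occurs as a divisor below. *)
Definition nrm_const : R := 1 + \sum_k nrm (delta_mx ord0 k).

Lemma nrm_const_gt0 : 0 < nrm_const.
Proof. by rewrite ltr_wpDr// sumr_ge0// => k _; exact: nrm_ge0. Qed.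

Lemma nrm_le_d1 v w : nrm (v - w) <= nrm_const * d1 v w.
Proof.
case: nrmP => tri hom _.
have tsum (l : seq 'I_q) (f : 'I_q -> 'rV[R]_q) :
    nrm (\sum_(k <- l) f k) <= \sum_(k <- l) nrm (f k).
  elim: l => [|k l IH]; first by rewrite !big_nil nrm0.
  by rewrite !big_cons (le_trans (tri _ _))// lerD2l.
rewrite {1}(row_sum_delta (v - w)) (le_trans (tsum _ _))//.
rewrite mulrC /d1 mulr_suml ler_sum// => k _.
rewrite hom !mxE ler_wpM2l// /nrm_const (bigD1 k)//= addrCA lerDl.
by rewrite addr_ge0// sumr_ge0// => j _; exact: nrm_ge0.
Qed.

Lemma nrm_sqr_le v w : nrm (v - w) ^+ 2 <= nrm_const ^+ 2 * (q%:R * sqdist v w).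
Proof.
apply: (@le_trans _ _ ((nrm_const * d1 v w) ^+ 2)).
  by rewrite lerXn2r ?nnegrE ?nrm_ge0 ?mulr_ge0 ?d1_ge0 ?(ltW nrm_const_gt0) ?nrm_le_d1.
by rewrite exprMn ler_wpM2l ?d1_sqr_le// exprn_ge0// ltW// nrm_const_gt0.
Qed.

End Norm.

(** * A countable dense set of times *)

Section DenseTimes.
Variables (R : realType) (T : R).
Hypothesis T_gt0 : 0 < T.

(** Enumerates the nonnegative rationals, cut off at T, through codes of pairs. The cut-off makes T
    itself a value; numbers that code no pair yield time 0. *)
Definition grid_time (i : nat) : R :=
  let p := odflt (0, 0)%N (unpickle i : option (nat * nat)) in
  Num.min T (p.1%:R / p.2.+1%:R).

Lemma grid_time_itv i : 0 <= grid_time i <= T.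
Proof. by rewrite le_min ge_min lexx (ltW T_gt0)/= divr_ge0. Qed.

Lemma grid_time_end : exists i, grid_time i = T.
Proof.
exists (pickle ((Num.truncn T).+1, 0)%N); rewrite /grid_time pickleK/= divr1.
by apply/min_idPl/ltW; have /andP[] := truncn_itv (ltW T_gt0).
Qed.

Lemma grid_time_dense t e : 0 <= t -> t < T -> 0 < e ->
  exists i, t < grid_time i < t + e.
Proof.
move=> t0 tT e0.
have m0 : 0 < Num.min e (T - t) by rewrite lt_min e0 subr_gt0.
pose b := Num.truncn (Num.min e (T - t))^-1.
have b0 : 0 < b.+1%:R :> R by rewrite ltr0n.
have hb : b.+1%:R^-1 < Num.min e (T - t).
  rewrite invf_plt ?posrE//.
  have /andP[_] : b%:R <= (Num.min e (T - t))^-1 < b.+1%:R.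
    by apply: truncn_itv; rewrite invr_ge0 ltW.
  by [].
pose a := (Num.truncn (t * b.+1%:R)).+1.
have /andP[ha1 ha2] : (Num.truncn (t * b.+1%:R))%:R <= t * b.+1%:R < a%:R.
  by apply: truncn_itv; rewrite mulr_ge0.
have h1 : t < a%:R / b.+1%:R by rewrite ltr_pdivlMr.
have h2 : a%:R / b.+1%:R <= t + b.+1%:R^-1.
  by rewrite ler_pdivrMr// mulrDl mulVf ?gt_eqF// /a -natr1 lerD2r.
move: hb; rewrite lt_min => /andP[hb1 hb2].
exists (pickle (a, b)); rewrite /grid_time pickleK/=.
rewrite lt_min tT h1/= gt_min; apply/orP; right.
by apply: (le_lt_trans h2); rewrite ltrD2l.
Qed.

End DenseTimes.

Section SupremumBound.
Variables (R : realType) (q n : nat) (beta Tf eps : R).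
Hypothesis Tf_gt0 : 0 < Tf.
Variables (nu0 : 'rV[R]_q) (phi : R -> 'rV[R]_q).
Hypothesis phiP : is_ode_sol beta Tf nu0 phi.
Variable nrm : 'rV[R]_q -> R.
Hypothesis nrmP : is_norm nrm.
Variables (d : measure_display) (Omega : measurableType d) (P : probability Omega R).
Variables (X : R -> Omega -> EN q n.+1) (x0 : EN q n.+1).
Hypothesis hX : is_MJP beta P X x0.

Let far t w : bool := eps < nrm (emb R (X t w) - phi t).

(* Paths are right-continuous and [phi] is continuous, so the supremum over
   [0, Tf] is already seen along the countable dense set of grid times. *)
Lemma far_on_grid : [set w | exists t, 0 <= t <= Tf /\ eps < nrm (emb R (X t w) - phi t)] =
  \bigcup_m [set w | has (far^~ w) (mkseq (grid_time Tf) m)].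
Proof.
have hasP_grid w i : far (grid_time Tf i) w ->
    (\bigcup_m [set w | has (far^~ w) (mkseq (grid_time Tf) m)]) w.
  move=> fw.
  have h : has (far^~ w) (mkseq (grid_time Tf) i.+1).
    apply/hasP; exists (grid_time Tf i) => //.
    by apply: map_f; rewrite mem_iota add0n ltnS leqnn.
  by exists i.+1.
apply/seteqP; split=> w /=; last first.
  move=> [m _ /= /hasP[t /mapP[i _ ->] ft]]; exists (grid_time Tf i).
  by split=> //; exact: grid_time_itv.
move=> [t [/andP[t0 tT] ft]].
have [tTf|Tft] := ltP t Tf; last first.
  have [i hi] := grid_time_end Tf_gt0; apply: (hasP_grid w i).
  by rewrite hi /far (_ : Tf = t)//; apply/le_anti; rewrite Tft tT.
case: (hX) => _ rc _ _; have [dl dl0 hdl] := rc w t t0.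
case: (phiP) => _ _ cphi _.
have cd : {within `[0, Tf], continuous (fun s => d1 (phi s) (phi t))}.
  apply: within_continuous_sum => k x; apply: cvg_norm.
  apply: (@within_continuousB R `[0, Tf] (fun s => phi s ord0 k) (fun=> phi t ord0 k)).
    exact: within_continuous_coord.
  by move=> y; exact: cvg_cst.
pose e := (nrm (emb R (X t w) - phi t) - eps) / nrm_const nrm.
have Cn0 := nrm_const_gt0 nrmP.
have e0 : 0 < e by rewrite divr_gt0// subr_gt0.
have : \forall s \near within `[0, Tf] (nbhs t), d1 (phi s) (phi t) < e.
  have /subspace_continuousP/(_ t) := cd.
  rewrite /= in_itv/= t0 tT => /(_ isT)/cvgrPdist_lt/(_ _ e0).
  apply: filterS => s; rewrite /from_subspace/=.
  have -> : d1 (phi t) (phi t) = 0 by apply: big1 => k _; rewrite subrr normr0.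
  by rewrite sub0r normrN ger0_norm// d1_ge0.
move=> /nbhs_ballP[r /= r0 hr].
have m0 : 0 < Num.min r dl by rewrite lt_min r0.
have [i /andP[i1 i2]] := grid_time_dense t0 tTf m0.
set s := grid_time Tf i in i1 i2.
have [sr sd] : s < t + r /\ s < t + dl.
  move: i2; rewrite -!ltrBlDl lt_min => /andP[-> ->] //.
have hs : d1 (phi s) (phi t) < e.
  apply: hr; last by rewrite /= in_itv/=; exact: grid_time_itv.
  by rewrite /ball/= ltr0_norm ?subr_lt0// opprB ltrBlDl.
apply: (hasP_grid w i); rewrite /far -/s (hdl s) ?(ltW i1)//.
case: (nrmP) => tri _ _.
have h1 := tri (emb R (X t w) - phi s) (phi s - phi t).
have h2 := nrm_le_d1 nrmP (phi s) (phi t).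
have h3 : nrm_const nrm * d1 (phi s) (phi t) < nrm (emb R (X t w) - phi t) - eps.
  by rewrite mulrC -ltr_pdivlMr.
move: h1; rewrite addrA subrK; move: h2 h3.
move: (nrm _) (nrm _) (nrm _) (_ * _) => *; lra.
Qed.

Lemma measurable_far m : measurable [set w | has (far^~ w) (mkseq (grid_time Tf) m)].
Proof.
elim: (mkseq _ _) => [|t ts IH] /=.
  by rewrite (_ : [set _ | _] = set0)//; apply/seteqP; split.
have -> : [set w | far t w || has (far^~ w) ts] =
    [set w | far t w] `|` [set w | has (far^~ w) ts].
  by apply/seteqP; split=> w /=; [move=> /orP|move=> h; apply/orP].
apply: measurableU => //.
exact: (measurable_state hX t (fun y => eps < nrm (emb R y - phi t))).
Qed.

(** Continuity of the measure from below along the increasing finite grids; this is why [B] must not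
    depend on m. *)
Lemma prob_far_le (B : R) :
  (forall m, pr P [set w | has (far^~ w) (mkseq (grid_time Tf) m)] <= B) ->
  (P [set w | exists t, ((0 <= t <= Tf) /\ eps < nrm (emb R (X t w) - phi t))%R] <= B%:E)%E.
Proof.
move=> hB; rewrite far_on_grid.
pose F m := [set w | has (far^~ w) (mkseq (grid_time Tf) m)].
have mF m : measurable (F m) by exact: measurable_far.
have mbF : measurable (\bigcup_m F m) by exact: bigcup_measurable.
have ndF : nondecreasing_seq F.
  move=> a b ab; apply/subsetPset => w /= /hasP[t /mapP[i]].
  rewrite mem_iota add0n => /= ia -> fi; apply/hasP; exists (grid_time Tf i) => //.
  by apply: map_f; rewrite mem_iota add0n/= (leq_trans ia).
have cF := nondecreasing_cvg_mu (mu := P) mF mbF ndF.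
rewrite -(cvg_lim _ cF)//; apply: lime_le; first by apply/cvg_ex; eexists; exact: cF.
by apply: nearW => m /=; rewrite prE// lee_fin; exact: hB.
Qed.

End SupremumBound.

(** * Deviation bound and convergence in probability *)

Section Main.
Variables (R : realType) (q : nat).
Hypothesis q_gt1 : (1 < q)%N.
Variable beta : R.
Hypotheses (beta_gt0 : 0 < beta) (beta_lt : beta * sin (pi / q%:R) ^+ 2 < 1).
Variables (Tf eps : R).
Hypotheses (Tf_gt0 : 0 < Tf) (eps_gt0 : 0 < eps).
Variables (nu0 : 'rV[R]_q) (phi : R -> 'rV[R]_q) (nrm : 'rV[R]_q -> R).
Hypothesis phiP : is_ode_sol beta Tf nu0 phi.
Hypothesis nrmP : is_norm nrm.

(** A norm above eps forces eps^2 <= nrm_const^2 q sqdist, and exp(-lyap_rate t) is least at Tf; so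
    [lyap] is at least this level at every deviating time. *)
Definition far_level : R :=
  expR (- lyap_rate q beta * Tf) * (eps ^+ 2 / (nrm_const nrm ^+ 2 * q%:R)).

Let q_gt0 : 0 < q%:R :> R. Proof. by rewrite ltr0n; case: q q_gt1. Qed.

Lemma far_level_gt0 : 0 < far_level.
Proof.
by rewrite mulr_gt0 ?expR_gt0// divr_gt0 ?exprn_gt0// mulr_gt0// exprn_gt0// nrm_const_gt0.
Qed.

Lemma lyap_far (delta t : R) n (x : EN q n.+1) : 0 < delta -> 0 <= t <= Tf ->
  eps < nrm (emb R x - phi t) -> far_level <= lyap beta delta Tf (phi t) t x.
Proof.
move=> de0 /andP[t0 tT] ft; have C0 := nrm_const_gt0 nrmP.
apply: (@le_trans _ _ (expR (- lyap_rate q beta * t) * sqdist (emb R x) (phi t))); last first.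
  by rewrite lerDl mulr_ge0 ?subr_ge0// ltW.
apply: ler_pM; first exact: expR_ge0.
- by rewrite divr_ge0 ?mulr_ge0 ?exprn_ge0 ?ler0n// ltW.
- by rewrite ler_expR !mulNr lerN2 ler_wpM2l// lyap_rate_ge0.
rewrite ler_pdivrMr ?mulr_gt0 ?exprn_gt0//.
apply: (@le_trans _ _ (nrm (emb R x - phi t) ^+ 2)).
  by rewrite lerXn2r ?nnegrE ?nrm_ge0 ?(ltW eps_gt0) ?(ltW ft).
by have := nrm_sqr_le nrmP (emb R x) (phi t); rewrite mulrA [leRHS]mulrC.
Qed.

(** [n0] serves all processes and starting points, because the drift estimate is uniform in the
    macrostate. The numerator is the Lyapunov function at time 0. *)
Lemma deviation_bound (delta : R) : 0 < delta -> exists n0, forall n, (n0 <= n)%N ->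
  forall (d : measure_display) (Omega : measurableType d) (P : probability Omega R)
    (X : R -> Omega -> EN q n.+1) (x0 : EN q n.+1), is_MJP beta P X x0 ->
  (P [set w | exists t, ((0 <= t <= Tf) /\ eps < nrm (emb R (X t w) - phi t))%R] <=
    ((sqdist (emb R x0) nu0 + delta * Tf) / far_level)%:E)%E.
Proof.
move=> de0; have [n0 hn0] := lyap_generator_le0 q_gt1 beta_gt0 beta_lt de0.
exists n0 => n nn0 d Omega P X x0 hX.
have [phi0 pphi cphi dphi] := phiP.
apply: (prob_far_le Tf_gt0 phiP nrmP hX) => m.
pose W t z := lyap beta delta Tf (phi t) t (n := n) z.
pose dW t z := dlyap beta delta (phi t) t (n := n) z.
have W_ge0 t z : 0 <= t <= Tf -> 0 <= W t z.
  move=> /andP[t0 tT]; rewrite addr_ge0 ?mulr_ge0 ?expR_ge0 ?sqdist_ge0 ?subr_ge0//.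
  exact: ltW.
have W_cont z : {within `[0, Tf], continuous (W^~ z)}.
  apply: within_continuousD.
    apply: within_continuousM; first exact: within_continuous_expM.
    apply: within_continuous_sum => k.
    rewrite (_ : (fun t => _) = fun t =>
      (emb R z ord0 k - phi t ord0 k) * (emb R z ord0 k - phi t ord0 k)); last first.
      by apply/funext => t; rewrite expr2.
    have h : {within `[0, Tf], continuous (fun t => emb R z ord0 k - phi t ord0 k)}.
      by apply: within_continuousB; [move=> x; exact: cvg_cst|exact: within_continuous_coord].
    exact: within_continuousM.
  apply: within_continuousM; first by move=> x; exact: cvg_cst.
  apply: continuous_subspaceT => t; apply: cvgB; first exact: cvg_cst.
  exact: cvg_id.
have W_deriv t z : 0 < t < Tf -> is_derive t (1 : R) (W^~ z) (dW t z).
  move=> tT.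
  have d1 := is_derive_sqdist (is_derive_cst (emb R z) t 1) (dphi t tT).
  have d2 := is_deriveM (is_derive_expM (- lyap_rate q beta) t) d1.
  have d3 : is_derive t (1 : R) (fun s : R => Tf - s) (- 1).
    by apply: is_derive_eq (is_deriveB (is_derive_cst Tf t 1) (is_derive_id t 1)) _; rewrite sub0r.
  have d4 := is_deriveM (is_derive_cst delta t 1) d3.
  apply: is_derive_eq (is_deriveD d2 d4) _.
  rewrite /dW /dlyap /GRing.scale/=.
  have -> : \sum_k 2 * (cst (emb R z) t ord0 k - phi t ord0 k) *
       ((0 : 'rV[R]_q) ord0 k - Fvec beta (phi t) ord0 k) =
     - \sum_k 2 * (emb R z ord0 k - phi t ord0 k) * Fvec beta (phi t) ord0 k.
    by rewrite -sumrN; apply: eq_bigr => k _; rewrite [X in X - Fvec _ _ _ _]mxE sub0r mulrN.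
  move: (expR (- lyap_rate q beta * t)) (\sum_k _) (sqdist _ _) => E S V.
  by move: (lyap_rate q beta) => L; ring.
have W_gen t z : 0 < t < Tf -> \sum_y QN beta z y * W t y + dW t z <= 0.
  move=> /andP[t0 tT]; apply: hn0 => //; first exact: ltW.
  by apply: pphi; rewrite !ltW.
have W0 : W 0 x0 = sqdist (emb R x0) nu0 + delta * Tf.
  by rewrite /W /lyap mulr0 expR0 mul1r subr0 phi0.
rewrite -W0.
(* The enumeration of grid times is not monotone, whereas the maximal inequality needs a sorted
   list; sorting does not change the event. *)
pose ts := sort <=%R (mkseq (grid_time Tf) m).
have mem_ts t : (t \in ts) = (t \in mkseq (grid_time Tf) m) by rewrite mem_sort.
have ts_itv t : t \in ts -> 0 <= t <= Tf.
  by rewrite mem_ts => /mapP[i _ ->]; exact: grid_time_itv.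
have hm := @maximal_ineq _ _ _ _ _ _ _ _ _ hX Tf W dW W_ge0 W_cont W_deriv W_gen
  _ far_level_gt0 ts (ltW Tf_gt0).
apply: le_trans (hm _ _); last 2 first.
- exact: (sort_sorted (@le_total _ R)).
- by apply/allP => t; exact: ts_itv.
apply: pr_le; [exact: (measurable_far Tf eps phi nrm hX)|exact: (measurable_bad hX)|].
move=> w /= /hasP[t]; rewrite -mem_ts => tts ft; apply/hasP; exists t => //.
by apply: lyap_far => //; exact: ts_itv.
Qed.

Lemma sqdist_cvg0 (u : nat -> 'rV[R]_q) (v : 'rV[R]_q) :
  (forall k, (fun n => u n ord0 k) @ \oo --> v ord0 k) ->
  (fun n => sqdist (u n) v) @ \oo --> (0 : R).
Proof.
move=> hu; rewrite (_ : 0 = \sum_(k < q) (0 : R)); last by rewrite big1.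
apply: cvg_big => [|k _]; first exact: add_continuous.
have h : (fun n => u n ord0 k - v ord0 k) @ \oo --> (0 : R).
  by rewrite -(subrr (v ord0 k)); apply: cvgB => //; exact: cvg_cst.
under eq_cvg do rewrite expr2.
have hh := cvgM h h; rewrite mulr0 in hh; exact: hh.
Qed.

Lemma deviation_cvg0 (d : nat -> measure_display) (Omega : forall n, measurableType (d n))
    (P : forall n, probability (Omega n) R) (X : forall n, R -> Omega n -> EN q n.+1)
    (nu0N : forall n, EN q n.+1) :
  (forall k : 'I_q, (fun n => emb R (nu0N n) ord0 k) @ \oo --> nu0 ord0 k) ->
  (forall n, is_MJP beta (P n) (X n) (nu0N n)) ->
  (fun n => P n [set w | exists t, 0 <= t <= Tf /\
                        eps < nrm (emb R (X n t w) - phi t)]) @ \oo --> (0 : R)%:E.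
Proof.
move=> hnu hX; have a0 := far_level_gt0.
pose ev n := [set w | exists t, 0 <= t <= Tf /\ eps < nrm (emb R (X n t w) - phi t)].
have evm n : measurable (ev n).
  rewrite /ev (far_on_grid eps Tf_gt0 phiP nrmP (hX n)).
  by apply: bigcup_measurable => m _; exact: (measurable_far Tf eps phi nrm (hX n)).
rewrite (_ : (fun n => _) = (fun n => (pr (P n) (ev n))%:E)); last first.
  by apply/funext => n; rewrite -prE.
apply/cvg_EFin; first exact: nearW.
apply/cvgrPdist_le => e e0.
(* Then delta Tf / far_level = e / 2; the initial distance takes the other half. *)
pose delta := e * far_level / (2 * Tf).
have de0 : 0 < delta by rewrite (divr_gt0 (mulr_gt0 e0 a0))// mulr_gt0.
have [n0 hn0] := deviation_bound de0.
have ea0 : 0 < e * far_level / 2 by rewrite (divr_gt0 (mulr_gt0 e0 a0)).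
have /cvgrPdist_le/(_ _ ea0) hs := sqdist_cvg0 hnu.
near=> n.
have nn0 : (n0 <= n)%N by near: n; exists n0.
have := hn0 n nn0 _ _ (P n) (X n) (nu0N n) (hX n).
rewrite -/(ev n) prE// lee_fin => h.
rewrite /= sub0r normrN ger0_norm ?pr_ge0//; apply: (le_trans h).
rewrite ler_pdivrMr//.
have hsn : `|0 - sqdist (emb R (nu0N n)) nu0| <= e * far_level / 2 by near: n.
rewrite sub0r normrN ger0_norm ?sqdist_ge0// in hsn.
have -> : delta * Tf = e * far_level / 2 by rewrite /delta; field; rewrite gt_eqF.
by rewrite [leRHS](splitr (e * far_level)) lerD2r.
Unshelve. all: by end_near.
Qed.

End Main.

(* Population size N is written n.+1 (n : nat), so E_N is never empty;
   N -> oo is n -> oo. *)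
Theorem theorem1p5 (R : realType) (beta : R) (q : nat) (Tf : R)
    (nu0 : 'rV[R]_q) (nu0N : forall n : nat, EN q n.+1)
    (nrm : 'rV[R]_q -> R) :
  0 < beta ->
  beta * (sin (pi / q%:R)) ^+ 2 < 1 ->
  0 < Tf ->
  probvec nu0 ->
  (forall k : 'I_q, (fun n => emb R (nu0N n) ord0 k) @ \oo --> nu0 ord0 k) ->
  is_norm nrm ->
  (exists phi : R -> 'rV[R]_q, is_ode_sol beta Tf nu0 phi /\
     forall psi, is_ode_sol beta Tf nu0 psi ->
       forall t, 0 <= t <= Tf -> psi t = phi t)
  /\
  (forall phi : R -> 'rV[R]_q, is_ode_sol beta Tf nu0 phi ->
   forall (d : nat -> measure_display) (Omega : forall n, measurableType (d n))
          (P : forall n, probability (Omega n) R)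
          (X : forall n, R -> Omega n -> EN q n.+1),
   (forall n, is_MJP beta (P n) (X n) (nu0N n)) ->
   forall eps : R, 0 < eps ->
     (fun n => P n [set w | exists t, 0 <= t <= Tf /\
                        eps < nrm (emb R (X n t w) - phi t)]) @ \oo --> (0 : R)%:E).
Proof.
move=> beta_gt0 beta_lt Tf_gt0 p0 hnu nrmP.
(* For q <= 1 the number sin(pi / q) vanishes and no longer bounds the half-width of a cell. The
   value q = 0 contradicts total mass 1, and for q = 1 the simplex is a point, so nothing can
   deviate. *)
have [q1|q_gt1] := leqP q 1; last first.
  split; last first.
    move=> phi phiP d Omega P X hX eps eps_gt0.
    exact: (deviation_cvg0 q_gt1 beta_gt0 beta_lt Tf_gt0 eps_gt0 phiP nrmP hnu hX).
  have [phi phiP] := empirical_ode_exists q_gt1 beta_gt0 beta_lt Tf p0.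
  by exists phi; split=> // psi; exact: empirical_ode_unique.
have q1E : q = 1%N.
  move: (q) q1 (nu0) p0 => [|[|//]] // _ v [_].
  by rewrite big_ord0 => /esym/eqP; rewrite oner_eq0.
subst q; split.
  exists (fun=> nu0); split; first exact: one_state_ode.
  by move=> psi [_ ppsi _ _] t tT; exact: probvec1 (ppsi t tT) p0.
move=> phi [_ pphi _ _] d Omega P X _ eps eps_gt0.
rewrite (_ : (fun n => _) = (fun=> 0%E)); first exact: cvg_cst.
apply/funext => n; rewrite (_ : [set _ | _] = set0) ?measure0//.
apply/seteqP; split=> // w [t [tT]].
rewrite (probvec1 (probvec_emb R (X n t w)) (pphi t tT)) subrr nrm0//.
by rewrite ltNge ltW.
Qed.
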